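(* If $u_0\in L_2(\Omega,\dot H^\beta)$ and $\|A^{\frac{\beta-1}2}Q^{\frac12}\|_{\mathrm{HS}}<\infty$ for some $0\le\beta<1$, then there is a constant $C=C(T,u_0,\beta)$, independent of $\tau$ and $n$, such that for $0<\tau<\frac1{2L_f}$ the mild solution $u$ of the semilinear stochastic heat equation and the solution $u^n$ of the backward Euler scheme $$u^n+\tau Au^n=u^{n-1}+\tau f(u^n)+\Delta W^n,\quad n\ge1;\qquad u^0=u_0,$$ satisfy $$\big(\mathbb E\|u(t_n)-u^n\|^2\big)^{\frac12}\le C\,\tau^{\beta/2},\qquad t_n=n\tau\in[0,T].$$
   Context: Setting. $T>0$; $\mathcal D\subset\mathbb R^d$, $d\in\{1,2,3\}$, is a convex polygonal domain or a domain with smooth boundary; $H=L_2(\mathcal D)$ with norm $\|\cdot\|$ and inner product $(\cdot,\cdot)$; $Au=-\nabla\cdot(\kappa\nabla u)$ with $\kappa$ smooth, $\kappa(x)>\kappa_0>0$, with domain $H^2(\mathcal D)\cap H^1_0(\mathcal D)$ in $H$; it has an orthonormal eigenbasis $\{e_k\}$ with positive eigenvalues $\lambda_k\to\infty$; $A^sv=\sum_k\lambda_k^s(v,e_k)e_k$; $\dot H^\beta=D(A^{\beta/2})$ with norm $\|v\|_\beta=\|A^{\beta/2}v\|$; $\|v\|_{L_2(\Omega,\dot H^\beta)}=(\mathbb E\|v\|_\beta^2)^{1/2}$; $\mathrm e^{-tA}$ is the analytic semigroup generated by $-A$. $\|\cdot\|_{\mathrm{HS}}$ is the Hilbert–Schmidt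 norm on $H$. $f\colon H\to H$ satisfies $\|f(u)-f(v)\|\le L_f\|u-v\|$ for all $u,v\in H$ (if $L_f=0$, $\frac1{2L_f}$ is read as $\infty$). $W$ is a $Q$-Wiener process on a filtered probability space with normal filtration, with covariance operator $Q$ on $H$ (bounded, self-adjoint, positive semidefinite; cylindrical if $Q$ is not trace class, with $\mathrm e^{-tA}$ and $(I+\tau A)^{-1}$ applied to $\mathrm dW$ or increments in the usual It\^o sense); $\Delta W^n=W(t_n)-W(t_{n-1})$. The equation is $\mathrm du+Au\,\mathrm dt=f(u)\,\mathrm dt+\mathrm dW$, $u(0)=u_0$, and its mild solution is the unique solution (with $\sup_{t\in[0,T]}\mathbb E\|u(t)\|^2<\infty$) of $$u(t)=\mathrm e^{-tA}u_0+\int_0^t\mathrm e^{-(t-s)A}f(u(s))\,\mathrm ds+\int_0^t\mathrm e^{-(t-s)A}\,\mathrm dW(s).$$ The constant $C$ may also depend on the fixed data $A$, $Q$, $f$. *)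

(* Defs.v *)
From HB Require Import structures.
From mathcomp Require Import all_boot all_order all_algebra.
From mathcomp Require Import all_classical all_reals all_analysis.
From mathcomp Require Import measurable_realfun lra.

Set Implicit Arguments.
Unset Strict Implicit.
Unset Printing Implicit Defensive.

Import Order.TTheory GRing.Theory Num.Theory.
Import numFieldNormedType.Exports.

Local Open Scope classical_set_scope.
Local Open Scope ring_scope.
Local Open Scope quotient_scope.

(* hoelder.v provides the vector space [LfunType mu p1] of p-integrable
   functions, but its quotient by a.e. equality carries no algebraic or normed
   structure there; for p = 2 this section builds it. *)
Section L2_space.
Context d (T : measurableType d) (R : realType).
Variable mu : {measure set T -> \bar R}.

Local Notation fun2 := (LfunType mu (@lee1n R 2)).

Definition L2_eqv (f g : fun2) : bool :=
  `[< (f : T -> R) = (g : T -> R) %[ae mu] >].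

Let L2_eqv_refl : reflexive L2_eqv.
Proof. by move=> f; apply/asboolP; exact: ae_eq_refl. Qed.

Let L2_eqv_sym : symmetric L2_eqv.
Proof. by move=> f g; apply/idP/idP => /asboolP h; apply/asboolP/ae_eq_sym. Qed.

Let L2_eqv_trans : transitive L2_eqv.
Proof.
by move=> f g h /asboolP gf /asboolP fh; apply/asboolP/(ae_eq_trans gf fh).
Qed.

Canonical L2_eqv_canonical := EquivRel L2_eqv L2_eqv_refl L2_eqv_sym L2_eqv_trans.

Definition L2 : Type := {eq_quot L2_eqv}.
HB.instance Definition _ := Choice.on L2.
HB.instance Definition _ := EqQuotient.on L2.

Definition L2_of (f : fun2) : L2 := \pi_L2 f.
Definition L2_fun (u : L2) : fun2 := repr u.
Coercion L2_fun : L2 >-> LfunType.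

Lemma L2_ofE (f : fun2) : (L2_of f : T -> R) = f %[ae mu].
Proof.
rewrite /L2_fun /L2_of.
by case: piP => g /eqmodP /asboolP; apply: ae_eq_sym.
Qed.

Lemma L2P (u v : L2) : (u : T -> R) = v %[ae mu] -> u = v.
Proof. by move=> uv; rewrite -[u]reprK -[v]reprK; apply/eqmodP/asboolP. Qed.

Definition L2_zero : L2 := L2_of 0.
Definition L2_opp (u : L2) : L2 := L2_of (- L2_fun u).
Definition L2_add (u v : L2) : L2 := L2_of (L2_fun u + L2_fun v).
Definition L2_scale (a : R) (u : L2) : L2 := L2_of (a *: L2_fun u).
Definition L2_norm (u : L2) : R := fine ('N[mu]_2%:E[EFin \o u])%E.

Let zeroE : (L2_zero : T -> R) = cst 0 %[ae mu].
Proof. exact: L2_ofE. Qed.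

Let oppE u : (L2_opp u : T -> R) = (fun x => - u x) %[ae mu].
Proof. exact: L2_ofE. Qed.

Let addE u v : (L2_add u v : T -> R) = (fun x => u x + v x) %[ae mu].
Proof. exact: L2_ofE. Qed.

Let scaleE a u : (L2_scale a u : T -> R) = (fun x => a * u x) %[ae mu].
Proof. exact: L2_ofE. Qed.

Let addA : associative L2_add.
Proof.
move=> u v w; apply: L2P; near=> x => Dx.
rewrite (near (addE u (L2_add v w)) x)// (near (addE v w) x)//.
by rewrite (near (addE (L2_add u v) w) x)// (near (addE u v) x)// addrA.
Unshelve. all: by end_near. Qed.

Let addC : commutative L2_add.
Proof. by move=> u v; rewrite /L2_add addrC. Qed.

Let add0 : left_id L2_zero L2_add.
Proof.
move=> u; apply: L2P; near=> x => Dx.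
by rewrite (near (addE _ _) x)// (near zeroE x)// add0r.
Unshelve. all: by end_near. Qed.

Let addN : left_inverse L2_zero L2_opp L2_add.
Proof.
move=> u; apply: L2P; near=> x => Dx.
by rewrite (near (addE _ _) x)// (near (oppE _) x)// (near zeroE x)// addNr.
Unshelve. all: by end_near. Qed.

HB.instance Definition _ := GRing.isZmodule.Build L2 addA addC add0 addN.

Let scaleA a b u : L2_scale a (L2_scale b u) = L2_scale (a * b) u.
Proof.
apply: L2P; near=> x => Dx.
by rewrite (near (scaleE a _) x)// !(near (scaleE _ u) x)// mulrA.
Unshelve. all: by end_near. Qed.

Let scale1 : left_id 1 L2_scale.
Proof.
move=> u; apply: L2P; near=> x => Dx.
by rewrite (near (scaleE _ _) x)// mul1r.
Unshelve. all: by end_near. Qed.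

Let scaleDr : right_distributive L2_scale +%R.
Proof.
move=> a u v; apply: L2P; near=> x => Dx.
rewrite (near (scaleE _ _) x)// (near (addE u v) x)//.
by rewrite (near (addE (L2_scale a u) _) x)// !(near (scaleE a _) x)// mulrDr.
Unshelve. all: by end_near. Qed.

Let scaleDl u : {morph L2_scale^~ u : a b / a + b}.
Proof.
move=> a b; apply: L2P; near=> x => Dx.
rewrite (near (scaleE _ _) x)// (near (addE (L2_scale a u) _) x)//.
by rewrite !(near (scaleE _ u) x)// mulrDl.
Unshelve. all: by end_near. Qed.

HB.instance Definition _ :=
  GRing.Zmodule_isLmodule.Build R L2 scaleA scale1 scaleDr scaleDl.

Lemma ae_eq_Lnorm2 (f g : fun2) : (f : T -> R) = g %[ae mu] ->
  ('N[mu]_2%:E[EFin \o f] = 'N[mu]_2%:E[EFin \o g])%E.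
Proof.
move=> fg; rewrite unlock; congr (_ `^ _)%E.
have mp (h : fun2) : measurable_fun setT (fun x : T => `|h x| `^ 2).
  apply: (@measurableT_comp _ _ _ _ _ _ (@powR R ^~ 2)) => //.
  exact: measurableT_comp.
apply: ae_eq_integral => //.
- by have /measurable_EFinP := mp f.
- by have /measurable_EFinP := mp g.
- by apply: filterS fg => x /= fg Dx; rewrite fg.
Qed.

Let normD (u v : L2) : L2_norm (u + v) <= L2_norm u + L2_norm v.
Proof.
rewrite {1}/L2_norm (ae_eq_Lnorm2 (L2_ofE _)).
exact: (@ler_LnormD _ _ _ mu _ (@lee1n R 2)).
Qed.

Let normZ a (u : L2) : L2_norm (a *: u) = `|a| * L2_norm u.
Proof.
rewrite {1}/L2_norm (ae_eq_Lnorm2 (L2_ofE _)).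
rewrite (@LnormZ _ _ _ mu _ (@lee1n R 2)) fineM//.
rewrite ge0_fin_numE ?Lnorm_ge0//; exact: (@Lfunction_finite _ _ _ _ _ (@lee1n R 2)).
Qed.

Let norm0 (u : L2) : L2_norm u = 0 -> u = 0.
Proof.
move=> /(@fine_Lnormr_eq0 _ _ _ mu _ (@lee1n R 2)) u0.
apply: L2P; near=> x => Dx.
by rewrite (near u0 x)// (near zeroE x).
Unshelve. all: by end_near. Qed.

HB.instance Definition _ := Lmodule_isNormed.Build R L2 normD normZ norm0.

Definition L2_dot (u v : L2) : R := (\int[mu]_x (u x * v x))%R.

End L2_space.

Definition rV_display : measure_display. Proof. exact: default_measure_display. Qed.

(* the product sigma-algebra on R^n, which is also its Borel sigma-algebra *)
Section rV_measurable.
Context (R : realType) (n : nat).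

Definition rV_coord (i : 'I_n) (x : 'rV[R]_n) : measurableTypeR R := x ord0 i.

HB.instance Definition _ := @isMeasurable.Build rV_display
  'rV[R]_n (g_sigma_preimage rV_coord)
  (@sigma_algebra0 _ setT _) (@sigma_algebraC _ _) (@sigma_algebra_bigcup _ setT _).

Lemma measurable_rV_coord (i : 'I_n) :
  measurable_fun [set: 'rV[R]_n] (rV_coord i).
Proof.
move=> _ Y mY; apply: sub_sigma_algebra => /=.
rewrite -bigcup_seq/=; exists i => /=; first by rewrite mem_index_enum.
by exists Y.
Qed.

Lemma measurable_fun_rV d (T : measurableType d) (f : T -> 'rV[R]_n) :
  (forall i, measurable_fun [set: T] (fun t => rV_coord i (f t))) ->
  measurable_fun [set: T] f.
Proof.
move=> mf _ Y mY; rewrite setTI.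
suff : Y \in [set A | measurable (f @^-1` A)] by rewrite inE.
rewrite inE; move: Y mY; apply: smallest_sub.
  split => [|A mA|F mF] /=.
  - by rewrite preimage_set0.
  - by rewrite setTD preimage_setC; exact: measurableC.
  - by rewrite preimage_bigcup; exact: bigcupT_measurable.
move=> A; rewrite -bigcup_seq/= => -[i _ [B mB <-]].
rewrite setTI -comp_preimage -[X in measurable X]setTI; exact: mf.
Qed.

Lemma open_measurable_rV (U : set 'rV[R]_n) : open U -> measurable U.
Proof.
move=> oU.
pose qv (q : 'rV[rat]_n) : 'rV[R]_n := \row_j ratr (q ord0 j).
pose F (q : 'rV[rat]_n * nat) : set 'rV[R]_n :=
  [set y | ball (qv q.1) (q.2.+1%:R^-1 : R) `<=` U /\
    forall i, ball (qv q.1 ord0 i) (q.2.+1%:R^-1 : R) (rV_coord i y)].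
have mF q : measurable (F q).
  have [qU|qU] := pselect (ball (qv q.1) (q.2.+1%:R^-1 : R) `<=` U); last first.
    by rewrite [F q](_ : _ = set0)// -subset0 => y [].
  rewrite [F q](_ : _ = \big[setI/setT]_(i < n)
      rV_coord i @^-1` (ball (qv q.1 ord0 i) (q.2.+1%:R^-1 : R))).
    apply: bigsetI_measurable => i _; rewrite -[X in measurable X]setTI.
    apply: measurable_rV_coord => //.
    exact: measurable_ball.
  rewrite -bigcap_seq; apply/seteqP; split => [y [_ yb] i _ /=|y yb].
    exact: yb.
  by split => // i; apply: yb => /=; rewrite mem_index_enum.
suff -> : U = \bigcup_q F q by exact: countable_bigcupT_measurable.
apply/seteqP; split => [x Ux|x [q _ [qU qx]]]; last first.
  apply: qU; split => [|i j]; first by rewrite invr_gt0.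
  by rewrite ord1; exact: qx.
have [e /= e0 xeU] : exists2 e : R, 0 < e & ball x e `<=` U.
  by move: oU; rewrite openE => /(_ _ Ux) /nbhs_ballP[e /= e0 xeU]; exists e.
pose k := Num.truncn (2 / e).
have ke : 2 * k.+1%:R^-1 < e :> R.
  rewrite ltr_pdivrMr// mulrC -ltr_pdivrMr//; exact: truncnS_gt.
have /choice[q qx] (i : 'I_n) : exists q : rat, `|x ord0 i - ratr q| < k.+1%:R^-1.
  have [|q] := @rat_in_itvoo R (x ord0 i - k.+1%:R^-1) (x ord0 i + k.+1%:R^-1).
    by rewrite ltrD2l gtrN.
  rewrite in_itv/= => /andP[q1 q2]; exists q.
  by rewrite ltr_norml ltrBrDr addrC -ltrBrDr opprK q2 ltrBlDl -ltrBlDr q1.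
exists (\row_j q j, k) => //; split => [y [_ qy]|i] /=.
  apply: xeU; split => // i j; have -> : i = ord0 by exact: ord1.
  rewrite /ball/=.
  have := qy ord0 j; rewrite /ball/= !mxE => {}qy.
  apply: le_lt_trans (ler_distD (ratr (q j)) _ _) _.
  have tri (a b r : R) : a < r -> b < r -> 2 * r < e -> a + b < e by lra.
  exact: tri (qx j) qy ke.
rewrite /qv !mxE /ball/= distrC; exact: qx.
Qed.

End rV_measurable.

Section lebesgue_rV.
Context (R : realType).

Definition rV_snoc n (p : 'rV[R]_n * measurableTypeR R) : 'rV[R]_n.+1 :=
  \row_j (if unlift ord_max j is Some k then p.1 ord0 k else p.2).

Lemma measurable_rV_snoc n : measurable_fun setT (@rV_snoc n).
Proof.
apply: measurable_fun_rV => j.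
have [k jk|jmax] := unliftP ord_max j.
- rewrite (_ : (fun t => _) = @rV_coord R n k \o fst).
    by apply: measurableT_comp => //; exact: measurable_rV_coord.
  by apply/funext => t; rewrite /rV_coord/= mxE jk liftK.
- rewrite (_ : (fun t => _) = snd)//.
  by apply/funext => t; rewrite /rV_coord/= mxE jmax unlift_none.
Qed.

Section step.
Local Open Scope ereal_scope.
Context n (mu : {measure set 'rV[R]_n -> \bar R}).

Definition lebesgue_rV_step : set 'rV[R]_n.+1 -> \bar R :=
  pushforward (mu \x @lebesgue_measure R) (@rV_snoc n).

Let step0 : lebesgue_rV_step set0 = 0.
Proof. by rewrite /lebesgue_rV_step /pushforward preimage_set0 measure0. Qed.

Let step_ge0 A : 0 <= lebesgue_rV_step A.
Proof. by rewrite /lebesgue_rV_step /pushforward; exact: measure_ge0. Qed.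

Let step_sigma_additive : semi_sigma_additive lebesgue_rV_step.
Proof.
move=> F mF tF mUF; rewrite /lebesgue_rV_step /pushforward preimage_bigcup.
have mS (A : set 'rV[R]_n.+1) : measurable A -> measurable (@rV_snoc n @^-1` A).
  by move=> mA; rewrite -[X in measurable X]setTI; exact: measurable_rV_snoc.
apply: measure_semi_sigma_additive.
- by move=> k; exact: mS.
- apply/trivIsetP => /= i j _ _ ij; rewrite -preimage_setI.
  by move/trivIsetP : tF => /(_ _ _ _ _ ij) ->//; rewrite preimage_set0.
- by rewrite -preimage_bigcup; exact: mS.
Qed.

HB.instance Definition _ := isMeasure.Build _ _ _
  lebesgue_rV_step step0 step_ge0 step_sigma_additive.

End step.

Fixpoint lebesgue_rV n : {measure set 'rV[R]_n -> \bar R} :=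
  if n is m.+1 then lebesgue_rV_step (lebesgue_rV m) else \d_(0 : 'rV[R]_0).

End lebesgue_rV.

Section domain.
Context (R : realType) (d : nat).
Implicit Types (D : set 'rV[R]_d) (f : 'rV[R]_d -> R) (i : 'I_d).

Definition partial i f : 'rV[R]_d -> R := fun x => 'D_(delta_mx ord0 i) f x.

Definition smooth f : Prop :=
  forall (s : seq 'I_d) (x : 'rV[R]_d), differentiable (foldr partial f s) x.

Definition convex_polytope D : Prop :=
  exists (m : nat) (a : 'I_m -> 'rV[R]_d) (b : 'I_m -> R),
    D = [set x | forall j, \sum_(i < d) a j ord0 i * x ord0 i < b j].

(* near each boundary point, D is a strict sublevel set of a smooth function
   with nonvanishing gradient *)
Definition smooth_boundary D : Prop :=
  forall x0, closure D x0 -> ~ D x0 ->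
    exists psi : 'rV[R]_d -> R,
      [/\ smooth psi, exists i, partial i psi x0 != 0 &
          \forall x \near x0, D x <-> psi x < 0].

Record domain : Type := Domain {
  dom :> set 'rV[R]_d ;
  dom_open : open dom ;
  dom_nonempty : dom !=set0 ;
  dom_connected : connected dom ;
  dom_bounded : bounded_set dom ;
  dom_shape : convex_polytope dom \/ smooth_boundary dom
}.

End domain.

Section elliptic_operator.
Context (R : realType) (d : nat) (D : domain R d).

Definition dom_measure : {measure set 'rV[R]_d -> \bar R} :=
  mrestr (lebesgue_rV R d) (open_measurable_rV (@dom_open _ _ D)).

Definition test_fun (phi : 'rV[R]_d -> R) : Prop :=
  smooth phi /\ exists K : set 'rV[R]_d,
    [/\ compact K, K `<=` D & forall x, ~ K x -> phi x = 0].

Definition weak_partial (i : 'I_d) (u g : 'rV[R]_d -> R) : Prop :=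
  forall phi, test_fun phi ->
    (\int[dom_measure]_x (u x * partial i phi x))%R =
    - (\int[dom_measure]_x (g x * phi x))%R.

Definition in_H2 (u : L2 dom_measure) : Prop :=
  exists g : 'I_d -> L2 dom_measure, (forall i, weak_partial i u (g i)) /\
    forall i j, exists h : L2 dom_measure, weak_partial j (g i) h.

(* the H^1-closure of the test functions *)
Definition in_H10 (u : L2 dom_measure) : Prop :=
  exists (g : 'I_d -> L2 dom_measure) (phi : nat -> 'rV[R]_d -> R),
    [/\ forall i, weak_partial i u (g i),
        forall n, test_fun (phi n),
        (\int[dom_measure]_x ((u x - phi n x) ^+ 2)%:E)%E @[n --> \oo] --> 0%E &
        forall i, (\int[dom_measure]_x ((g i x - partial i (phi n) x) ^+ 2)%:E)%E
          @[n --> \oo] --> 0%E].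

(* graph of the operator: u is in H^2 and H^1_0, and w = - div (kappa grad u) *)
Definition elliptic_op (kappa : 'rV[R]_d -> R) (u w : L2 dom_measure) : Prop :=
  [/\ in_H2 u, in_H10 u &
    exists g h : 'I_d -> L2 dom_measure,
      [/\ forall i, weak_partial i u (g i),
          forall i, weak_partial i (fun x => kappa x * g i x) (h i) &
          w = - \sum_(i < d) h i]].

End elliptic_operator.

Section hilbert_space_operators.
Context d (T : measurableType d) (R : realType).
Variable mu : {measure set T -> \bar R}.
Local Notation H := (L2 mu).
Implicit Types (A : H -> H -> Prop) (B : H -> H) (S : R -> H -> H).

Definition bounded_linear B : Prop :=
  (forall a u v, B (a *: u + v) = a *: B u + B v) /\
  exists M : R, forall v, `|B v| <= M * `|v|.

Definition adjoint_op B Bs : Prop :=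
  bounded_linear Bs /\ forall u v, L2_dot (B u) v = L2_dot u (Bs v).

Definition nonneg_self_adjoint B : Prop :=
  [/\ bounded_linear B, forall u v, L2_dot (B u) v = L2_dot u (B v) &
      forall v, 0 <= L2_dot (B v) v].

Definition operator_sqrt B Bh : Prop :=
  nonneg_self_adjoint Bh /\ forall v, Bh (Bh v) = B v.

(* unbounded operators are given by their graphs A *)
Definition orthonormal_eigenbasis A (e : nat -> H) (lam : nat -> R) : Prop :=
  [/\ forall j k, L2_dot (e j) (e k) = (j == k)%:R,
      forall v, series (fun k => L2_dot v (e k) *: e k) @ \oo --> v,
      forall k, 0 < lam k,
      forall k, A (e k) (lam k *: e k) &
      lam @ \oo --> +oo].

Definition in_dom_power (e : nat -> H) (lam : nat -> R) (s : R) (v : H) : Prop :=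
  cvgn (series (fun k => (lam k `^ s * L2_dot v (e k)) *: e k)).

(* meaningful on vectors satisfying in_dom_power only *)
Definition power (e : nat -> H) (lam : nat -> R) (s : R) (v : H) : H :=
  limn (series (fun k => (lam k `^ s * L2_dot v (e k)) *: e k)).

(* the Hilbert-Schmidt norm, computed in the orthonormal basis e (its value
   does not depend on that choice) *)
Definition hs_norm_sq (e : nat -> H) B : \bar R :=
  (\sum_(k <oo) (`|B (e k)| ^+ 2)%:E)%E.

Definition hs_norm (e : nat -> H) B : \bar R := (hs_norm_sq e B `^ 2^-1)%E.

Definition semigroup_generated A S : Prop :=
  [/\ forall t, 0 <= t -> bounded_linear (S t),
      forall v, S 0 v = v,
      forall s t v, 0 <= s -> 0 <= t -> S (s + t) v = S s (S t v),
      forall v, {within `[0, +oo[, continuous (S ^~ v)} &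
      forall v w, A v w <->
        h^-1 *: (S h v - v) @[h --> 0^'+] --> - w].

(* Rs = (I + tau A)^-1 *)
Definition resolvent A (tau : R) Rs : Prop :=
  [/\ bounded_linear Rs,
      forall v, exists2 w, A (Rs v) w & Rs v + tau *: w = v &
      forall v w, A v w -> Rs (v + tau *: w) = v].

Definition bochner_integral (a b : R) (g : R -> H) (x : H) : Prop :=
  exists (N : nat -> nat) (E : nat -> nat -> set R) (c : nat -> nat -> H),
    let s m r := \sum_(i < N m) (\1_(E m i) r : R) *: c m i in
    [/\ forall m i, (i < N m)%N -> measurable (E m i) /\ E m i `<=` `[a, b],
        {ae @lebesgue_measure R, forall r, r \in `[a, b] -> s m r @[m --> \oo] --> g r},
        (\int[@lebesgue_measure R]_(r in `[a, b]) `|g r - s m r|%:E)%E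
          @[m --> \oo] --> 0%E &
        \sum_(i < N m) fine (@lebesgue_measure R (E m i)) *: c m i
          @[m --> \oo] --> x].

End hilbert_space_operators.

Section stochastic.
Context d (T : measurableType d) (R : realType).
Variable mu : {measure set T -> \bar R}.
Local Notation H := (L2 mu).
Context d' (Om : measurableType d') (P : probability Om R).

Definition measurable_wrt (G : set (set Om)) (X : Om -> H) : Prop :=
  forall U : set H, open U -> G (X @^-1` U).

Definition mean_sq (X : Om -> H) : \bar R := (\int[P]_w (`|X w| ^+ 2)%:E)%E.

Definition L2_Omega_norm (X : Om -> H) : \bar R := (mean_sq X `^ 2^-1)%E.

(* X is in L_2(Omega, D(A^s)), D(A^s) being normed by |A^s v| *)
Definition in_L2_Omega_power e lam (s : R) (X : Om -> H) : Prop :=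
  [/\ measurable_wrt measurable X,
      {ae P, forall w, in_dom_power e lam s (X w)} &
      (L2_Omega_norm (fun w => power e lam s (X w)) < +oo)%E].

Record normal_filtration (tT : R) (F : R -> set (set Om)) : Prop := {
  filtration_sigma : forall t, t \in `[0, tT] -> sigma_algebra setT (F t) ;
  filtration_sub : forall t, t \in `[0, tT] -> F t `<=` measurable ;
  filtration_incr : forall s t, 0 <= s -> s <= t -> t <= tT -> F s `<=` F t ;
  filtration_null : forall A, measurable A -> P A = 0%E -> F 0 A ;
  filtration_right : forall t A, t \in `[0, tT[ ->
    (forall s, t < s -> s <= tT -> F s A) -> F t A
}.

(* normal_prob 0 0 is not the Dirac mass, hence the case distinction *)
Definition centered_gaussian (X : Om -> R) (v : R) : Prop :=
  if v == 0 then {ae P, forall w, X w = 0}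
  else forall Y : set R, measurable Y ->
    P (X @^-1` Y) = normal_prob 0 (Num.sqrt v) Y.

Definition increment (W : R -> H -> Om -> R) (s t : R) (h : H) : Om -> R :=
  fun w => W t h w - W s h w.

(* The process is represented by the real processes W t h = (W(t), h), which
   also makes sense in the cylindrical case; an H-valued Q-Wiener process
   (Q of trace class) is the special case W t h w = L2_dot (V t w) h. *)
Record Q_wiener (tT : R) (F : R -> set (set Om)) (Q : H -> H)
    (W : R -> H -> Om -> R) : Prop := {
  wiener_adapted : forall t h (Y : set R), t \in `[0, tT] -> measurable Y ->
    F t (W t h @^-1` Y) ;
  wiener0 : forall h, {ae P, forall w, W 0 h w = 0} ;
  wiener_linear : forall t a h g, t \in `[0, tT] ->
    {ae P, forall w, W t (a *: h + g) w = a * W t h w + W t g w} ;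
  wiener_continuous : forall h,
    {ae P, forall w, {within `[0, tT], continuous (fun t => W t h w)}} ;
  wiener_gaussian : forall s t h, 0 <= s -> s <= t -> t <= tT ->
    centered_gaussian (increment W s t h) ((t - s) * L2_dot (Q h) h) ;
  wiener_indep : forall s t A B, 0 <= s -> s <= t -> t <= tT -> F s A ->
    <<s [set C | exists h (Y : set R),
           measurable Y /\ C = increment W s t h @^-1` Y] >> B ->
    P (A `&` B) = (P A * P B)%E
}.

(* Y = B X for a cylindrical random variable X, i.e. (Y, h) = X (B^* h) *)
Definition apply_cylindrical (B : H -> H) (X : H -> Om -> R) (Y : Om -> H) : Prop :=
  measurable_wrt measurable Y /\
  exists2 Bs, adjoint_op B Bs &
    forall h, {ae P, forall w, L2_dot (Y w) h = X (Bs h) w}.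

Record step_operator : Type := StepOperator {
  step_size : nat ;
  step_time : nat -> R ;
  step_val : nat -> H -> H
}.

Definition step_at (phi : step_operator) (r : R) (v : H) : H :=
  \sum_(i < step_size phi | step_time phi i < r <= step_time phi i.+1)
    step_val phi i v.

Definition step_on (e : nat -> H) (Qh : H -> H) (t : R) (phi : step_operator) : Prop :=
  [/\ step_time phi 0 = 0, step_time phi (step_size phi) = t &
      forall i, (i < step_size phi)%N ->
        [/\ step_time phi i <= step_time phi i.+1,
            bounded_linear (step_val phi i) &
            (hs_norm e (step_val phi i \o Qh) < +oo)%E]].

Definition step_integral (W : R -> H -> Om -> R) (phi : step_operator)
    (I : Om -> H) : Prop :=
  exists Y : nat -> Om -> H,
    (forall i, (i < step_size phi)%N ->
       apply_cylindrical (step_val phi i)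
         (increment W (step_time phi i) (step_time phi i.+1)) (Y i)) /\
    forall w, I w = \sum_(i < step_size phi) Y i w.

(* Z is the Ito integral of the deterministic operator-valued integrand Phi
   over [0, t] with respect to W *)
Definition ito_integral (e : nat -> H) (Qh : H -> H) (W : R -> H -> Om -> R)
    (t : R) (Phi : R -> H -> H) (Z : Om -> H) : Prop :=
  measurable_wrt measurable Z /\
  exists (phi : nat -> step_operator) (I : nat -> Om -> H),
    [/\ forall m, step_on e Qh t (phi m),
        forall m, step_integral W (phi m) (I m),
        (\int[@lebesgue_measure R]_(r in `[0%R, t])
            hs_norm_sq e (fun v => Phi r (Qh v) - step_at (phi m) r (Qh v))%R)%E
          @[m --> \oo] --> 0%E &
        mean_sq (fun w => I m w - Z w) @[m --> \oo] --> 0%E].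

Record mild_solution (tT : R) (F : R -> set (set Om)) (e : nat -> H)
    (Qh : H -> H) (W : R -> H -> Om -> R) (S : R -> H -> H) (f : H -> H)
    (u0 : Om -> H) (u : R -> Om -> H) : Prop := {
  mild_adapted : forall t, t \in `[0, tT] -> measurable_wrt (F t) (u t) ;
  mild_measurable : forall U : set H, open U ->
    measurable [set p : measurableTypeR R * Om | p.1 \in `[0, tT] /\ U (u p.1 p.2)] ;
  mild_bounded :
    (ereal_sup [set mean_sq (u t) | t in `[0%R, tT]] < +oo)%E ;
  mild_eq : forall t, t \in `[0, tT] ->
    exists2 Z, ito_integral e Qh W t (fun s => S (t - s)) Z &
      {ae P, forall w, exists2 J,
         bochner_integral 0 t (fun s => S (t - s) (f (u s w))) J &
         u t w = S t (u0 w) + J + Z w}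
}.

(* the scheme in the form
   u^n = (I + tau A)^-1 (u^(n-1) + tau f(u^n)) + (I + tau A)^-1 (W(t_n) - W(t_(n-1))),
   at all grid points t_n = n tau in [0, tT] *)
Definition backward_euler (tT : R) (W : R -> H -> Om -> R)
    (A : H -> H -> Prop) (f : H -> H) (u0 : Om -> H) (tau : R)
    (un : nat -> Om -> H) : Prop :=
  [/\ forall n, measurable_wrt measurable (un n),
      {ae P, forall w, un 0%N w = u0 w} &
      exists2 Rs, resolvent A tau Rs &
        forall n, n.+1%:R * tau <= tT ->
          exists2 Y,
            apply_cylindrical Rs (increment W (n%:R * tau) (n.+1%:R * tau)) Y &
            {ae P, forall w,
               un n.+1 w = Rs (un n w + tau *: f (un n.+1 w)) + Y w}].

End stochastic.

(* Main.v *)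
(* In the eigenbasis of A everything is diagonal. Mild solution and scheme are
   compared coordinate by coordinate: the k-th coordinate of u(t_n) integrates
   drift and noise against exp(-lam_k (t_n - r)), that of u^n against the step
   function with values (1 + tau lam_k)^-(n-i) on (t_i, t_(i+1)]. The squared
   L2-distance of these two kernels is at most tau and at most 2 / lam_k, hence
   at most 2 tau^beta lam_k^(beta-1), which is summable against the hypothesis
   on A^((beta-1)/2) Q^(1/2); the initial value is treated in the same way. The
   same estimates give a bound on E |u(t)|^2 that depends on the data only
   (by an exponentially weighted fixed-point argument) and the regularity
   E |u(t) - u(s)|^2 <= C |t - s|^beta, so that replacing f(u(r)) by
   f(u(t_(i+1))) on each step is harmless. The remaining difference
   f(u(t_(i+1))) - f(u^(i+1)) is absorbed by a discrete Gronwall inequality,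
   applied path by path.

   The noise enters through second moments only: increments over disjoint
   intervals are uncorrelated, which yields the Ito isometry for step functions,
   and in the limit an inequality with constant 4 suffices. *)

Require Import Defs.
From HB Require Import structures.
From mathcomp Require Import all_boot all_order all_algebra.
From mathcomp Require Import all_classical all_reals all_analysis.
From mathcomp Require Import measurable_realfun ring lra.

Set Implicit Arguments.
Unset Strict Implicit.
Unset Printing Implicit Defensive.

Import Order.TTheory GRing.Theory Num.Theory.
Import numFieldNormedType.Exports.

Local Open Scope classical_set_scope.
Local Open Scope ring_scope.

(** * The Hilbert space L2 *)

(** Two constraints shape the proof. The constant is chosen before noise, solution and [tau], so
    nothing taken from a particular solution may enter it: the finite supremum that comes with a
    mild solution only starts an iteration whose outcome depends on the data. And [f] is merely
    Lipschitz, so the feedback of the scheme error through [f] cannot be expanded. It is subtracted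
    instead ([truncation_error]); the remainder is linear in initial value, exact drift,
    frozen-drift defect and noise, its second moment is bounded mode by mode ([coord_bound]), and
    the feedback is then restored on each path. Drift and noise ask different things of the same
    kernels. The coordinates of the drift are summed by Parseval, so a bound uniform in the
    eigenvalue is enough; those of the noise are summable only with the weight lam_k^(beta-1), and
    interpolation between two kernel bounds produces it. Norms of differences in [H] are bounded by
    measurable majorants ([integral_bound]), so their own measurability is never at stake. *)

Section integral_extra.
Context d (T : measurableType d) (R : realType) (mu : {measure set T -> \bar R}).

(** The integral of a nonnegative function is a supremum over simple functions below it, so it is
    monotone whether or not the functions are measurable. Integrands whose measurability is left
    open are compared this way. *)
Lemma ge0_le_integral_nonmeas (D : set T) (f g : T -> \bar R) :
  (forall x, D x -> (0 <= f x)%E) -> (forall x, D x -> (f x <= g x)%E) ->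
  (\int[mu]_(x in D) f x <= \int[mu]_(x in D) g x)%E.
Proof.
move=> f0 fg; have g0 x : D x -> (0 <= g x)%E by move=> Dx; exact: (le_trans (f0 x Dx) (fg x Dx)).
rewrite !ge0_integralE//; apply: le_ereal_sup => _ /= [h hf <-]; exists h => //= x.
apply: le_trans (hf x) _; exact: lee_restrict.
Qed.

Lemma ae_eq_Rintegral (f g : T -> R) : measurable_fun setT f -> measurable_fun setT g ->
  f = g %[ae mu] -> (\int[mu]_x f x = \int[mu]_x g x)%R.
Proof.
move=> mf mg fg; congr fine; apply: ae_eq_integral => //; try exact/measurable_EFinP.
by apply: filterS fg => x /= h Dx; rewrite h.
Qed.

End integral_extra.

Section dot.
Context d (T : measurableType d) (R : realType) (mu : {measure set T -> \bar R}).
Local Notation H := (L2 mu).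
Implicit Types u v w : H.

Lemma measurable_L2 u : measurable_fun setT (u : T -> R).
Proof. exact: measurable_funP. Qed.
Hint Resolve measurable_L2 : core.

Lemma L2_Lfun u : (u : T -> R) \in Lfun mu 2%:E.
Proof. exact: LfunP. Qed.

Lemma L2_mul_integrable u v : mu.-integrable setT (EFin \o (fun x => u x * v x)).
Proof. by apply/Lfun1_integrable; apply: Lfun2_mul_Lfun1; exact: L2_Lfun. Qed.

Lemma L2_sqr_integral u : (\int[mu]_x ((u x) ^+ 2)%:E = (`|u| ^+ 2)%:E)%E.
Proof.
have pw := @powR_Lnorm d T R mu (EFin \o u) 2.
rewrite {1}/Num.norm/= /L2_norm.
have fin : ('N[mu]_2%:E[EFin \o u])%E \is a fin_num.
  rewrite ge0_fin_numE ?Lnorm_ge0//; exact: (@Lfunction_finite _ _ _ _ _ (@lee1n R 2)).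
rewrite -powR_mulrn ?fine_ge0 ?Lnorm_ge0// -poweR_EFin fineK// pw//.
apply: eq_integral => x _ /=.
by rewrite powR_mulrn// real_normK// num_real.
Qed.

Lemma L2_dotC u v : L2_dot u v = L2_dot v u.
Proof. by apply: eq_Rintegral => x _; rewrite mulrC. Qed.

Lemma L2_dotDl u v w : L2_dot (u + v) w = L2_dot u w + L2_dot v w.
Proof.
rewrite /L2_dot -RintegralD//; try exact: L2_mul_integrable.
apply: ae_eq_Rintegral; [exact: measurable_funM|by apply: measurable_funD; exact: measurable_funM|].
by apply: filterS (L2_ofE (L2_fun u + L2_fun v)) => x /= h Dx; rewrite h// mulrDl.
Qed.

Lemma L2_dotZl a u w : L2_dot (a *: u) w = a * L2_dot u w.
Proof.
rewrite /L2_dot -RintegralZl//; try exact: L2_mul_integrable.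
apply: ae_eq_Rintegral; [exact: measurable_funM|by apply: measurable_funM => //; exact: measurable_funM|].
by apply: filterS (L2_ofE (a *: L2_fun u)) => x /= h Dx; rewrite h// mulrA.
Qed.

Lemma L2_dotDr u v w : L2_dot w (u + v) = L2_dot w u + L2_dot w v.
Proof. by rewrite L2_dotC L2_dotDl !(L2_dotC w). Qed.
Lemma L2_dotZr a u w : L2_dot w (a *: u) = a * L2_dot w u.
Proof. by rewrite L2_dotC L2_dotZl !(L2_dotC w). Qed.
Lemma L2_dotNl u w : L2_dot (- u) w = - L2_dot u w.
Proof. by rewrite -scaleN1r L2_dotZl mulN1r. Qed.
Lemma L2_dotNr u w : L2_dot w (- u) = - L2_dot w u.
Proof. by rewrite L2_dotC L2_dotNl L2_dotC. Qed.
Lemma L2_dotBl u v w : L2_dot (u - v) w = L2_dot u w - L2_dot v w.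
Proof. by rewrite L2_dotDl L2_dotNl. Qed.
Lemma L2_dotBr u v w : L2_dot w (u - v) = L2_dot w u - L2_dot w v.
Proof. by rewrite L2_dotDr L2_dotNr. Qed.
Lemma L2_dot0l w : L2_dot 0 w = 0.
Proof. by rewrite -(scale0r (0 : H)) L2_dotZl mul0r. Qed.
Lemma L2_dot0r w : L2_dot w 0 = 0.
Proof. by rewrite L2_dotC L2_dot0l. Qed.

Lemma L2_dot_suml (I : Type) (r : seq I) (P : pred I) (F : I -> H) w :
  L2_dot (\sum_(i <- r | P i) F i) w = \sum_(i <- r | P i) L2_dot (F i) w.
Proof.
apply: (big_morph (fun u => L2_dot u w)) => [u v|]; first exact: L2_dotDl.
exact: L2_dot0l.
Qed.
Lemma L2_dotvv u : L2_dot u u = `|u| ^+ 2.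
Proof.
rewrite /L2_dot; apply: EFin_inj; rewrite -L2_sqr_integral fineK; last first.
  by apply: integrable_fin_num => //; exact: L2_mul_integrable.
by apply: eq_integral => x _; rewrite expr2.
Qed.

Lemma L2_normD_sqr u v : `|u + v| ^+ 2 = `|u| ^+ 2 + L2_dot u v *+ 2 + `|v| ^+ 2.
Proof.
by rewrite -!L2_dotvv !(L2_dotDl, L2_dotDr) (L2_dotC v u) mulr2n !addrA.
Qed.

Lemma L2_cauchy_schwarz u v : `|L2_dot u v| <= `|u| * `|v|.
Proof.
have [->|v0] := eqVneq v 0; first by rewrite L2_dot0r !normr0 mulr0.
rewrite -ler_sqr ?nnegrE ?mulr_ge0// real_normK ?num_real// exprMn.
have nv : 0 < `|v| ^+ 2 by rewrite exprn_gt0// normr_gt0.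
have := sqr_ge0 `|(`|v| ^+ 2) *: u - L2_dot u v *: v|.
rewrite -(L2_dotvv (_ - _)) !(L2_dotBl, L2_dotBr, L2_dotZl, L2_dotZr) !L2_dotvv (L2_dotC v u).
set a := L2_dot u v; set p := `|u| ^+ 2; set q := `|v| ^+ 2.
rewrite (_ : _ - _ = q * (p * q - a ^+ 2)); last by ring.
by rewrite pmulr_rge0// subr_ge0.
Qed.

Lemma L2_dot_cont w : continuous (fun v : H => L2_dot v w).
Proof.
move=> v; apply/(@cvgrPdist_le R _ _ (nbhs v) (nbhs_filter v)) => e e0; near=> x.
rewrite -L2_dotBl; apply: le_trans (L2_cauchy_schwarz _ _) _.
apply: (@le_trans _ _ (e / (`|w| + 1) * (`|w| + 1))).
  rewrite ler_pM//; first by near: x; apply: cvgr_dist_le => //; rewrite divr_gt0// ltr_wpDl.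
  by rewrite lerDl.
by rewrite divfK// gt_eqF// ltr_wpDl.
Unshelve. all: by end_near. Qed.

End dot.
#[export] Hint Resolve measurable_L2 : core.

Lemma cvgn_EFin (R : realType) (a : nat -> R) (l : R) :
  a n @[n --> \oo] --> l -> (a n)%:E @[n --> \oo] --> l%:E.
Proof. by move=> al; apply: cvg_EFin => //; exact: nearW. Qed.

Section completeness.
Context d (T : measurableType d) (R : realType) (mu : {measure set T -> \bar R}).
Local Notation H := (L2 mu).
Implicit Types u v w : H.

Lemma L2_exists (f : T -> R) : measurable_fun setT f ->
  (\int[mu]_x ((f x) ^+ 2)%:E < +oo)%E -> exists u : H, (u : T -> R) = f %[ae mu].
Proof.
move=> mf f2; have fL : f \in Lfun mu 2%:R%:E.
  rewrite inE; apply/andP; split; rewrite inE//=.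
  rewrite /finite_norm unlock poweR_lty//; apply: le_lt_trans f2.
  apply: ge0_le_integral_nonmeas => x _ /=; first by rewrite lee_fin powR_ge0.
  by rewrite powR_mulrn// real_normK// num_real.
exists (L2_of (Lfun_Sub (@lee1n R 2) fL)).
have := L2_ofE (Lfun_Sub (@lee1n R 2) fL); by rewrite Lfun_valP.
Qed.

Lemma L2_dist_sqr u v : (\int[mu]_x ((u x - v x) ^+ 2)%:E = (`|u - v| ^+ 2)%:E)%E.
Proof.
rewrite -L2_sqr_integral; apply: ae_eq_integral => //.
- by apply/measurable_EFinP/measurable_funX/measurable_funB.
- by apply/measurable_EFinP/measurable_funX.
apply: (@filterS2 _ _ _ _ _ _ _ (L2_ofE (L2_fun u + L2_fun (- v))) (L2_ofE (- L2_fun v))).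
by move=> x /= h1 h2 Dx; rewrite h1//=; congr (((_ + _) ^+ 2)%:E); rewrite h2.
Qed.

Lemma geometric_dist_cvg (a : nat -> R) (C : R) :
  (forall k, `|a k.+1 - a k| <= C * 2^-1 ^+ k) -> cvgn a.
Proof.
move=> aC; have : cvgn (series (fun k => a k.+1 - a k)).
  apply: normed_cvg; apply: (@series_le_cvg _ _ (geometric C 2^-1)) => //.
    by move=> n; rewrite /= normr_ge0.
    by move=> n; exact: le_trans (aC n).
  by apply: is_cvg_geometric_series; rewrite ger0_norm ?invf_lt1 ?ltr1n.
move=> /cvg_ex[l /= al]; apply/cvg_ex; exists (l + a 0%N) => /=.
rewrite [X in X @ _ --> _](_ : a = (fun n => series (fun k => a k.+1 - a k) n + a 0%N)).
  by apply: cvgD; [exact: al|exact: cvg_cst].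
by apply/funext => n; rewrite /series/= telescope_sumr// subrK.
Qed.

(* Riesz-Fischer: a subsequence with |v_(k+1) - v_k| <= 4^-k converges almost
   everywhere because sum_k 4^k |v_(k+1) - v_k|^2 is integrable. *)
Lemma L2_complete (u_ : nat -> H) :
  (forall eps, 0 < eps -> exists N, forall m n, (N <= m)%N -> (N <= n)%N ->
     `|u_ m - u_ n| <= eps) -> cvgn u_.
Proof.
move=> u_cauchy.
have /choice[N NP] (k : nat) : exists N, forall m n, (N <= m)%N -> (N <= n)%N ->
    `|u_ m - u_ n| <= 4^-1 ^+ k.
  by apply: u_cauchy; rewrite exprn_gt0.
pose phi k := (\sum_(i < k.+1) N i)%N.
have Nphi k j : (k <= j)%N -> (N k <= phi j)%N.
  by move=> kj; rewrite /phi (bigD1 (Ordinal (kj : (k < j.+1)%N)))//= leq_addr.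
pose v k := u_ (phi k).
have vd k j : (k <= j)%N -> `|v j - v k| <= 4^-1 ^+ k.
  by move=> kj; apply: NP; exact: Nphi.
(* The weight 4^k balances two demands: the integral of [g k] is still at most 4^-k, while a finite
   sum S at [x] forces |v_(k+1) - v_k| <= sqrt(S) 2^-k, which is summable. *)
pose g k x : \bar R := (4 ^+ k * (v k.+1 x - v k x) ^+ 2)%:E.
have g0 k x : (0 <= g k x)%E.
  by rewrite /g lee_fin mulr_ge0 ?sqr_ge0 ?exprn_ge0.
have mg k : measurable_fun setT (g k).
  apply/measurable_EFinP; apply: measurable_funM => //.
  by apply: measurable_funX; exact: measurable_funB.
have intg : (\int[mu]_x (\sum_(k <oo) g k x) < +oo)%E.
  rewrite integral_nneseries//.
  have gk k : (\int[mu]_x g k x <= (geometric 1 4^-1 k)%:E)%E.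
    rewrite /g; under eq_integral do rewrite EFinM.
    rewrite ge0_integralZl//; last 2 first.
      by apply/measurable_EFinP/measurable_funX/measurable_funB.
      by move=> x _; rewrite lee_fin sqr_ge0.
    rewrite L2_dist_sqr -EFinM lee_fin /geometric/= mul1r.
    apply: (@le_trans _ _ (4 ^+ k * (4^-1 ^+ k) ^+ 2)).
      by rewrite ler_wpM2l ?exprn_ge0// lerXn2r ?nnegrE ?exprn_ge0// vd.
    by rewrite expr2 mulrA -exprMn divff// expr1n mul1r.
  apply: le_lt_trans (@lee_nneseries _ _ (fun k => (geometric 1 4^-1 k)%:E) _ _ _ _) _.
  - by move=> k _ _; exact: integral_ge0.
  - by move=> k _; exact: gk.
  have cg : cvgn (series (geometric (1 : R) 4^-1)).
    by apply: is_cvg_geometric_series; rewrite ger0_norm ?invf_lt1 ?ltr1n.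
  rewrite (_ : (fun n => _) = EFin \o series (geometric (1 : R) 4^-1)); last first.
    by apply/funext => n; rewrite /= /series/= sumEFin.
  by rewrite EFin_lim// ltry.
have mG : measurable_fun setT (fun x => (\sum_(k <oo) g k x)%E).
  exact: ge0_emeasurable_sum.
have aecv : {ae mu, forall x, cvgn (fun k => v k x : R)}.
  have /integrable_ae : mu.-integrable setT (fun x => (\sum_(k <oo) g k x)%E).
    apply/integrableP; split => //.
    under eq_integral do rewrite gee0_abs ?nneseries_ge0//.
    exact: intg.
  move=> /(_ measurableT); apply: filterS => x /(_ Logic.I) Sfin.
  apply: (@geometric_dist_cvg _ (Num.sqrt (fine (\sum_(k <oo) g k x)%E))) => k.
  rewrite -ler_sqr ?nnegrE ?mulr_ge0// ?exprn_ge0// real_normK ?num_real//.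
  rewrite exprMn sqr_sqrtr ?fine_ge0 ?nneseries_ge0//.
  have : (g k x <= \sum_(k <oo) g k x)%E.
    apply: le_trans (nneseries_lim_ge k.+1 _) => //.
    by rewrite big_nat_recr//= leeDr// sume_ge0.
  rewrite -(fineK Sfin) /g lee_fin.
  have -> : (2^-1 ^+ k) ^+ 2 = (4 ^+ k)^-1 :> R.
    by rewrite -exprM mulnC exprM -exprVn; congr (_ ^+ k); field.
  by rewrite ler_pdivlMr ?exprn_gt0// mulrC.
(* The upper limit is measurable on all of [T], including the null set where [v] diverges. *)
pose f x := fine (limn_esup (fun k => (v k x)%:E)).
have mf : measurable_fun setT f.
  apply: (@measurableT_comp _ _ _ _ _ _ fine); first exact: fine_measurable.
  by apply: measurable_fun_limn_esup => n; exact/measurable_EFinP.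
have vf : {ae mu, forall x, (v k x : R) @[k --> \oo] --> f x}.
  move: aecv; apply: filterS => x /cvg_ex[l vl]; have := vl.
  by move=> /cvgn_EFin/cvg_limn_einf_sup[_ h]; rewrite /f h.
(* Fatou in j at fixed k: the differences v_(j+k) - v_k all have norm at most 4^-k. *)
have fv k : (\int[mu]_x ((f x - v k x) ^+ 2)%:E <= ((4^-1 ^+ k) ^+ 2)%:E)%E.
  have -> : (\int[mu]_x ((f x - v k x) ^+ 2)%:E =
      \int[mu]_x limn_einf (fun j => ((v (j + k)%N x - v k x) ^+ 2)%:E))%E.
    have mh (j : nat) : measurable_fun setT (fun x => ((v (j + k)%N x - v k x) ^+ 2)%:E).
      by apply/measurable_EFinP/measurable_funX/measurable_funB.
    apply: ae_eq_integral => //.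
    - by apply/measurable_EFinP/measurable_funX/measurable_funB.
    - rewrite [X in measurable_fun _ X](_ : _ =
        (fun x => - limn_esup (fun j => - ((v (j + k)%N x - v k x) ^+ 2)%:E))%E); last first.
        by apply/funext => x; rewrite -limn_einfN; congr limn_einf; apply/funext => j; exact/esym/oppeK.
      apply: measurableT_comp => //; apply: measurable_fun_limn_esup => j.
      exact: measurableT_comp.
    move: vf; apply: filterS => x vx _.
    apply/esym/(@cvg_limn_einf_sup _ _ _ _).1; apply: cvgn_EFin.
    have vx' : (v (j + k)%N x : R) @[j --> \oo] --> f x.
      by have := vx; rewrite -(cvg_shiftn k).
    have vx2 : v (j + k)%N x - v k x @[j --> \oo] --> f x - v k x.
      by apply: cvgB => //; exact: cvg_cst.
    rewrite expr2; under eq_fun do rewrite expr2; exact: cvgM.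
  apply: le_trans (fatou _ _ _ _) _ => //.
  - by move=> n; apply/measurable_EFinP/measurable_funX/measurable_funB.
  - by move=> n x _; rewrite lee_fin sqr_ge0.
  apply: le_trans (limn_einf_sup _) _.
  rewrite limn_esup_lim; apply: lime_le; first exact: is_cvg_esups.
  apply: nearW => n; apply: ge_ereal_sup => _ /= [j _ <-].
  rewrite L2_dist_sqr lee_fin lerXn2r ?nnegrE ?exprn_ge0//.
  by apply: vd; exact: leq_addl.
have [|U Uf] := L2_exists mf.
  apply: (@le_lt_trans _ _ (\int[mu]_x ((2 * (f x - v 0%N x) ^+ 2)%:E + (2 * (v 0%N x) ^+ 2)%:E))%E).
    apply: ge0_le_integral_nonmeas => x _; rewrite -?EFinD lee_fin ?sqr_ge0//.
    have := sqr_ge0 (f x - v 0%N x - v 0%N x).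
    by set a := f x; set b := v 0%N x; nra.
  have m1 : measurable_fun setT (fun x => ((f x - v 0%N x) ^+ 2)%:E).
    by apply/measurable_EFinP/measurable_funX/measurable_funB.
  have m2 : measurable_fun setT (fun x => ((v 0%N x) ^+ 2)%:E).
    by apply/measurable_EFinP/measurable_funX.
  under eq_integral do rewrite !EFinM.
  rewrite ge0_integralD//; first last.
  - exact: measurable_funeM.
  - by move=> x _; rewrite mule_ge0// lee_fin sqr_ge0.
  - exact: measurable_funeM.
  - by move=> x _; rewrite mule_ge0// lee_fin sqr_ge0.
  rewrite !ge0_integralZl//; try by [move=> x _; rewrite lee_fin sqr_ge0|rewrite lee_fin].
  rewrite L2_sqr_integral -EFinM lte_add_pinfty// ?ltry//.
  by rewrite lte_mul_pinfty// (le_lt_trans (fv 0%N))// ltry.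
have Uv k : `|U - v k| <= 4^-1 ^+ k.
  rewrite -ler_sqr ?nnegrE ?exprn_ge0// -lee_fin -L2_dist_sqr.
  apply: le_trans _ (fv k); rewrite le_eqVlt; apply/orP; left; apply/eqP.
  apply: ae_eq_integral => //.
  - by apply/measurable_EFinP/measurable_funX/measurable_funB.
  - by apply/measurable_EFinP/measurable_funX/measurable_funB.
  by move: Uf; apply: filterS => x /= h Dx; rewrite h.
apply/cvg_ex; exists U; apply/(@cvgrPdist_le R _ _ _ _) => e e0.
have [k ke] : exists k, 4^-1 ^+ k <= e / 2 :> R.
  have /cvgrPdist_le/(_ (e / 2)) : (4^-1 : R) ^+ k @[k --> \oo] --> (0 : R).
    by apply: cvg_expr; rewrite ger0_norm ?invf_lt1 ?ltr1n.
  rewrite divr_gt0// => /(_ isT)[k _ /(_ k (leqnn k))].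
  by rewrite /= sub0r normrN ger0_norm ?exprn_ge0//; exists k.
exists (N k) => // n /= Nn.
rewrite -(subrKA (v k)); apply: le_trans (ler_normD _ _) _.
rewrite (splitr e) lerD// ?(le_trans (Uv k))//.
by rewrite (le_trans _ ke)//; apply: NP => //; exact: Nphi.
Qed.

End completeness.

(** * Orthonormal bases: Parseval, powers of the operator, Hilbert-Schmidt sums *)

Section orthonormal_basis.
Context d (T : measurableType d) (R : realType) (mu : {measure set T -> \bar R}).
Local Notation H := (L2 mu).
Implicit Types (u v w : H) (e : nat -> H).

Definition orthonormal_basis e :=
  (forall j k, L2_dot (e j) (e k) = (j == k)%:R) /\
  forall v, series (fun k => L2_dot v (e k) *: e k) @ \oo --> v.

Variable e : nat -> H.
Hypothesis eb : orthonormal_basis e.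

Lemma onb_sum_dot (c : nat -> R) (m n k : nat) :
  L2_dot (\sum_(m <= i < n) c i *: e i) (e k) = if (m <= k < n)%N then c k else 0.
Proof.
rewrite L2_dot_suml; under eq_bigr do rewrite L2_dotZl eb.1.
rewrite -(big_nat1_eq +%R c) [RHS]big_mkcond/=.
by apply: eq_bigr => i _; case: eqP => [->|]; rewrite ?mulr1 ?mulr0.
Qed.

Lemma onb_sum_norm (c : nat -> R) (m n : nat) :
  `|\sum_(m <= i < n) c i *: e i| ^+ 2 = \sum_(m <= i < n) c i ^+ 2.
Proof.
rewrite -L2_dotvv [X in L2_dot X _]big_nat_cond L2_dot_suml [RHS]big_nat_cond.
apply: eq_bigr => i /andP[mi _]; rewrite L2_dotZl L2_dotC onb_sum_dot mi.
by rewrite expr2.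
Qed.

Lemma parseval v : (\sum_(k <oo) ((L2_dot v (e k)) ^+ 2)%:E = (`|v| ^+ 2)%:E)%E.
Proof.
apply/cvg_lim => //.
have -> : (fun n => \sum_(0 <= k < n) ((L2_dot v (e k)) ^+ 2)%:E)%E =
    EFin \o (fun n => `|series (fun k => L2_dot v (e k) *: e k) n| ^+ 2).
  by apply/funext => n; rewrite sumEFin /= /series/= onb_sum_norm.
apply: cvgn_EFin; rewrite expr2; under eq_fun do rewrite expr2.
by apply: cvgM; apply: cvg_norm; exact: eb.2.
Qed.

Lemma onb_ext u v : (forall k, L2_dot u (e k) = L2_dot v (e k)) -> u = v.
Proof.
move=> uv; apply/eqP; rewrite -subr_eq0 -normr_eq0 -sqrf_eq0 -eqe -parseval.
by rewrite eseries0// => k _ _; rewrite L2_dotBl uv subrr expr0n.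
Qed.

Lemma onb_dot_lim (c : nat -> R) w k :
  series (fun k => c k *: e k) @ \oo --> w -> L2_dot w (e k) = c k.
Proof.
move=> cw; have h : L2_dot (series (fun k => c k *: e k) n) (e k) @[n --> \oo] --> L2_dot w (e k).
  exact: (cvg_comp _ (fun v => L2_dot v (e k)) cw (@L2_dot_cont _ _ _ _ (e k) w)).
apply/esym; apply: (cvg_unique _ _ h) => //; apply: cvg_near_cst.
by exists k.+1 => // n /= kn; rewrite /series/= onb_sum_dot leq0n kn.
Qed.

(** Pythagoras turns blocks of the vector series into blocks of the scalar series, so the partial
    sums are Cauchy. *)
Lemma onb_series_cvg (c : nat -> R) : cvgn (series (fun k => c k ^+ 2)) ->
  cvgn (series (fun k => c k *: e k)).
Proof.
move=> /cvg_ex[l /= cl]; apply: L2_complete => eps eps0.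
have /cvgrPdist_le/(_ (eps ^+ 2 / 2)) := cl.
rewrite divr_gt0 ?exprn_gt0// => /(_ isT)[N _ NP].
exists N.
suff le m n : (N <= m)%N -> (m <= n)%N ->
    `|series (fun k => c k *: e k) n - series (fun k => c k *: e k) m| <= eps.
  move=> m n Nm Nn; have [mn|/ltW nm] := leP m n; last exact: le.
  by rewrite distrC; exact: le.
move=> Nm mn; have Nn := leq_trans Nm mn.
rewrite /series/= (big_cat_nat (leq0n m) mn)/= addrAC subrr add0r.
rewrite -ler_sqr ?nnegrE ?(ltW eps0)// onb_sum_norm.
have -> : \sum_(m <= i < n) c i ^+ 2 =
    series (fun k => c k ^+ 2) n - series (fun k => c k ^+ 2) m.
  by rewrite /series/= [in RHS](big_cat_nat (leq0n m) mn)/= addrAC subrr add0r.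
have := NP _ Nm; have := NP _ Nn; rewrite /= !ler_norml.
set a := series _ n; set b := series _ m => /andP[h1 h2] /andP[h3 h4].
by clear -h1 h2 h3 h4; lra.
Qed.

Section power.
Variable lam : nat -> R.
Hypothesis lam0 : forall k, 0 < lam k.
Hypothesis lamy : lam @ \oo --> +oo.

Lemma power_coord s v k : in_dom_power e lam s v ->
  L2_dot (power e lam s v) (e k) = lam k `^ s * L2_dot v (e k).
Proof. by move=> dv; apply: (@onb_dot_lim (fun k => lam k `^ s * L2_dot v (e k))); exact: dv. Qed.

Lemma power_norm s v : in_dom_power e lam s v ->
  ((`|power e lam s v| ^+ 2)%:E =
   \sum_(k <oo) (lam k `^ (2 * s) * L2_dot v (e k) ^+ 2)%:E)%E.
Proof.
move=> dv; rewrite -parseval; apply: eq_eseriesr => k _.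
by rewrite power_coord// exprMn -[(lam k `^ s) ^+ 2]powR_mulrn ?powR_ge0// -powRrM (mulrC s).
Qed.

(** All but finitely many eigenvalues are at least 1, and the minimum of 1 and the others is
    positive. This bound makes nonpositive powers of the operator bounded. *)
Lemma eigenvalue_lower_bound : exists2 l0, 0 < l0 & forall k, l0 <= lam k.
Proof.
have /cvgryPge/(_ 1)[N _ NP] := lamy.
exists (\big[Num.min/1]_(i < N) lam i).
  by elim/big_ind: _ => // x y x0 y0; rewrite lt_min x0.
move=> k; have [Nk|kN] := leqP N k.
  by apply: le_trans (NP _ Nk); exact: bigmin_le_id.
exact: (@bigmin_le_cond _ _ _ _ (Ordinal kN) predT (fun i => lam i)).
Qed.

(** For s <= 0 the weights are at most l0^s, so the series converges for every vector and the [limn]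
    in [power] is a true limit. This covers the exponent (beta-1)/2 of the noise condition. *)
Lemma in_dom_power_le0 s v : s <= 0 -> in_dom_power e lam s v.
Proof.
move=> s0; have [l0 l00 l0P] := eigenvalue_lower_bound.
apply: onb_series_cvg.
apply: (@series_le_cvg _ _ (fun k => (l0 `^ s) ^+ 2 * L2_dot v (e k) ^+ 2)).
- by move=> n; rewrite sqr_ge0.
- by move=> n; rewrite mulr_ge0 ?sqr_ge0.
- move=> n; rewrite exprMn ler_wpM2r ?sqr_ge0// lerXn2r ?nnegrE ?powR_ge0//.
  rewrite -(opprK s) 2!(powRN _ (- s)) lef_pV2 ?posrE ?powR_gt0//.
  by apply: ge0_ler_powR; rewrite ?nnegrE ?oppr_ge0// ltW.
apply/cvg_ex; exists ((l0 `^ s) ^+ 2 * `|v| ^+ 2) => /=.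
rewrite [X in X @ _ --> _](_ : _ = fun n => (l0 `^ s) ^+ 2 *
    `|series (fun k => L2_dot v (e k) *: e k) n| ^+ 2); last first.
  by apply/funext => n; rewrite /series/= onb_sum_norm mulr_sumr.
apply: cvgM; first exact: cvg_cst.
rewrite expr2; under eq_fun do rewrite expr2.
by apply: cvgM; apply: cvg_norm; exact: eb.2.
Qed.

(** Exchanging the two sums and moving the self-adjoint [B] across the inner product shows that A^s
    B and B A^s have the same Hilbert-Schmidt norm; on an eigenvector the power is just a number. *)
Lemma hs_norm_sq_power s (B : H -> H) : s <= 0 ->
  (forall u v, L2_dot (B u) v = L2_dot u (B v)) ->
  (hs_norm_sq e (fun v => power e lam s (B v)) =
   \sum_(k <oo) (lam k `^ (2 * s) * `|B (e k)| ^+ 2)%:E)%E.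
Proof.
move=> s0 Bs; rewrite /hs_norm_sq.
under eq_eseriesr do rewrite (power_norm (in_dom_power_le0 s0)).
rewrite nneseries_interchange; last first.
  by move=> i j; rewrite lee_fin mulr_ge0 ?sqr_ge0 ?powR_ge0.
apply: eq_eseriesr => k _.
under eq_eseriesr do rewrite EFinM.
rewrite nneseriesZl; last by move=> i _; rewrite lee_fin sqr_ge0.
rewrite EFinM -parseval; congr (_ * _)%E.
by apply: eq_eseriesr => j _; rewrite Bs L2_dotC.
Qed.

End power.
End orthonormal_basis.

(** * Diagonal operators *)

Section right_derivative.
Variable R : realType.

(** The generator of a semigroup only provides right derivatives, so the mean value theorem is
    replaced by a continuity induction. *)
Lemma right_derivative0_const (g : R -> R) :
  {within `[0, +oo[, continuous g} ->
  (forall t, 0 <= t -> h^-1 * (g (t + h) - g t) @[h --> 0^'+] --> (0 : R)) ->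
  forall t, 0 <= t -> g t = g 0.
Proof.
move=> /subspace_continuousP gc gd t; rewrite le_eqVlt => /predU1P[<-//|t0].
suff le eps : 0 < eps -> `|g t - g 0| <= eps * t.
  apply/eqP; rewrite -subr_eq0 -normr_le0; apply/ler_addgt0Pl => eps eps0.
  by rewrite addr0; have := le (eps / t); rewrite divfK ?gt_eqF// => ->//; rewrite divr_gt0.
move=> eps0.
(* The times up to which [g] stays below slope [eps]. The supremum belongs to the set by continuity,
   and if it were smaller than [t], the vanishing right derivative there would extend the set beyond
   it. *)
pose E := [set s | 0 <= s <= t /\ forall r, 0 <= r <= s -> `|g r - g 0| <= eps * r].
have E0 : E 0.
  split => [|r /andP[r0 r0']]; first by rewrite lexx ltW.
  by rewrite (_ : r = 0) ?subrr ?normr0 ?mulr0//; apply/le_anti; rewrite r0 r0'.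
have supE : has_sup E.
  by split; [exists 0 | exists t => s [/andP[]]].
pose s := sup E.
have s0 : 0 <= s by exact: (ub_le_sup supE.2 E0).
have st : s <= t by apply: ge_sup; [exists 0 | move=> x [/andP[]]].
have Elt r : 0 <= r < s -> `|g r - g 0| <= eps * r.
  move=> /andP[r0 /(sup_gt (ex_intro _ _ E0))[x Ex rx]].
  by apply: Ex.2; rewrite r0 ltW.
have Es : `|g s - g 0| <= eps * s.
  have [s00|sgt] := leP s 0.
    by rewrite (_ : s = 0) ?subrr ?normr0 ?mulr0//; apply/le_anti; rewrite s0 s00.
  apply/ler_addgt0Pl => eta eta0.
  have := gc s _; rewrite /= in_itv/= andbT => /(_ s0)/cvgrPdist_le/(_ _ eta0).
  rewrite near_withinE => /nbhs_ballP[del /= del0 delP].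
  pose r := Num.max 0 (s - del / 2).
  have rs : 0 <= r < s.
    by rewrite le_max lexx/= gt_max sgt/= ltrBlDr ltrDl divr_gt0.
  have := delP r; rewrite /ball/= in_itv/= andbT.
  have /andP[r0 rs'] := rs.
  have sr : `|s - r| < del.
    rewrite ger0_norm ?subr_ge0 ?(ltW rs')//.
    have : s - del / 2 <= r by rewrite le_max lexx orbT.
    by clear -del0; lra.
  move=> /(_ sr r0) gsr.
  rewrite -(subrKA (g r)); apply: le_trans (ler_normD _ _) _; rewrite lerD//.
  by apply: le_trans (Elt _ rs) _; rewrite ler_wpM2l ?(ltW eps0)// ltW.
have Esle r : 0 <= r <= s -> `|g r - g 0| <= eps * r.
  by move=> /andP[r0]; rewrite le_eqVlt => /predU1P[->//|rs]; apply: Elt; rewrite r0.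
have [st'|/eqP sneqt] := pselect (s = t); first by rewrite -st'.
have slt : s < t by rewrite lt_neqAle sneqt st.
have /cvgrPdist_le/(_ _ eps0) := gd s s0.
move=> [del /= del0 delP].
pose de := Num.min (del / 2) (t - s).
have de0 : 0 < de by rewrite lt_min divr_gt0//= subr_gt0.
suff : E (s + de).
  by move=> /(ub_le_sup supE.2); rewrite -/s gerDl leNgt de0.
split.
  rewrite addr_ge0 ?(ltW de0)//= -lerBrDl.
  by rewrite ge_min lexx orbT.
move=> r /andP[r0 rs]; have [rls|slr] := leP r s; first by apply: Esle; rewrite r0.
have rs0 : 0 < r - s by rewrite subr_gt0.
have := delP (r - s); rewrite /ball/= sub0r normrN gtr0_norm//.
have rsd : r - s < del.
  have : de <= del / 2 by rewrite ge_min lexx.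
  by clear -del0 rs; lra.
move=> /(_ rsd rs0).
rewrite sub0r normrN normrM gtr0_norm ?invr_gt0// subrKC mulrC ler_pdivrMr// => h.
rewrite -(subrKA (g s)); apply: le_trans (ler_normD _ _) _.
by apply: le_trans (lerD h Es) _; rewrite -mulrDr subrK.
Qed.

Lemma expR_right_derivative (l : R) :
  h^-1 * (expR (l * h) - 1) @[h --> 0^'+] --> l.
Proof.
have d : is_derive (0 : R) 1 (fun h : R => expR (l * h)) l.
  rewrite [X in is_derive _ _ _ X](_ : l = expR (l * 0) *: (l *: 1 : R)).
    exact: is_derive1_comp.
  by rewrite mulr0 expR0 scale1r /GRing.scale/= mulr1.
have := @ex_derive _ _ _ _ _ _ _ d.
have := @derive_val _ _ _ _ _ _ _ d; rewrite /derivable /derive => ->.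
have sub : (0 : R)^'+ `=>` (0 : R)^'.
  move=> P [r r0 rP]; exists r => // y yr y0; apply: rP => //.
  by rewrite gt_eqF.
move=> /(cvg_trans (cvg_app _ sub)).
under [X in X @ _ --> _]eq_fun do rewrite /= addr0 mulr0 expR0 /GRing.scale/= mulr1.
by [].
Qed.

End right_derivative.

Section diagonal_operators.
Context d (T : measurableType d) (R : realType) (mu : {measure set T -> \bar R}).
Local Notation H := (L2 mu).
Implicit Types (u v w : H) (B : H -> H).

Section bounded_linear.
Variable B : H -> H.
Hypothesis Bb : bounded_linear B.

Lemma bounded_linear0 : B 0 = 0.
Proof.
have := Bb.1 1 0 0; rewrite scaler0 addr0 scale1r => /esym/eqP.
by rewrite -subr_eq0 addrK => /eqP.
Qed.

Lemma bounded_linearD u v : B (u + v) = B u + B v.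
Proof. by have := Bb.1 1 u v; rewrite !scale1r. Qed.

Lemma bounded_linearZ a u : B (a *: u) = a *: B u.
Proof. by have := Bb.1 a u 0; rewrite bounded_linear0 !addr0. Qed.

Lemma bounded_linearB u v : B (u - v) = B u - B v.
Proof. by rewrite -scaleN1r bounded_linearD bounded_linearZ scaleN1r. Qed.

Lemma bounded_linear_sum (I : Type) (r : seq I) (P : pred I) (F : I -> H) :
  B (\sum_(i <- r | P i) F i) = \sum_(i <- r | P i) B (F i).
Proof. exact: (big_morph _ bounded_linearD bounded_linear0). Qed.

Lemma bounded_linear_cvg (I : Type) (F : set_system I) {FF : Filter F} (u : I -> H) v :
  u i @[i --> F] --> v -> B (u i) @[i --> F] --> B v.
Proof.
have [M MP] := Bb.2.
move=> /cvgrPdist_le uv; apply/cvgrPdist_le => eps eps0.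
have M0 : 0 < `|M| + 1 by rewrite ltr_wpDl.
have := uv (eps / (`|M| + 1)); rewrite divr_gt0// => /(_ isT).
apply: filterS => i /= h; rewrite -bounded_linearB; apply: le_trans (MP _) _.
apply: (@le_trans _ _ ((`|M| + 1) * `|v - u i|)).
  by rewrite ler_wpM2r// (le_trans (ler_norm M))// lerDl.
by rewrite mulrC -ler_pdivlMr.
Qed.

End bounded_linear.

Variable e : nat -> H.
Hypothesis eb : orthonormal_basis e.

Lemma diagonal_coord B (b : nat -> R) : bounded_linear B ->
  (forall k, B (e k) = b k *: e k) ->
  forall v k, L2_dot (B v) (e k) = b k * L2_dot v (e k).
Proof.
move=> Bb Be v k; rewrite mulrC.
apply: (onb_dot_lim eb (c := fun k => L2_dot v (e k) * b k)).
rewrite [X in X @ _ --> _](_ : _ = B \o series (fun k => L2_dot v (e k) *: e k)).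
  by apply: bounded_linear_cvg => //; exact: eb.2.
apply/funext => n /=.
rewrite /series/= bounded_linear_sum//; apply: eq_bigr => i _.
by rewrite bounded_linearZ// Be scalerA.
Qed.

(** A bounded operator is applied to cylindrical noise through its adjoint, so the adjoint must be
    known on the eigenbasis too. *)
Lemma diagonal_adjoint B Bs (b : nat -> R) :
  (forall v k, L2_dot (B v) (e k) = b k * L2_dot v (e k)) -> adjoint_op B Bs ->
  forall k, Bs (e k) = b k *: e k.
Proof.
move=> Be [_ BBs] k; apply: (onb_ext eb) => j.
rewrite L2_dotC -BBs Be L2_dotZl eb.1 eb.1 eq_sym.
by case: eqP => [->//|]; rewrite !mulr0.
Qed.

Lemma diagonal_norm_le B (b : nat -> R) (c : R) : 0 <= c ->
  (forall v k, L2_dot (B v) (e k) = b k * L2_dot v (e k)) ->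
  (forall k, `|b k| <= c) -> forall v, `|B v| <= c * `|v|.
Proof.
move=> c0 Be b1 v; rewrite -ler_sqr ?nnegrE ?mulr_ge0// exprMn -lee_fin [leRHS]EFinM -(parseval eb (B v)) -(parseval eb v).
rewrite -nneseriesZl; last by move=> i _; rewrite lee_fin sqr_ge0.
apply: lee_nneseries => k _; first by rewrite lee_fin sqr_ge0.
rewrite Be exprMn -EFinM lee_fin ler_wpM2r ?sqr_ge0//.
by rewrite -(real_normK (num_real (b k))) lerXn2r ?nnegrE.
Qed.

Variables (A : H -> H -> Prop) (lam : nat -> R).
Hypothesis Ae : forall k, A (e k) (lam k *: e k).

Lemma resolvent_coord (tau : R) Rs : (forall k, 0 < lam k) -> 0 < tau -> resolvent A tau Rs ->
  forall v k, L2_dot (Rs v) (e k) = (1 + tau * lam k)^-1 * L2_dot v (e k).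
Proof.
move=> lam0 tau0 [Rb _ RA]; apply: diagonal_coord => // k.
have k0 : 1 + tau * lam k != 0 by rewrite gt_eqF// addr_gt0// mulr_gt0.
rewrite -{2}(RA _ _ (Ae k)) scalerA -[X in Rs (X + _)]scale1r -scalerDl.
by rewrite bounded_linearZ// scalerA mulVf// scale1r.
Qed.

(** Since e_k is an eigenvector of the generator, exp(lam_k r) times any coordinate of S_r e_k has
    right derivative 0, hence keeps its value at r = 0. *)
Lemma semigroup_coord S : semigroup_generated A S ->
  forall t : R, 0 <= t -> forall v k,
  L2_dot (S t v) (e k) = expR (- (lam k * t)) * L2_dot v (e k).
Proof.
move=> [Sb S0 SD Sc SA]; suff Se t k : 0 <= t -> S t (e k) = expR (- (lam k * t)) *: e k.
  by move=> t t0; apply: diagonal_coord; [exact: Sb|move=> k; exact: Se].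
move=> t0; apply: (onb_ext eb) => j; rewrite L2_dotZl.
pose g r := expR (lam k * r) * L2_dot (S r (e k)) (e j).
have : g t = g 0.
  apply: right_derivative0_const t0.
    apply/subspace_continuousP => x x0; apply: cvgM.
      apply: cvg_within_filter.
      have : continuous (fun r : R => expR (lam k * r)).
        move=> y; apply: (continuous_comp (f := fun r => lam k * r)); last exact: continuous_expR.
        exact: mulrl_continuous.
      exact.
    have /subspace_continuousP/(_ x x0) Sx := Sc (e k).
    exact: (cvg_comp _ (fun v => L2_dot v (e j)) Sx (@L2_dot_cont _ _ _ _ (e j) _)).
  move=> r r0.
  (* Product rule at h = 0: the contributions - lam_k e_k of the semigroup and lam_k e_k of the
     exponential cancel. *)
  have lim0 : h^-1 *: (expR (lam k * h) *: S h (e k) - e k) @[h --> 0^'+] --> (0 : H).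
    have l1 := (SA (e k) (lam k *: e k)).1 (Ae k).
    have l2 : expR (lam k * h) @[h --> 0^'+] --> (1 : R).
      rewrite -(expR0 R) -[X in expR X](mulr0 (lam k)); apply: cvg_at_right_filter.
      apply: (continuous_comp (f := fun r => lam k * r)); last exact: continuous_expR.
      exact: mulrl_continuous.
    have l3 := @expR_right_derivative R (lam k).
    rewrite [X in X @ _ --> _](_ : _ = fun h => expR (lam k * h) *: (h^-1 *: (S h (e k) - e k))
        + (h^-1 * (expR (lam k * h) - 1)) *: e k); last first.
      apply/funext => h; rewrite !scalerBr !scalerA mulrBr scalerBl mulr1 [_ * h^-1]mulrC.
      by rewrite addrA subrK.
    rewrite -[X in _ --> X](addNr (lam k *: e k)) -[X in _ --> X + _]scale1r.
    by apply: cvgD; apply: cvgZ => //; exact: cvg_cst.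
  have lim1 : expR (lam k * r) * L2_dot (S r (h^-1 *: (expR (lam k * h) *: S h (e k) - e k)))
      (e j) @[h --> 0^'+] --> (0 : R).
    rewrite [X in _ --> X](_ : 0 = expR (lam k * r) * L2_dot (S r 0) (e j)); last first.
      by rewrite (bounded_linear0 (Sb r r0)) L2_dot0l mulr0.
    apply: cvgM; first exact: cvg_cst.
    apply: (cvg_comp _ (fun v => L2_dot v (e j)) _ (@L2_dot_cont _ _ _ _ (e j) _)).
    by apply: bounded_linear_cvg => //; exact: Sb.
  apply: cvg_trans lim1; apply: near_eq_cvg; near=> h.
  have h0 : 0 <= h by near: h; exact: nbhs_right_ge.
  have Srb := Sb r r0.
  rewrite /g (bounded_linearZ Srb) (bounded_linearB Srb) (bounded_linearZ Srb) -(SD _ _ _ r0 h0).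
  rewrite L2_dotZl L2_dotBl L2_dotZl (mulrDr (lam k)) expRD.
  by rewrite mulrCA mulrBr !mulrA.
rewrite /g S0 mulr0 expR0 mul1r => <-.
by rewrite mulrA -expRD addrC subrr expR0 mul1r.
Unshelve. all: by end_near. Qed.

End diagonal_operators.

(** * Kernels of the semigroup and of the Euler scheme *)

Section scalar_estimates.
Variable R : realType.
Implicit Types (l t s h x r tau : R) (n m i : nat).
Local Notation leb := (@lebesgue_measure R).

(** The Ornstein-Uhlenbeck kernel: what forcing at time r contributes at time t in a mode with
    eigenvalue l. Extension by zero allows kernels with different t to be subtracted and integrated
    over the whole line. *)
Definition ou_kernel l t r : R := \1_(`]0, t]) r * expR (- (l * (t - r))).

(** Closed on the right: a cell goes with its right endpoint, where the implicit scheme evaluates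
    [f]. *)
Definition cell tau i : set R := `](i%:R * tau), (i.+1%:R * tau)]%classic.

Definition euler_factor l tau : R := (1 + tau * l)^-1.

(* For an eigenvalue [l], [euler_kernel l tau n] is to [n] Euler steps what
   [ou_kernel l (n%:R * tau)] is to the semigroup: the corresponding coordinate
   integrates drift and noise against it. *)
Definition euler_kernel l tau n r : R :=
  \sum_(i < n) euler_factor l tau ^+ (n - i) * \1_(cell tau i) r.

Lemma cell_uniq tau i j r : 0 < tau -> cell tau i r -> cell tau j r -> i = j.
Proof.
move=> tau0; rewrite /cell/= !in_itv/=; wlog: i j / (i < j)%N.
  move=> hw hi hj; have [ij|ji|//] := ltngtP i j; first exact: hw.
  by apply/esym/hw.
move=> ij /andP[_ ri] /andP[rj _].
have : i.+1%:R * tau <= j%:R * tau :> R by rewrite ler_wpM2r ?ler_nat// ltW.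
by move=> /(le_trans ri)/le_lt_trans/(_ rj); rewrite ltxx.
Qed.

Lemma cell_exists tau n r : 0 < tau -> 0 < r -> r <= n%:R * tau ->
  exists2 i, (i < n)%N & cell tau i r.
Proof.
move=> tau0 r0; elim: n => [|n IH]; first by rewrite mul0r leNgt r0.
have [rn|rn] := leP r (n%:R * tau) => rn1.
  by have [i ni ir] := IH rn; exists i => //; exact: ltnW.
by exists n => //; rewrite /cell/= in_itv/= rn.
Qed.

Lemma cell_sub tau n i r : 0 < tau -> (i < n)%N -> cell tau i r -> 0 < r <= n%:R * tau.
Proof.
move=> tau0 ni; rewrite /cell/= in_itv/= => /andP[h1 h2]; apply/andP; split.
  by apply: le_lt_trans h1; rewrite mulr_ge0 ?ler0n ?ltW.
by apply: le_trans h2 _; rewrite ler_wpM2r ?ler_nat ?ltW.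
Qed.

Lemma sum_cell tau n (c : nat -> R) i r : 0 < tau -> (i < n)%N -> cell tau i r ->
  \sum_(j < n) c j * \1_(cell tau j) r = c i.
Proof.
move=> tau0 ni ir; rewrite (bigD1 (Ordinal ni))//= indicE mem_set// mulr1.
rewrite big1 ?addr0// => j ji; rewrite indicE memNset ?mulr0// => jr.
by move/eqP: ji; apply; apply: val_inj; exact: cell_uniq ir.
Qed.

Lemma sum_cell0 tau n (c : nat -> R) r : 0 < tau -> ~~ (0 < r <= n%:R * tau) ->
  \sum_(j < n) c j * \1_(cell tau j) r = 0.
Proof.
move=> tau0 rn; rewrite big1// => j _; rewrite indicE memNset ?mulr0// => jr.
by move/negP : rn; apply; exact: cell_sub jr.
Qed.

Lemma measurable_cell tau i : measurable (cell tau i).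
Proof. exact: measurable_itv. Qed.

Lemma cell_measure tau i : 0 < tau -> leb (cell tau i) = tau%:E.
Proof.
move=> tau0; rewrite /cell lebesgue_measure_itv/= lte_fin ltr_pM2r// ltr_nat ltnS leqnn.
by rewrite -EFinD -mulrBl -natrB// subSnn mul1r.
Qed.

Lemma integral_cells tau n (c : nat -> R) : 0 < tau -> (forall i, 0 <= c i) ->
  (\int[leb]_r (\sum_(j < n) c j * \1_(cell tau j) r)%:E =
   (tau * \sum_(j < n) c j)%:E)%E.
Proof.
move=> tau0 c0; under eq_integral do rewrite -sumEFin.
rewrite ge0_integral_sum//; first last.
- by move=> i r _; rewrite lee_fin mulr_ge0.
- move=> i; apply/measurable_EFinP; apply: measurable_funM => //.
  by apply: measurable_indic; exact: measurable_cell.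
rewrite mulr_sumr -sumEFin; apply: eq_bigr => i _.
under eq_integral do rewrite EFinM.
rewrite ge0_integralZl//; [|by apply/measurable_EFinP; apply: measurable_indic; exact: measurable_cell|by rewrite lee_fin].
rewrite integral_indic//; last exact: measurable_cell.
rewrite setIT (_ : _ (cell tau i) = tau%:E) -?EFinM 1?mulrC//; exact: cell_measure.
Qed.

Lemma measurable_cells tau n (c : nat -> R) :
  measurable_fun setT (fun r => \sum_(j < n) c j * \1_(cell tau j) r).
Proof.
apply: measurable_sum => i; apply: measurable_funM => //.
by apply: measurable_indic; exact: measurable_cell.
Qed.

Lemma measurable_ou_kernel l t : measurable_fun setT (ou_kernel l t).
Proof.
apply: measurable_funM; first by apply: measurable_indic; exact: measurable_itv.
apply: measurableT_comp => //; apply: measurableT_comp => //.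
by apply: measurable_funM => //; apply: measurable_funB.
Qed.

Lemma integral_expR_le (c a b : R) : 0 < c -> a <= b ->
  (\int[leb]_(r in `]a, b]) (expR (- (c * (b - r))))%:E
   <= (c^-1 * (1 - expR (- (c * (b - a)))))%:E)%E.
Proof.
move=> c0; rewrite le_eqVlt => /predU1P[->|ab].
  by rewrite set_itvoc0 integral_set0 lee_fin subrr mulr0 oppr0 expR0 subrr mulr0.
rewrite integral_itv_obnd_cbnd; last first.
  apply: measurable_funTS; apply/measurable_EFinP.
  apply: measurableT_comp => //; apply: measurableT_comp => //.
  by apply: measurable_funM => //; apply: measurable_funB.
have contf : continuous (fun r : R => expR (- (c * (b - r)))).
  move=> r; apply: (continuous_comp (f := fun r => - (c * (b - r)))); last exact: continuous_expR.
  by apply: cvgN; apply: cvgM; [exact: cvg_cst|apply: cvgB; [exact: cvg_cst|exact: cvg_id]].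
have dF (r : R) : is_derive r 1 (fun r => c^-1 * expR (- (c * (b - r)))) (expR (- (c * (b - r)))).
  have d1 : is_derive r 1 (fun r : R => - (c * (b - r))) c.
    by apply: is_derive_eq; rewrite /GRing.scale/=; ring.
  have d2 : is_derive r 1 (expR \o (fun r : R => - (c * (b - r)))) (expR (- (c * (b - r))) *: c).
    exact: is_derive1_comp.
  have d3 := is_deriveZ c^-1 d2.
  apply: is_derive_eq d3 _.
  by rewrite /GRing.scale/=; field; rewrite gt_eqF.
rewrite (@continuous_FTC2 _ _ (fun r => c^-1 * expR (- (c * (b - r)))) _ _ ab).
- by rewrite -EFinB lee_fin subrr mulr0 oppr0 expR0 -mulrBr.
- exact: continuous_subspaceT.
- split.
  + by move=> x _; exact: (@ex_derive _ _ _ _ _ _ _ (dF x)).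
  + by apply: cvg_at_right_filter; apply: cvgM; [exact: cvg_cst|exact: contf].
  + by apply: cvg_at_left_filter; apply: cvgM; [exact: cvg_cst|exact: contf].
- by move=> x _; rewrite derive1E; exact: (@derive_val _ _ _ _ _ _ _ (dF x)).
Qed.

Lemma integral_expR_le_inv (c a b : R) : 0 < c ->
  (\int[leb]_(r in `]a, b]) (expR (- (c * (b - r))))%:E <= c^-1%:E)%E.
Proof.
move=> c0; have [ab|ba] := leP a b.
  apply: le_trans (integral_expR_le c0 ab) _; rewrite lee_fin.
  by rewrite ger_pMr ?invr_gt0// gerBl expR_ge0.
by rewrite set_itv_ge ?integral_set0 ?lee_fin ?invr_ge0 ?ltW// -leNgt bnd_simp ltW.
Qed.

Lemma oneB_expRN_le x : 0 <= x -> 0 <= 1 - expR (- x) <= Num.min 1 x.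
Proof.
move=> x0; rewrite subr_ge0 le_min gerBl expR_ge0.
have := expR_ge1Dx (- x) => h.
by rewrite -(expR0 R) ler_expR oppr_le0 x0/= lerBlDr expR0; clear -h; lra.
Qed.

(** * One mode of the Euler scheme against the exponential *)

Section euler.
Variables (l tau : R).
Hypotheses (l0 : 0 < l) (tau0 : 0 < tau).
Let x := tau * l.
Let rho := euler_factor l tau.
Let E := expR (- x).

Let x0 : 0 < x. Proof. exact: mulr_gt0. Qed.
Let rhoE : rho * (1 + x) = 1.
Proof. by rewrite /rho /euler_factor mulVf// gt_eqF// addr_gt0. Qed.

Lemma euler_factor_gt0 : 0 < rho.
Proof. by rewrite invr_gt0 addr_gt0// mulr_gt0. Qed.

Lemma euler_factor_le1 : rho <= 1.
Proof. by rewrite invf_le1 ?addr_gt0// ?mulr_gt0// lerDl mulr_ge0 ?ltW. Qed.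

Lemma euler_factor_exp_le1 m : 0 <= rho ^+ m <= 1.
Proof.
by rewrite exprn_ge0 ?(ltW euler_factor_gt0)// exprn_ile1 ?(ltW euler_factor_gt0)// euler_factor_le1.
Qed.

Let E_le_rho : E <= rho.
Proof.
rewrite /E expRN /rho /euler_factor lef_pV2 ?posrE ?expR_gt0 ?addr_gt0//.
exact: expR_ge1Dx.
Qed.

(** One-step error: E >= 1 - x, and rho (1 + x) = 1 turns 1 - x into rho (1 - x^2). *)
Let rho_sub_E : rho - E <= x ^+ 2 * rho.
Proof.
have h := expR_ge1Dx (- x).
have : rho * (1 + x) * (1 - x) = 1 - x by rewrite rhoE mul1r.
rewrite -/E in h; move: h rhoE; rewrite -/rho; set r := rho; nra.
Qed.

(** Bernoulli's inequality (1 + x)^m >= 1 + m x. It is the smoothing property of the scheme and pays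
    for the factor m that appears when m one-step errors add up. *)
Lemma mul_euler_factor_exp_le1 m : m%:R * x * rho ^+ m <= 1.
Proof.
suff : m%:R * x <= (1 + x) ^+ m.
  move=> h; have rm : 0 <= rho ^+ m by case/andP: (euler_factor_exp_le1 m).
  by apply: le_trans (ler_wpM2r rm h) _; rewrite -exprMn mulrC rhoE expr1n.
suff : 1 + m%:R * x <= (1 + x) ^+ m by apply: le_trans; rewrite lerDr.
elim: m => [|m IH]; first by rewrite mul0r addr0 expr0.
rewrite exprS; apply: le_trans (ler_wpM2l _ IH); last by rewrite addr_ge0// ltW.
rewrite -natr1; have : 0 <= m%:R * (x * x) by rewrite !mulr_ge0// ltW.
by lra.
Qed.

(** Telescoping with E <= rho: each of the m steps contributes at most x^2 rho^m. *)
Lemma euler_factor_exp_sub m : 0 <= rho ^+ m - E ^+ m <= m%:R * x ^+ 2 * rho ^+ m.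
Proof.
have E0 : 0 <= E by exact: expR_ge0.
have r0 := ltW euler_factor_gt0.
elim: m => [|m /andP[IH1 IH2]]; first by rewrite !expr0 subrr !mul0r lexx.
rewrite subr_ge0 lerXn2r ?nnegrE//=.
have -> : rho ^+ m.+1 - E ^+ m.+1 = rho * (rho ^+ m - E ^+ m) + E ^+ m * (rho - E).
  by rewrite !exprS; ring.
have h1 : E ^+ m * (rho - E) <= rho ^+ m * (x ^+ 2 * rho).
  by apply: ler_pM; rewrite ?exprn_ge0 ?subr_ge0// -subr_ge0.
apply: le_trans (lerD (ler_wpM2l r0 IH2) h1) _.
by rewrite -natr1 (exprS rho m) le_eqVlt; apply/orP; left; apply/eqP; ring.
Qed.

Let EX m : E ^+ m = expR (- (l * (m%:R * tau))).
Proof. by rewrite /E -expRM_natl; congr expR; rewrite /x; ring. Qed.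

(** Smoothing reduces n x^2 rho^n to x, uniformly in n; the bound 1 serves the modes with large
    x. *)
Lemma euler_initial_error n : (expR (- (l * (n%:R * tau))) - rho ^+ n) ^+ 2 <= Num.min 1 (x ^+ 2).
Proof.
rewrite -EX.
have /andP[h1 h2] := euler_factor_exp_sub n.
have /andP[rn0 rn1] := euler_factor_exp_le1 n.
have En : 0 <= E ^+ n by rewrite exprn_ge0 ?expR_ge0.
rewrite -sqrrN opprB le_min; apply/andP; split.
  by rewrite expr_le1// lerBlDr ler_wpDr.
rewrite lerXn2r ?nnegrE ?(ltW x0)//; apply: le_trans h2 _.
have := ler_wpM2l (ltW x0) (mul_euler_factor_exp_le1 n).
by rewrite mulr1; apply: le_trans; rewrite le_eqVlt; apply/orP; left; apply/eqP; ring.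
Qed.

Lemma euler_kernel_cell n i r : (i < n)%N -> cell tau i r ->
  euler_kernel l tau n r = rho ^+ (n - i).
Proof. by move=> ni ir; exact: (sum_cell (fun i => rho ^+ (n - i)) tau0 ni ir). Qed.

Lemma euler_kernel_le1 n r : 0 <= euler_kernel l tau n r <= 1.
Proof.
have [/andP[r0 rn]|rn] := boolP (0 < r <= n%:R * tau).
  have [i ni ir] := cell_exists tau0 r0 rn.
  by rewrite (euler_kernel_cell ni ir) euler_factor_exp_le1.
by rewrite /euler_kernel (sum_cell0 (fun i => rho ^+ (n - i)) tau0 rn) lexx ler01.
Qed.

(** With m = n - i, the exponential lies between E^m and rho^(m-1) = rho^m (1 + x). Below rho^m, the
    difference is at most rho^m and at most m x^2 rho^m; multiplying the two bounds, smoothing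
    absorbs m x rho^m. Above rho^m, it is at most x rho^m and at most 1. The factor rho^m is kept so
    that the sum over the cells stays geometric. *)
Lemma kernel_diff_cell n i r : (i < n)%N -> cell tau i r ->
  (expR (- (l * (n%:R * tau - r))) - rho ^+ (n - i)) ^+ 2 <= x * rho ^+ (n - i).
Proof.
move=> ni; rewrite /cell/= in_itv/= => /andP[ir ri].
set s := n%:R * tau - r; pose m := (n - i)%N.
have mE : (m.-1).+1 = m by rewrite prednK// subn_gt0.
have nE : n%:R = m%:R + i%:R :> R by rewrite -natrD subnK// ltnW.
have /andP[rm0 rm1] := euler_factor_exp_le1 m.
have s1 : expR (- (l * s)) <= rho ^+ m.-1.
  apply: (@le_trans _ _ (E ^+ m.-1)); last by rewrite lerXn2r ?nnegrE ?expR_ge0 ?(ltW euler_factor_gt0).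
  rewrite EX ler_expR lerN2 ler_wpM2l ?(ltW l0)//.
  have -> : m.-1%:R = m%:R - 1 :> R by rewrite -[in RHS]mE -natr1 addrK.
  rewrite /s nE; move: ri; rewrite -natr1; lra.
have s2 : E ^+ m <= expR (- (l * s)).
  rewrite EX ler_expR lerN2 ler_wpM2l ?(ltW l0)//.
  rewrite /s nE; move: ir; lra.
have [le|/ltW le] := leP (expR (- (l * s))) (rho ^+ m).
  have h0 : 0 <= rho ^+ m - expR (- (l * s)) by rewrite subr_ge0.
  have /andP[_ h] := euler_factor_exp_sub m.
  rewrite -sqrrN opprB expr2.
  apply: (@le_trans _ _ (rho ^+ m * (m%:R * x ^+ 2 * rho ^+ m))).
    apply: ler_pM => //; first by rewrite lerBlDr lerDl expR_ge0.
    by apply: le_trans h; rewrite lerD2l lerN2.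
  have := ler_wpM2l (mulr_ge0 (ltW x0) rm0) (mul_euler_factor_exp_le1 m).
  by rewrite mulr1; apply: le_trans; rewrite le_eqVlt; apply/orP; left; apply/eqP; ring.
have h0 : 0 <= expR (- (l * s)) - rho ^+ m by rewrite subr_ge0.
have h1 : expR (- (l * s)) - rho ^+ m <= x * rho ^+ m.
  have : rho ^+ m.-1 = rho ^+ m * (1 + x) by rewrite -{2}mE exprSr -mulrA rhoE mulr1.
  by move: s1 => /[swap] ->; lra.
have h2 : expR (- (l * s)) - rho ^+ m <= 1.
  have : expR (- (l * s)) <= 1.
    by apply: le_trans s1 _; case/andP: (euler_factor_exp_le1 m.-1).
  by move: rm0; lra.
by rewrite expr2 -[leRHS]mul1r ler_pM.
Qed.

Lemma sum_euler_factor n : x * (\sum_(i < n) rho ^+ (n - i)) <= 1.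
Proof.
have -> : \sum_(i < n) rho ^+ (n - i) = \sum_(i < n) rho ^+ i.+1.
  rewrite -(big_mkord xpredT (fun i => rho ^+ (n - i))) big_nat_rev/= add0n big_mkord.
  by apply: eq_bigr => i _; congr (_ ^+ _); rewrite subKn.
suff -> : x * (\sum_(i < n) rho ^+ i.+1) = 1 - rho ^+ n.
  by rewrite gerBl; case/andP: (euler_factor_exp_le1 n).
elim: n => [|n IH]; first by rewrite big_ord0 mulr0 expr0 subrr.
rewrite big_ord_recr/= mulrDr IH.
have : rho ^+ n = rho ^+ n.+1 * (1 + x) by rewrite exprSr -mulrA rhoE mulr1.
by move=> ->; ring.
Qed.

Lemma measurable_euler_kernel n : measurable_fun setT (euler_kernel l tau n).
Proof. exact: (@measurable_cells tau n (fun i => rho ^+ (n - i))). Qed.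

(** Integrating the cell bound leaves tau times x times the sum of rho^(n-i), and that geometric sum
    is at most 1/x: eigenvalue and n disappear. *)
Lemma kernel_diff_le_tau n :
  (\int[leb]_r ((ou_kernel l (n%:R * tau) r - euler_kernel l tau n r) ^+ 2)%:E <= tau%:E)%E.
Proof.
apply: (@le_trans _ _ (\int[leb]_r (\sum_(j < n) (x * rho ^+ (n - j)) * \1_(cell tau j) r)%:E)%E).
  apply: ge0_le_integral_nonmeas => r _; rewrite lee_fin ?sqr_ge0//.
  have [/andP[r0 rn]|rn] := boolP (0 < r <= n%:R * tau).
    have [i ni ir] := cell_exists tau0 r0 rn.
    rewrite (euler_kernel_cell ni ir) (sum_cell (fun j => x * rho ^+ (n - j)) tau0 ni ir).
    rewrite /ou_kernel indicE mem_set/= ?in_itv/= ?r0// mul1r.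
    exact: kernel_diff_cell.
  rewrite (sum_cell0 (fun j => x * rho ^+ (n - j)) tau0 rn).
  rewrite /euler_kernel (sum_cell0 (fun i => rho ^+ (n - i)) tau0 rn).
  rewrite /ou_kernel indicE memNset/= ?in_itv/=; last exact/negP.
  by rewrite mul0r subrr expr0n.
have c0 i : 0 <= x * rho ^+ (n - i).
  by rewrite mulr_ge0 ?(ltW x0)//; case/andP: (euler_factor_exp_le1 (n - i)).
rewrite (integral_cells n tau0 c0) lee_fin ger_pMr// -mulr_sumr.
exact: sum_euler_factor.
Qed.

End euler.

Lemma ou_kernel_sqr l t r : ou_kernel l t r ^+ 2 = \1_(`]0, t]) r * expR (- (2 * l * (t - r))).
Proof.
rewrite exprMn; congr (_ * _); first by rewrite indicE; case: (_ \in _); rewrite ?expr1n ?expr0n.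
by rewrite expr2 -expRD; congr expR; ring.
Qed.

Lemma ou_kernel_le1 l t r : 0 < l -> 0 <= ou_kernel l t r <= 1.
Proof.
move=> l0; rewrite /ou_kernel indicE.
have [|_] := boolP (r \in _); last by rewrite mul0r lexx ler01.
rewrite inE/= in_itv/= => /andP[r0 rt]; rewrite mul1r expR_ge0/=.
by rewrite -(expR0 R) ler_expR oppr_le0 mulr_ge0 ?subr_ge0// ltW.
Qed.

Lemma integral_ou_kernel_sqr l t : (\int[leb]_r (ou_kernel l t r ^+ 2)%:E =
  \int[leb]_(r in `]0%R, t]) (expR (- (2 * l * (t - r))))%:E)%E.
Proof.
rewrite [RHS]integral_mkcond; apply: eq_integral => r _.
rewrite ou_kernel_sqr patchE indicE; case: (r \in _); by rewrite ?mul1r ?mul0r.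
Qed.

Lemma ou_kernel_sqr_le l t : 0 < l -> (\int[leb]_r (ou_kernel l t r ^+ 2)%:E <= (2 * l)^-1%:E)%E.
Proof.
by move=> l0; rewrite integral_ou_kernel_sqr; apply: integral_expR_le_inv; rewrite mulr_gt0.
Qed.

Lemma integral_expR_le_length (c a b : R) : 0 < c -> a <= b ->
  (\int[leb]_(r in `]a, b]) (expR (- (c * (b - r))))%:E <= (b - a)%:E)%E.
Proof.
move=> c0 ab; apply: le_trans (integral_expR_le c0 ab) _; rewrite lee_fin.
have : 0 <= c * (b - a) by rewrite mulr_ge0 ?subr_ge0// ltW.
move=> /oneB_expRN_le/andP[_]; rewrite le_min => /andP[_ h].
by rewrite ler_pdivrMl.
Qed.

Lemma kernel_diff_le_inv l tau n : 0 < l -> 0 < tau ->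
  (\int[leb]_r ((ou_kernel l (n%:R * tau) r - euler_kernel l tau n r) ^+ 2)%:E <= (2 / l)%:E)%E.
Proof.
move=> l0 tau0.
(* For a and b in [0, 1], (a - b)^2 <= a^2 + b. The two integrals are at most 1/(2l) and 1/l; the
   latter is enlarged to 3/(2l) to reach 2/l. *)
apply: (@le_trans _ _ (\int[leb]_r ((ou_kernel l (n%:R * tau) r ^+ 2)%:E + (euler_kernel l tau n r)%:E))%E).
  apply: ge0_le_integral_nonmeas => r _; rewrite -?EFinD lee_fin ?sqr_ge0//.
  have /andP[k0 k1] := ou_kernel_le1 (n%:R * tau) r l0.
  have /andP[g0 g1] := euler_kernel_le1 l0 tau0 n r.
  by move: k0 k1 g0 g1; set a := ou_kernel _ _ _; set b := euler_kernel _ _ _ _; nra.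
rewrite ge0_integralD//; first last.
- by apply/measurable_EFinP; exact: measurable_euler_kernel.
- by move=> r _; rewrite lee_fin; case/andP: (euler_kernel_le1 l0 tau0 n r).
- by apply/measurable_EFinP/measurable_funX; exact: measurable_ou_kernel.
- by move=> r _; rewrite lee_fin sqr_ge0.
have c0 i : 0 <= euler_factor l tau ^+ (n - i) by case/andP: (euler_factor_exp_le1 l0 tau0 (n - i)).
have -> : (2 / l)%:E = ((2 * l)^-1 + (3 / 2) * l^-1)%:E :> \bar R.
  by congr EFin; field; rewrite gt_eqF.
rewrite EFinD; apply: leeD; first exact: ou_kernel_sqr_le.
rewrite (integral_cells n tau0 c0) lee_fin.
apply: (@le_trans _ _ l^-1); last by rewrite ler_peMl ?invr_ge0 ?(ltW l0)// ler_pdivlMr// mul1r ler_nat.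
by rewrite -[leRHS]mul1r ler_pdivlMr// mulrAC; exact: sum_euler_factor.
Qed.

(** Let q = 1 - exp(-l (t - s)). In absolute value the difference is q times the kernel of s on ]0,
    s], and it is the kernel of t on ]s, t]. As q^2 <= q, the first part costs at most q / (2 l),
    the second the integral of exp(-2 l (t - r)); both are at most h and at most 1/l. *)
Lemma ou_kernel_increment l s t h : 0 < l -> 0 <= s -> s <= t -> t - s <= h ->
  (\int[leb]_r ((ou_kernel l t r - ou_kernel l s r) ^+ 2)%:E <= (2 * Num.min h l^-1)%:E)%E.
Proof.
move=> l0 s0 st tsh; have l20 : 0 < 2 * l by rewrite mulr_gt0.
have ts : 0 <= l * (t - s) by rewrite mulr_ge0 ?subr_ge0// ltW.
have /andP[q0] := oneB_expRN_le ts; rewrite le_min => /andP[q1 q2].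
set q := 1 - expR (- (l * (t - s))) in q0 q1 q2.
have f1m : measurable_fun setT (fun r => (q * (ou_kernel l s r ^+ 2))%:E).
  apply/measurable_EFinP; apply: measurable_funM => //; apply: measurable_funX.
  exact: measurable_ou_kernel.
have f2m : measurable_fun setT (fun r => (\1_(`]s, t]) r * expR (- (2 * l * (t - r))))%:E).
  apply/measurable_EFinP; apply: measurable_funM.
    by apply: measurable_indic; exact: measurable_itv.
  apply: measurableT_comp => //; apply: measurableT_comp => //.
  by apply: measurable_funM => //; apply: measurable_funB.
apply: (@le_trans _ _ (\int[leb]_r ((q * (ou_kernel l s r ^+ 2))%:E +
    (\1_(`]s, t]) r * expR (- (2 * l * (t - r))))%:E))%E).
  apply: ge0_le_integral_nonmeas => r _; rewrite -?EFinD lee_fin ?sqr_ge0//.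
  rewrite {1 2}/ou_kernel ou_kernel_sqr !indicE !mem_setE !in_itv/=.
  have [r0|r0] := ltP 0 r; last first.
    rewrite /= !mul0r subrr expr0n/= mulr0 add0r.
    by rewrite [s < r]ltNge (le_trans r0 s0)/= mul0r.
  have [rs|sr] := leP r s.
    rewrite (le_trans rs st)/= !mul1r mul0r addr0.
    have -> : expR (- (l * (t - r))) = expR (- (l * (s - r))) * (1 - q).
      by rewrite /q subKr -expRD; congr expR; ring.
    have -> : expR (- (2 * l * (s - r))) = expR (- (l * (s - r))) ^+ 2.
      by rewrite expr2 -expRD; congr expR; ring.
    set E := expR _; have : 0 <= E ^+ 2 by rewrite sqr_ge0.
    rewrite (_ : (E * (1 - q) - E) ^+ 2 = q * (q * E ^+ 2)); last by ring.
    by move=> E2; rewrite ler_wpM2l// ler_piMl.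
  have [rt|tr] := leP r t; last by rewrite /= !mul0r subrr expr0n/= mulr0 addr0.
  rewrite /= !mul1r !mul0r subr0 mulr0 add0r.
  by rewrite expr2 -expRD le_eqVlt; apply/orP; left; apply/eqP; congr expR; ring.
rewrite ge0_integralD//; first last.
- by move=> r _; rewrite lee_fin mulr_ge0 ?sqr_ge0.
under eq_integral do rewrite EFinM.
rewrite ge0_integralZl//; first last.
- by move=> r _; rewrite lee_fin sqr_ge0.
- by apply/measurable_EFinP; apply: measurable_funX; exact: measurable_ou_kernel.
have i2 : (\int[leb]_r (\1_(`]s, t]) r * expR (- (2 * l * (t - r))))%:E <= (Num.min h l^-1)%:E)%E.
  have -> : (\int[leb]_r (\1_(`]s, t]) r * expR (- (2 * l * (t - r))))%:E =
      \int[leb]_(r in `]s, t]) (expR (- (2 * l * (t - r))))%:E)%E.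
    rewrite [RHS]integral_mkcond; apply: eq_integral => r _.
    by rewrite patchE indicE; case: (r \in _); rewrite ?mul1r ?mul0r.
  rewrite /Num.min; case: ifPn => _.
    by apply: le_trans (integral_expR_le_length l20 st) _; rewrite lee_fin.
  apply: le_trans (integral_expR_le_inv _ _ l20) _; rewrite lee_fin.
  by rewrite lef_pV2 ?posrE// ler_peMl ?ler1n// ltW.
have i1 : (q%:E * \int[leb]_r (ou_kernel l s r ^+ 2)%:E <= (Num.min h l^-1)%:E)%E.
  apply: (@le_trans _ _ (q%:E * (2 * l)^-1%:E)%E).
    by apply: lee_wpmul2l; [rewrite lee_fin|exact: ou_kernel_sqr_le].
  rewrite -EFinM lee_fin le_min; apply/andP; split.
    rewrite ler_pdivrMr//; apply: le_trans q2 _.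
    have := ler_wpM2l (ltW l0) tsh; have : 0 <= l * h.
      by apply: le_trans ts _; rewrite ler_wpM2l// ltW.
    by lra.
  by rewrite ler_pdivrMr// mulrCA mulVf ?gt_eqF// mulr1; apply: le_trans q1 _; rewrite ler1n.
rewrite (_ : 2 * Num.min h l^-1 = Num.min h l^-1 + Num.min h l^-1); last by ring.
by rewrite [leRHS]EFinD; exact: (leeD i1 i2).
Qed.

(** Write y = y^b y^(1-b) and use one bound in each factor. This is where order in the step size is
    traded for the negative power of the eigenvalue that makes the noise summable. *)
Lemma interpolation_le y h l (b : R) : 0 <= b <= 1 -> 0 < h -> 0 < l ->
  0 <= y -> y <= h -> y <= l^-1 -> y <= h `^ b * l `^ (b - 1).
Proof.
move=> /andP[b0 b1] h0 l0 y0 yh yl.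
have [->|yn0] := eqVneq y 0; first by rewrite mulr_ge0 ?powR_ge0.
have -> : y = y `^ b * y `^ (1 - b).
  by rewrite -powRD ?subrKC ?powRr1// yn0 implybT.
apply: ler_pM; rewrite ?powR_ge0//; first by apply: ge0_ler_powR => //; rewrite nnegrE ltW.
have -> : l `^ (b - 1) = l^-1 `^ (1 - b).
  by rewrite -powR_inv1 ?ltW// -powRrM mulN1r opprB.
by apply: ge0_ler_powR => //; rewrite ?nnegrE ?subr_ge0 ?invr_ge0// ltW.
Qed.

Lemma min1_sqr_le_powR x (b : R) : 0 <= b <= 2 -> 0 < x -> Num.min 1 (x ^+ 2) <= x `^ b.
Proof.
move=> /andP[b0 b2] x0; have [x1|x1] := leP 1 x.
  rewrite ge_min; apply/orP; left.
  by rewrite -[leLHS](powRr0 x); apply: ler_powR.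
rewrite ge_min; apply/orP; right.
have x01 : 0 < x <= 1 by rewrite x0 ltW.
have := ger_powR x01 b2.
by rewrite powR_mulrn// ltW.
Qed.

End scalar_estimates.

(** * Wiener integrals of deterministic functions *)

Section gaussian_second_moment.
Variable R : realType.
Local Notation leb := (@lebesgue_measure R).

Lemma integral_normal_prob (m s : R) (f : R -> \bar R) : s != 0 ->
  (forall x, (0 <= f x)%E) -> measurable_fun setT f ->
  (\int[normal_prob m s]_x f x = \int[leb]_x (f x * (normal_pdf m s x)%:E))%E.
Proof.
move=> s0 f0 mf; have dom := normal_prob_dominates m s.
rewrite -(Radon_Nikodym_SigmaFinite.change_of_variables dom f0)//.
have fi := Radon_Nikodym_SigmaFinite.f_integrable dom.
apply: ae_eq_integral => //.
- by apply: emeasurable_funM => //; exact: measurable_int fi.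
- apply: emeasurable_funM => //; apply/measurable_EFinP; exact: measurable_normal_pdf.
have : ae_eq leb setT (Radon_Nikodym_SigmaFinite.f (normal_prob m s) leb)
    (fun x => (normal_pdf m s x)%:E).
  apply: integral_ae_eq => //.
    by apply/measurable_EFinP; exact: measurable_normal_pdf.
  by move=> E _ mE; rewrite -(Radon_Nikodym_SigmaFinite.f_integral dom).
by apply: filterS => x /= h Tx; rewrite h.
Qed.

(** The number 1, kept as a symbol: it only enters the final constant, where finiteness suffices. *)
Definition gaussian_moment2 : \bar R := (\int[normal_prob (0 : R) 1]_x (x ^+ 2)%:E)%E.

Lemma gaussian_moment2_fin : gaussian_moment2 \is a fin_num.
Proof.
rewrite ge0_fin_numE; last by apply: integral_ge0 => x _; rewrite lee_fin sqr_ge0.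
rewrite /gaussian_moment2 integral_normal_prob//; first last.
- by apply/measurable_EFinP; exact: measurable_funX.
- by move=> x; rewrite lee_fin sqr_ge0.
(* Domination by the normal density of variance 2: x^2 <= 4 exp(x^2/4), hence x^2 exp(-x^2/2) <= 4
   exp(-x^2/4). *)
pose s : R := Num.sqrt 2.
have s0 : s != 0 by rewrite gt_eqF// sqrtr_gt0.
have ss : s ^+ 2 = 2 by rewrite sqr_sqrtr.
have c0 : 0 < 4 * normal_peak 1 / normal_peak s.
  by rewrite divr_gt0 ?mulr_gt0 ?normal_peak_gt0.
apply: (@le_lt_trans _ _ (\int[leb]_x ((4 * normal_peak 1 / normal_peak s)%:E * (normal_pdf 0 s x)%:E))%E).
  apply: ge0_le_integral_nonmeas => x _; rewrite -EFinM lee_fin.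
    by rewrite mulr_ge0 ?sqr_ge0 ?normal_pdf_ge0.
  rewrite !normal_pdfE//.
  rewrite [leRHS](_ : _ = normal_peak 1 * (4 * normal_fun 0 s x)); last first.
    by field; rewrite gt_eqF// normal_peak_gt0.
  rewrite mulrCA ler_wpM2l ?normal_peak_ge0//.
  rewrite /normal_fun ss subr0 expr1n.
  have -> : - x ^+ 2 / (1 *+ 2) = - x ^+ 2 / (2 *+ 2) + - x ^+ 2 / (2 *+ 2) by field.
  rewrite expRD mulrA ler_pM2r ?expR_gt0//.
  have -> : - x ^+ 2 / (2 *+ 2) = - (x ^+ 2 / 4) by rewrite mulNr -mulrnA.
  rewrite expRN ler_pdivrMr ?expR_gt0//.
  have := expR_ge1Dx (x ^+ 2 / 4); lra.
rewrite ge0_integralZl//; first last.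
- by rewrite lee_fin ltW.
- by move=> x _; rewrite lee_fin normal_pdf_ge0.
- by apply/measurable_EFinP; exact: measurable_normal_pdf.
by rewrite integral_normal_pdf mule1 ltry.
Qed.

End gaussian_second_moment.

Section independent_product.
Context d (Om : measurableType d) (R : realType) (P : probability Om R).

(** The product rule on rectangles identifies the joint law with the product of the two laws; by
    Fubini the inner integral is then a multiple of the mean of [Y]. *)
Lemma indep_expectation0 (X Y : Om -> R) :
  measurable_fun setT X -> measurable_fun setT Y ->
  (forall A B : set R, measurable A -> measurable B ->
     P (X @^-1` A `&` Y @^-1` B) = (P (X @^-1` A) * P (Y @^-1` B))%E) ->
  P.-integrable setT (fun w => (X w * Y w)%:E) ->
  P.-integrable setT (EFin \o Y) ->
  (\int[P]_w (Y w)%:E = 0)%E ->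
  (\int[P]_w (X w * Y w)%:E = 0)%E.
Proof.
move=> mX mY ind intXY intY Y0.
pose X' : {mfun Om >-> R} := mfun_Sub (mem_set mX).
pose Y' : {mfun Om >-> R} := mfun_Sub (mem_set mY).
have mXY : measurable_fun setT (fun w => (X w, Y w)) by exact: measurable_fun_pair.
pose XY : {mfun Om >-> _} := mfun_Sub (mem_set mXY).
pose f : R * R -> \bar R := fun z => (z.1 * z.2)%:E.
have mf : measurable_fun setT f by apply/measurable_EFinP; apply: measurable_funM.
have prodE A : measurable A -> A `<=` setT ->
    (distribution P X' \x distribution P Y')%E A = distribution P XY A.
  by move=> mA _; apply: product_measure_unique.
have fint : (distribution P XY).-integrable setT f.
  by apply: integrable_pushforward.
have -> : (\int[P]_w (X w * Y w)%:E = \int[distribution P XY]_z f z)%E.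
  by rewrite integral_distribution.
rewrite -(eq_measure_integral _ prodE).
have fint' : (distribution P X' \x distribution P Y')%E.-integrable setT f.
  apply/integrableP; split => //; rewrite (eq_measure_integral _ prodE).
  by case/integrableP: fint.
rewrite -integral12_prod_meas1// integral0_eq// => x _.
rewrite /fubini_F /f/=; under eq_integral do rewrite EFinM.
rewrite integralZl//; last by apply: integrable_pushforward.
by rewrite integral_distribution//= Y0 mule0.
Qed.

End independent_product.

Lemma sqr_integrable_Lfun2 d (T : measurableType d) (R : realType)
    (mu : {measure set T -> \bar R}) (f : T -> R) : measurable_fun setT f ->
  (\int[mu]_x ((f x) ^+ 2)%:E < +oo)%E -> f \in Lfun mu 2%:E.
Proof.
move=> mf f2; rewrite inE; apply/andP; split; rewrite inE//=.
rewrite /finite_norm unlock poweR_lty//; apply: le_lt_trans f2.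
apply: ge0_le_integral_nonmeas => x _ /=; first by rewrite lee_fin powR_ge0.
by rewrite powR_mulrn// real_normK// num_real.
Qed.

Lemma integrableZl_EFin d (T : measurableType d) (R : realType)
    (mu : {measure set T -> \bar R}) (k : R) (f : T -> R) :
  mu.-integrable setT (EFin \o f) -> mu.-integrable setT (EFin \o (fun x => k * f x)).
Proof. by move=> /(integrableZl measurableT k); apply: eq_integrable. Qed.

Lemma integrableD_EFin d (T : measurableType d) (R : realType)
    (mu : {measure set T -> \bar R}) (f g : T -> R) :
  mu.-integrable setT (EFin \o f) -> mu.-integrable setT (EFin \o g) ->
  mu.-integrable setT (EFin \o (fun x => f x + g x)).
Proof. by move=> fi gi; have := integrableD measurableT fi gi; apply: eq_integrable. Qed.

Section wiener.
Context d (T : measurableType d) (R : realType) (mu : {measure set T -> \bar R}).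
Local Notation H := (L2 mu).
Context d' (Om : measurableType d') (P : probability Om R).
Variables (tT : R) (F : R -> set (set Om)) (Q : H -> H) (W : R -> H -> Om -> R).
Hypotheses (hF : normal_filtration P tT F) (hQ : nonneg_self_adjoint Q)
  (hW : Q_wiener P tT F Q W).
Implicit Types (s t : R) (h g : H).

Let m2 : R := fine (gaussian_moment2 R).

Lemma gaussian_moment2_fine_ge0 : 0 <= m2.
Proof. by apply: fine_ge0; apply: integral_ge0 => x _; rewrite lee_fin sqr_ge0. Qed.

Lemma wiener_measurable t h : 0 <= t <= tT -> measurable_fun setT (W t h).
Proof.
move=> tin _ Y mY; rewrite setTI; have tin' : t \in `[0, tT] by rewrite in_itv.
by apply: (filtration_sub hF tin'); exact: (wiener_adapted hW).
Qed.

Lemma increment_measurable s t h : 0 <= s -> s <= t -> t <= tT ->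
  measurable_fun setT (increment W s t h).
Proof.
move=> s0 st tT'; apply: measurable_funB; apply: wiener_measurable.
  by rewrite (le_trans s0 st).
by rewrite s0 (le_trans st).
Qed.

Lemma increment_linear s t a h g : 0 <= s -> s <= t -> t <= tT ->
  {ae P, forall w, increment W s t (a *: h + g) w = a * increment W s t h w + increment W s t g w}.
Proof.
move=> s0 st tT'; have ti : t \in `[0, tT] by rewrite in_itv/= (le_trans s0 st).
have si : s \in `[0, tT] by rewrite in_itv/= s0 (le_trans st).
apply: filterS2 (wiener_linear hW a h g ti) (wiener_linear hW a h g si) => w h1 h2.
by rewrite /increment h1 h2; ring.
Qed.

Lemma gaussian_integral (X : Om -> R) (v : R) (f : R -> \bar R) :
  v != 0 -> measurable_fun setT X -> centered_gaussian P X v ->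
  measurable_fun setT f -> P.-integrable setT (f \o X) ->
  (\int[P]_w f (X w) = \int[normal_prob 0%R (Num.sqrt v)]_x f x)%E.
Proof.
move=> v0 mX; rewrite /centered_gaussian (negbTE v0) => Xv mf intf.
have mX' : measurable_fun setT (X : Om -> measurableTypeR R) by exact: mX.
pose X' : {mfun Om >-> measurableTypeR R} := @mfun_Sub _ _ _ (measurableTypeR R) X (mem_set mX').
rewrite -(@integral_distribution _ _ _ _ _ P X')//.
by apply: eq_measure_integral => A mA _; exact: Xv.
Qed.

Lemma gaussian_integral_ge0 (X : Om -> R) (v : R) (f : R -> \bar R) :
  v != 0 -> measurable_fun setT X -> centered_gaussian P X v ->
  measurable_fun setT f -> (forall x, (0 <= f x)%E) ->
  (\int[P]_w f (X w) = \int[normal_prob 0%R (Num.sqrt v)]_x f x)%E.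
Proof.
move=> v0 mX; rewrite /centered_gaussian (negbTE v0) => Xv mf f0.
have mX' : measurable_fun setT (X : Om -> measurableTypeR R) by exact: mX.
pose X' : {mfun Om >-> measurableTypeR R} := @mfun_Sub _ _ _ (measurableTypeR R) X (mem_set mX').
rewrite -(@ge0_integral_distribution _ _ _ _ _ P X')//.
by apply: eq_measure_integral => A mA _; exact: Xv.
Qed.

Lemma increment_sqr s t h : 0 <= s -> s <= t -> t <= tT ->
  (\int[P]_w (increment W s t h w ^+ 2)%:E = (m2 * ((t - s) * L2_dot (Q h) h))%:E)%E.
Proof.
move=> s0 st tT'; set v := (t - s) * _.
have mX g := increment_measurable g s0 st tT'.
have mX2 g : measurable_fun setT (fun w => (increment W s t g w ^+ 2)%:E).
  by apply/measurable_EFinP; exact: measurable_funX.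
have [v0|v0] := eqVneq v 0.
  have := wiener_gaussian hW h s0 st tT'; rewrite /centered_gaussian -/v v0 eqxx => X0.
  rewrite mulr0 (ae_eq_integral (cst 0%E))//; first by rewrite integral0.
  by move: X0; apply: filterS => w /= -> _; rewrite expr0n.
have vgt0 : 0 < v.
  by rewrite lt0r v0 mulr_ge0 ?subr_ge0//; case: hQ.
(* Rescaling [h] to unit variance reduces every positive variance to [gaussian_moment2]. *)
pose a := (Num.sqrt v)^-1.
have a0 : 0 < a by rewrite invr_gt0 sqrtr_gt0.
have a2 : a ^+ 2 * v = 1 by rewrite exprVn sqr_sqrtr ?(ltW vgt0)// mulVf.
have Qah : (t - s) * L2_dot (Q (a *: h)) (a *: h) = 1.
  rewrite (bounded_linearZ (let: And3 q _ _ := hQ in q)) L2_dotZl L2_dotZr -a2 /v; ring.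
have := wiener_gaussian hW (a *: h) s0 st tT'; rewrite Qah => ga.
have ma : (\int[P]_w (increment W s t (a *: h) w ^+ 2)%:E = m2%:E)%E.
  have := gaussian_integral_ge0 (oner_neq0 _) (mX (a *: h)) ga (f := fun x => (x ^+ 2)%:E).
  move=> -> //; last by move=> x; rewrite lee_fin sqr_ge0.
    by rewrite sqrtr1 fineK//; exact: gaussian_moment2_fin.
  by apply/measurable_EFinP; exact: measurable_funX.
have : (\int[P]_w (increment W s t (a *: h) w ^+ 2)%:E =
    (a ^+ 2)%:E * \int[P]_w (increment W s t h w ^+ 2)%:E)%E.
  rewrite -ge0_integralZl//; first last.
  - by rewrite lee_fin sqr_ge0.
  - by move=> w _; rewrite lee_fin sqr_ge0.
  apply: ae_eq_integral => //; first exact: measurable_funeM.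
  (* Linearity comes in the form a h + g, so [a *: h] is read with g = 0; the second instance, -1
     times 0 plus 0, shows that the increment at the vector 0 vanishes almost surely. *)
  apply: filterS2 (increment_linear a h 0 s0 st tT') (increment_linear (-1) 0 0 s0 st tT').
  move=> w; rewrite addr0 scaler0 addr0 => -> h2 _.
  have -> : increment W s t 0 w = 0 by move: h2; lra.
  by rewrite addr0 exprMn EFinM.
rewrite ma; set I := (\int[P]_w _)%E => maI.
have I0 : (0 <= I)%E by apply: integral_ge0 => w _; rewrite lee_fin sqr_ge0.
have If : I \is a fin_num.
  rewrite ge0_fin_numE// ltNge leye_eq; apply/negP => /eqP Iy; move: maI; rewrite Iy.
  by rewrite gt0_muley// lte_fin exprn_gt0.
move: maI; rewrite -(fineK If) -EFinM => -[->]; congr EFin.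
by rewrite mulrAC a2 mul1r.
Qed.

Lemma increment_Lfun2 s t h : 0 <= s -> s <= t -> t <= tT ->
  increment W s t h \in Lfun P 2%:E.
Proof.
move=> s0 st tT'; apply: sqr_integrable_Lfun2; first exact: increment_measurable.
by rewrite increment_sqr// ltry.
Qed.

Lemma Lfun2_Lfun1 (X : Om -> R) : X \in Lfun P 2%:E -> X \in Lfun P 1.
Proof. by move/(Lfun_subset12 _); apply; exact: fin_num_measure. Qed.

(** The variance is even in [h], so the increments at [h] and [- h] have the same law, hence the
    same mean; but they are opposite almost surely. *)
Lemma increment_mean0 s t h : 0 <= s -> s <= t -> t <= tT ->
  (\int[P]_w (increment W s t h w)%:E = 0)%E.
Proof.
move=> s0 st tT'; set v := (t - s) * L2_dot (Q h) h.
have mX g := increment_measurable g s0 st tT'.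
have iX g : P.-integrable setT (EFin \o increment W s t g).
  by apply/Lfun1_integrable/Lfun2_Lfun1/increment_Lfun2.
have gh := wiener_gaussian hW h s0 st tT'.
have [v0|v0] := eqVneq v 0.
  move: gh; rewrite /centered_gaussian -/v v0 eqxx => X0.
  rewrite (ae_eq_integral (cst 0%E))//; first by rewrite integral0.
  - exact/measurable_EFinP.
  - by move: X0; apply: filterS => w /= -> _.
have gh' := wiener_gaussian hW (- h) s0 st tT'.
have Qlin : bounded_linear Q by case: hQ.
rewrite -(scaleN1r h) (bounded_linearZ Qlin) L2_dotZl L2_dotZr mulN1r mulN1r opprK scaleN1r in gh'.
have e1 := gaussian_integral v0 (mX h) gh (f := EFin) (@EFin_measurable _ _) (iX h).
have e2 := gaussian_integral v0 (mX (- h)) gh' (f := EFin) (@EFin_measurable _ _) (iX (- h)).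
have e3 : (\int[P]_w (increment W s t (- h) w)%:E = (-1)%:E * \int[P]_w (increment W s t h w)%:E)%E.
  rewrite -integralZl//; last exact: iX.
  apply: ae_eq_integral => //; first exact/measurable_EFinP.
    by apply: measurable_funeM; exact/measurable_EFinP.
  (* [- h] is written as -2 h + h, the form in which linearity is available. *)
  apply: filterS (increment_linear (- (1 + 1)) h h s0 st tT') => w.
  rewrite scaleNr scalerDl scale1r opprD subrK => -> _ /=.
  by rewrite -EFinM; congr EFin; ring.
have Xf : (\int[P]_w (increment W s t h w)%:E)%E \is a fin_num by apply: integrable_fin_num (iX h).
move: e3; rewrite e2 -e1 -(fineK Xf) -EFinM => -[h0]; congr EFin.
by move: h0; lra.
Qed.

Lemma Lfun2_mul_integrable (X Y : Om -> R) : X \in Lfun P 2%:E -> Y \in Lfun P 2%:E ->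
  P.-integrable setT (EFin \o (fun w => X w * Y w)).
Proof. by move=> X2 Y2; apply/Lfun1_integrable; exact: Lfun2_mul_Lfun1. Qed.

Lemma Lfun2_measurable (X : Om -> R) : X \in Lfun P 2%:E -> measurable_fun setT X.
Proof. by rewrite inE => /andP[]; rewrite inE. Qed.

Lemma wiener_Lfun2 t h : 0 <= t <= tT -> W t h \in Lfun P 2%:E.
Proof.
move=> /andP[t0 tT']; apply: sqr_integrable_Lfun2.
  by apply: wiener_measurable; rewrite t0.
rewrite (_ : integral _ _ _ = \int[P]_w (increment W 0 t h w ^+ 2)%:E)%E.
  by rewrite increment_sqr// ltry.
apply: ae_eq_integral => //.
- by apply/measurable_EFinP; apply: measurable_funX; apply: wiener_measurable; rewrite t0.
- by apply/measurable_EFinP; apply: measurable_funX; apply: increment_measurable.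
- by apply: filterS (wiener0 hW h) => w w0 _; rewrite /increment w0 subr0.
Qed.

(** Polarization of [increment_sqr] at h, g and h + g. *)
Lemma wiener_covariance_same t h g : 0 <= t <= tT ->
  (\int[P]_w (W t h w * W t g w))%R = m2 * (t * L2_dot (Q h) g).
Proof.
move=> /andP[t0 tT'].
have iL k := increment_Lfun2 k (lexx 0) t0 tT'.
have im k := increment_measurable k (lexx 0) t0 tT'.
have sq k : (\int[P]_w (increment W 0 t k w ^+ 2))%R = m2 * (t * L2_dot (Q k) k).
  by rewrite /Rintegral increment_sqr//= subr0.
have iM k l : P.-integrable setT (EFin \o (fun w => increment W 0 t k w * increment W 0 t l w)).
  exact: Lfun2_mul_integrable.
transitivity (\int[P]_w (increment W 0 t h w * increment W 0 t g w))%R.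
  apply: ae_eq_Rintegral.
  - by apply: measurable_funM; apply: wiener_measurable; rewrite t0.
  - exact: measurable_funM.
  - by apply: filterS2 (wiener0 hW h) (wiener0 hW g) => w h1 h2 _; rewrite /increment h1 h2 !subr0.
have [Qlin Qsym _] := hQ.
have : (\int[P]_w (increment W 0 t (h + g) w ^+ 2))%R =
    (\int[P]_w (increment W 0 t h w ^+ 2))%R +
    (2 * (\int[P]_w (increment W 0 t h w * increment W 0 t g w))%R +
    (\int[P]_w (increment W 0 t g w ^+ 2))%R).
  have i2 k : P.-integrable setT (EFin \o (fun w => increment W 0 t k w ^+ 2)) by exact: iM.
  have i3 : P.-integrable setT (EFin \o (fun w => 2 * (increment W 0 t h w * increment W 0 t g w))).
    exact: integrableZl_EFin.
  rewrite -RintegralZl// -RintegralD// -RintegralD//; last exact: integrableD_EFin.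
  apply: ae_eq_Rintegral.
  - exact: measurable_funX.
  - apply: measurable_funD; first exact: measurable_funX.
    apply: measurable_funD; last exact: measurable_funX.
    by apply: measurable_funM => //; exact: measurable_funM.
  - apply: filterS (increment_linear 1 h g (lexx 0) t0 tT') => w; rewrite scale1r => -> _.
    by ring.
rewrite !sq (bounded_linearD Qlin) !(L2_dotDl, L2_dotDr).
have -> : L2_dot (Q g) h = L2_dot (Q h) g by rewrite Qsym L2_dotC.
set I := (\int[P]_w _)%R; lra.
Qed.

Lemma wiener_covariance_increment s t h g : 0 <= s -> s <= t -> t <= tT ->
  (\int[P]_w (W s h w * increment W s t g w))%R = 0.
Proof.
move=> s0 st tT'; have sin : 0 <= s <= tT by rewrite s0 (le_trans st).
rewrite /Rintegral (indep_expectation0 (X := W s h))//.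
- exact: wiener_measurable.
- exact: increment_measurable.
- move=> A B mA mB; apply: (wiener_indep hW s0 st tT').
    by apply: (wiener_adapted hW) => //; rewrite in_itv.
  by apply: sub_sigma_algebra; exists g, B.
- by apply: Lfun2_mul_integrable; [exact: wiener_Lfun2|exact: increment_Lfun2].
- by apply/Lfun1_integrable/Lfun2_Lfun1/increment_Lfun2.
- exact: increment_mean0.
Qed.

Lemma wiener_covariance s t h g : 0 <= s <= tT -> 0 <= t <= tT ->
  (\int[P]_w (W s h w * W t g w))%R = m2 * (Num.min s t * L2_dot (Q h) g).
Proof.
wlog st : s t h g / s <= t.
  move=> hw sin tin; have [st|/ltW ts] := leP s t; first by rewrite hw// min_l.
  under eq_Rintegral do rewrite mulrC.
  rewrite hw// min_l//; have [_ Qsym _] := hQ; by rewrite Qsym L2_dotC.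
move=> sin tin; rewrite min_l//.
have /andP[s0 sT] := sin; have /andP[t0 tT'] := tin.
rewrite -wiener_covariance_same//.
rewrite -[RHS]addr0 -(wiener_covariance_increment h g s0 st tT') -RintegralD//; first last.
- by apply: Lfun2_mul_integrable; [exact: wiener_Lfun2|exact: increment_Lfun2].
- by apply: Lfun2_mul_integrable; exact: wiener_Lfun2.
by apply: eq_Rintegral => w _; rewrite /increment; ring.
Qed.

End wiener.

(** * The Ito isometry for step functions *)

Section elementary.
Context d (T : measurableType d) (R : realType) (mu : {measure set T -> \bar R}).
Local Notation H := (L2 mu).
Context d' (Om : measurableType d') (P : probability Om R).
Variables (tT : R) (F : R -> set (set Om)) (Q Qh : H -> H) (W : R -> H -> Om -> R).
Hypotheses (hF : normal_filtration P tT F) (hQ : nonneg_self_adjoint Q)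
  (hQh : operator_sqrt Q Qh) (hW : Q_wiener P tT F Q W).
Implicit Types (s t : R) (h : H) (X : Om -> R) (g : R -> H).
Local Notation leb := (@lebesgue_measure R).
Let m2 : R := fine (gaussian_moment2 R).

(* [elementary X g]: X is the Wiener integral of the step function g, whose
   values are already multiplied by the square root of the covariance. *)
Inductive elementary : (Om -> R) -> (R -> H) -> Prop :=
| elementary0 : elementary (fun=> 0) (fun=> 0)
| elementary_cons c t h X g : 0 <= t <= tT -> elementary X g ->
    elementary (fun w => c * W t h w + X w)
               (fun r => (c * \1_(`]0, t]) r) *: Qh h + g r).

Lemma elementaryD X g Y k : elementary X g -> elementary Y k ->
  elementary (fun w => X w + Y w) (fun r => g r + k r).
Proof.
move=> Xg Yk; elim: Xg => [|c t h X' g' tin _ IH].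
  rewrite (_ : (fun w => _) = Y); last by apply/funext => w; rewrite add0r.
  by rewrite (_ : (fun r => _) = k)//; apply/funext => w; rewrite add0r.
have := elementary_cons c h tin IH; congr elementary; apply/funext => w; exact: addrA.
Qed.

Lemma elementaryZ a X g : elementary X g ->
  elementary (fun w => a * X w) (fun r => a *: g r).
Proof.
elim=> [|c t h X' g' tin _ IH].
  rewrite (_ : (fun w => _) = fun=> 0); last by apply/funext => w; rewrite mulr0.
  rewrite (_ : (fun r => _) = fun=> 0); last by apply/funext => w; rewrite scaler0.
  exact: elementary0.
have := elementary_cons (a * c) h tin IH; congr elementary; apply/funext => w.
  by rewrite mulrDr mulrA.
by rewrite scalerDr scalerA mulrA.
Qed.

Lemma elementary_increment c s t h : 0 <= s -> s <= t -> t <= tT ->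
  elementary (fun w => c * increment W s t h w) (fun r => (c * \1_(`]s, t]) r) *: Qh h).
Proof.
move=> s0 st tT'; have tin : 0 <= t <= tT by rewrite (le_trans s0 st).
have sin : 0 <= s <= tT by rewrite s0 (le_trans st).
have := elementary_cons c h tin (elementary_cons (- c) h sin elementary0).
congr elementary; apply/funext => w.
  by rewrite /increment addr0 mulNr -mulrBr.
rewrite addr0 -scalerDl mulNr -mulrBr; congr (_ * _ *: _).
rewrite !indicE !mem_setE !in_itv/=.
have [ws|sw] := leP w s; first by rewrite (le_trans ws st) andbT subrr.
by rewrite (le_lt_trans s0 sw)/= subr0.
Qed.

Lemma elementary_sum n (X : nat -> Om -> R) (g : nat -> R -> H) :
  (forall i, (i < n)%N -> elementary (X i) (g i)) ->
  elementary (fun w => \sum_(i < n) X i w) (fun r => \sum_(i < n) g i r).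
Proof.
elim: n => [|n IH] Xg.
  rewrite (_ : (fun w => _) = fun=> 0); last by apply/funext => w; rewrite big_ord0.
  rewrite (_ : (fun r => _) = fun=> 0); last by apply/funext => w; rewrite big_ord0.
  exact: elementary0.
have := elementaryD (IH (fun i ni => Xg i (ltnW ni))) (Xg n (leqnn _)).
by congr elementary; apply/funext => w; rewrite big_ord_recr.
Qed.

Lemma itv_indicM s t r : (\1_(`]0, s]) r : R) * \1_(`]0, t]) r = \1_(`]0, Num.min s t]) r.
Proof.
rewrite !indicE !mem_setE !in_itv/= le_min.
by case: (0 < r) => /=; rewrite ?mul0r//; case: (r <= s); case: (r <= t); rewrite ?mul0r ?mulr0 ?mulr1.
Qed.

Lemma integrable_itv_indic t : leb.-integrable setT (EFin \o (\1_(`]0, t]) : R -> R)).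
Proof. exact: integrable_indic_itv. Qed.

Lemma Rintegral_itv_indic t : 0 <= t -> (\int[leb]_r (\1_(`]0, t]) r))%R = t.
Proof.
move=> t0; rewrite /Rintegral integral_indic//= ?setIT.
rewrite lebesgue_measure_itv/= lte_fin; case: ltP => [_|t0'].
  by rewrite oppr0 adde0.
by apply/le_anti; rewrite t0 t0'.
Qed.

(** The isometry alone is not inductive: squaring a sum requires the covariance of the remaining
    integral with an arbitrary [W t h], hence the extra clause. The factor [Num.min s t] of the
    covariance is the integral of the product of the indicators of ]0, s] and ]0, t], which is why
    overlapping intervals cause no trouble. *)
Lemma elementary_isometry_aux X g : elementary X g ->
  [/\ X \in Lfun P 2%:E,
      forall v, measurable_fun setT (fun r => L2_dot (g r) v),
      forall t v, leb.-integrable setT (EFin \o (fun r => \1_(`]0, t]) r * L2_dot (g r) v)),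
      leb.-integrable setT (EFin \o (fun r => `|g r| ^+ 2)) &
      (forall t h, 0 <= t <= tT -> (\int[P]_w (W t h w * X w))%R =
         m2 * (\int[leb]_r (\1_(`]0%R, t]) r * L2_dot (g r) (Qh h)))%R) /\
      (\int[P]_w (X w ^+ 2))%R = m2 * (\int[leb]_r (`|g r| ^+ 2))%R].
Proof.
have [[_ Qhs _] QhQ] := hQh.
elim=> [|c t h X' g' tin _ [X2 mg ig ig2 [WX XX]]].
  have i0 : leb.-integrable setT (EFin \o (fun _ : R => 0 : R)) by exact: integrable0.
  split.
  - apply: sqr_integrable_Lfun2 => //.
    by under eq_integral do rewrite expr0n/=; rewrite integral0.
  - by move=> v; exact: measurable_cst.
  - by move=> t v; under eq_fun do rewrite L2_dot0l mulr0.
  - by under eq_fun do rewrite normr0 expr0n/=.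
  - split=> [t h tin|].
      under eq_Rintegral do rewrite mulr0.
      under [in RHS]eq_Rintegral do rewrite L2_dot0l mulr0.
      by rewrite /Rintegral !integral0 mulr0.
    under eq_Rintegral do rewrite expr0n/=.
    under [in RHS]eq_Rintegral do rewrite normr0 expr0n/=.
    by rewrite /Rintegral !integral0 mulr0.
have W2 k : W t k \in Lfun P 2%:E by exact: (wiener_Lfun2 hF hQ hW).
set q := Qh h.
have iq t' v : leb.-integrable setT (EFin \o (fun r => (c * L2_dot q v) * \1_(`]0, Num.min t' t]) r)).
  by apply: integrableZl_EFin; exact: integrable_itv_indic.
have dE t' v : (fun r => \1_(`]0, t']) r * L2_dot ((c * \1_(`]0, t]) r) *: q + g' r) v) =
    (fun r => (c * L2_dot q v) * \1_(`]0, Num.min t' t]) r + \1_(`]0, t']) r * L2_dot (g' r) v).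
  by apply/funext => r; rewrite L2_dotDl L2_dotZl -itv_indicM; ring.
have nE : (fun r => `|(c * \1_(`]0, t]) r) *: q + g' r| ^+ 2) =
    (fun r => (c ^+ 2 * `|q| ^+ 2) * \1_(`]0, t]) r +
       ((2 * c) * (\1_(`]0, t]) r * L2_dot (g' r) q) + `|g' r| ^+ 2)).
  apply/funext => r; rewrite L2_normD_sqr L2_dotZl (L2_dotC q) normrZ exprMn real_normK ?num_real//.
  have : (\1_(`]0, t]) r : R) ^+ 2 = \1_(`]0, t]) r.
    by rewrite expr2 itv_indicM minxx.
  by rewrite -mulr_natl exprMn => ->; ring.
have iq2 : leb.-integrable setT (EFin \o (fun r => (c ^+ 2 * `|q| ^+ 2) * \1_(`]0, t]) r)).
  by apply: integrableZl_EFin; exact: integrable_itv_indic.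
have ic : leb.-integrable setT (EFin \o (fun r => (2 * c) * (\1_(`]0, t]) r * L2_dot (g' r) q))).
  by apply: integrableZl_EFin; exact: ig.
have iWX k s : 0 <= s <= tT -> P.-integrable setT (EFin \o (fun w => W s k w * X' w)).
  by move=> sin; apply: Lfun2_mul_integrable => //; exact: (wiener_Lfun2 hF hQ hW).
have iWW s k : 0 <= s <= tT -> P.-integrable setT (EFin \o (fun w => W s k w * W t h w)).
  by move=> sin; apply: Lfun2_mul_integrable => //; exact: (wiener_Lfun2 hF hQ hW).
have X1m := Lfun2_measurable X2.
have Wm k : measurable_fun setT (W t k) by exact: (wiener_measurable hF hW).
have iX2 : P.-integrable setT (EFin \o (fun w => X' w ^+ 2)) by exact: Lfun2_mul_integrable.
have XE : (fun w => (c * W t h w + X' w) ^+ 2) = (fun w => c ^+ 2 * (W t h w * W t h w) +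
    ((2 * c) * (W t h w * X' w) + X' w ^+ 2)).
  by apply/funext => w; ring.
have iXE : P.-integrable setT (EFin \o (fun w => (c * W t h w + X' w) ^+ 2)).
  rewrite XE; apply: integrableD_EFin; first by apply: integrableZl_EFin; exact: iWW.
  by apply: integrableD_EFin => //; apply: integrableZl_EFin; exact: iWX.
split.
- apply: sqr_integrable_Lfun2; first by apply: measurable_funD => //; exact: measurable_funM.
  case/integrableP: iXE => _; apply: le_lt_trans; apply: ge0_le_integral_nonmeas => w _.
    by rewrite lee_fin sqr_ge0.
  by rewrite /= lee_fin ler_norm.
- move=> v; under eq_fun do rewrite L2_dotDl L2_dotZl.
  by apply: measurable_funD => //; apply: measurable_funM => //; apply: measurable_funM.
- by move=> t' v; rewrite dE; apply: integrableD_EFin.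
- by rewrite nE; apply: integrableD_EFin => //; apply: integrableD_EFin.
- split=> [t' h' t'in|].
    rewrite dE RintegralD// RintegralZl//; last exact: integrable_itv_indic.
    rewrite mulrDr -WX//.
    have -> : (fun w => W t' h' w * (c * W t h w + X' w)) =
        (fun w => c * (W t' h' w * W t h w) + W t' h' w * X' w).
      by apply/funext => w; ring.
    rewrite RintegralD//; [|by apply: integrableZl_EFin; exact: iWW|exact: iWX].
    rewrite RintegralZl//; last exact: iWW.
    rewrite (wiener_covariance hF hQ hW)// Rintegral_itv_indic; last first.
      by rewrite le_min; case/andP: tin => -> _; case/andP: t'in => ->.
    by rewrite /q Qhs QhQ -/m2 (L2_dotC h); ring.
  rewrite XE nE RintegralD//; [|by apply: integrableZl_EFin; exact: iWW|].
    rewrite RintegralD//; [|by apply: integrableZl_EFin; exact: iWX].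
    rewrite !RintegralZl//; [|exact: iWX|exact: iWW].
    rewrite (RintegralD _ iq2)//; last exact: integrableD_EFin.
    rewrite (RintegralD _ ic)// !RintegralZl//; last exact: integrable_itv_indic.
    rewrite XX WX// (wiener_covariance hF hQ hW)// minxx -/m2 Rintegral_itv_indic; last by case/andP: tin.
    by rewrite -L2_dotvv /q [L2_dot (Qh h) (Qh h)]Qhs QhQ (L2_dotC h); ring.
  by apply: integrableD_EFin => //; apply: integrableZl_EFin; exact: iWX.
Qed.

End elementary.

Lemma ge0_integral_sqrD_le d (T : measurableType d) (R : realType)
    (mu : {measure set T -> \bar R}) (f g h : T -> \bar R) :
  measurable_fun setT g -> measurable_fun setT h ->
  (forall x, 0 <= f x)%E -> (forall x, 0 <= g x)%E -> (forall x, 0 <= h x)%E ->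
  (forall x, f x <= 2%:E * g x + 2%:E * h x)%E ->
  (\int[mu]_x f x <= 2%:E * (\int[mu]_x g x) + 2%:E * (\int[mu]_x h x))%E.
Proof.
move=> mg mh f0 g0 h0 fgh.
rewrite -!ge0_integralZl// -ge0_integralD//.
- by apply: ge0_le_integral_nonmeas.
- by move=> x _; rewrite mule_ge0.
- exact: measurable_funeM.
- by move=> x _; rewrite mule_ge0.
- exact: measurable_funeM.
Qed.

Lemma cvge2_0 (R : realType) (a b : nat -> \bar R) :
  a n @[n --> \oo] --> 0%E -> b n @[n --> \oo] --> 0%E ->
  (2%:E * a n + 2%:E * b n)%E @[n --> \oo] --> 0%E.
Proof.
move=> a0 b0; have -> : (0 = 2%:E * 0 + 2%:E * 0 :> \bar R)%E by rewrite !mule0 adde0.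
by apply: cvgeD => //; try exact: cvgeZl; rewrite ?mule0.
Qed.

Section wiener_integral.
Context d (T : measurableType d) (R : realType) (mu : {measure set T -> \bar R}).
Local Notation H := (L2 mu).
Context d' (Om : measurableType d') (P : probability Om R).
Variables (tT : R) (F : R -> set (set Om)) (Q Qh : H -> H) (W : R -> H -> Om -> R).
Hypotheses (hF : normal_filtration P tT F) (hQ : nonneg_self_adjoint Q)
  (hQh : operator_sqrt Q Qh) (hW : Q_wiener P tT F Q W).
Variable e : nat -> H.
Hypothesis eb : orthonormal_basis e.
Implicit Types (s t : R) (h : H) (X Y : Om -> R) (g k : R -> H).
Local Notation leb := (@lebesgue_measure R).
Let m2 : R := fine (gaussian_moment2 R).
Let m20 : 0 <= m2. Proof. exact: gaussian_moment2_fine_ge0. Qed.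

(** Scalar measurability is enough: by Parseval the squared norm is a countable sum of squares of
    coordinates, hence measurable too. *)
Definition weakly_measurable g := forall v, measurable_fun setT (fun r => L2_dot (g r) v).

Lemma weakly_measurableB g k : weakly_measurable g -> weakly_measurable k ->
  weakly_measurable (fun r => g r - k r).
Proof. by move=> mg mk v; under eq_fun do rewrite L2_dotBl; exact: measurable_funB. Qed.

Lemma weakly_measurable_norm g : weakly_measurable g ->
  measurable_fun setT (fun r => (`|g r| ^+ 2)%:E).
Proof.
move=> mg; under eq_fun do rewrite -(parseval eb).
apply: ge0_emeasurable_sum => [n r _ _|n _]; first by rewrite lee_fin sqr_ge0.
exact/measurable_EFinP/measurable_funX.
Qed.

Lemma L2_sqr_normD_le (u v : H) : `|u + v| ^+ 2 <= 2 * `|u| ^+ 2 + 2 * `|v| ^+ 2.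
Proof.
apply: le_trans (_ : (`|u| + `|v|) ^+ 2 <= _).
  by rewrite lerXn2r ?nnegrE ?addr_ge0// ler_normD.
have := sqr_ge0 (`|u| - `|v|); set a := `|u|; set b := `|v|; nra.
Qed.

Lemma elementary_facts X g : elementary tT Qh W X g ->
  [/\ measurable_fun setT X, weakly_measurable g &
     (\int[P]_w (X w ^+ 2)%:E = m2%:E * \int[leb]_r (`|g r| ^+ 2)%:E)%E].
Proof.
move=> /(elementary_isometry_aux hF hQ hQh hW)[X2 mg _ ig [_ XX]]; split => //.
  exact: Lfun2_measurable X2.
have iX : P.-integrable setT (EFin \o (fun w => X w ^+ 2)) by exact: Lfun2_mul_integrable.
have := XX; rewrite /Rintegral => XX'.
have f1 : (\int[P]_w (X w ^+ 2)%:E)%E \is a fin_num by apply: integrable_fin_num iX.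
have f2 : (\int[leb]_r (`|g r| ^+ 2)%:E)%E \is a fin_num by apply: integrable_fin_num ig.
by rewrite -(fineK f1) -(fineK f2) -EFinM; congr EFin.
Qed.

(** The closure of the elementary pairs, in both mean squares at once. It is a relation: solution
    and scheme supply the random variables, and what has to be shown is which integrand belongs to
    them. *)
Definition wiener_integral X g :=
  [/\ measurable_fun setT X, weakly_measurable g &
   exists (Xm : nat -> Om -> R) (gm : nat -> R -> H),
    [/\ forall m, elementary tT Qh W (Xm m) (gm m),
      (\int[P]_w ((Xm m w - X w) ^+ 2)%:E)%E @[m --> \oo] --> 0%E &
      (\int[leb]_r (`|gm m r - g r| ^+ 2)%:E)%E @[m --> \oo] --> 0%E]].

Lemma elementary_wiener_integral X Y g : elementary tT Qh W X g ->
  measurable_fun setT Y -> Y = X %[ae P] -> wiener_integral Y g.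
Proof.
move=> Xg mY YX; have [mX mg _] := elementary_facts Xg; split => //.
exists (fun=> X), (fun=> g); split => //.
  rewrite (_ : (fun _ => _) = cst 0%E); first exact: cvg_cst.
  apply/funext => n; rewrite (ae_eq_integral (cst 0%E))//; first by rewrite integral0.
    by apply/measurable_EFinP/measurable_funX/measurable_funB.
  by apply: filterS YX => w /= h Tw; rewrite h// subrr expr0n.
rewrite (_ : (fun _ => _) = cst 0%E); first exact: cvg_cst.
apply/funext => n; rewrite integral0_eq// => r _.
by rewrite subrr normr0 expr0n.
Qed.

Lemma wiener_integralB X g Y k : wiener_integral X g -> wiener_integral Y k ->
  wiener_integral (fun w => X w - Y w) (fun r => g r - k r).
Proof.
move=> [mX mg [Xm [gm [Xg X0 g0]]]] [mY mk [Ym [km [Yk Y0 k0]]]]; split.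
- exact: measurable_funB.
- exact: weakly_measurableB.
exists (fun m w => Xm m w - Ym m w), (fun m r => gm m r - km m r); split.
- move=> m; have := elementaryD (Xg m) (elementaryZ (-1) (Yk m)).
  by congr elementary; apply/funext => ?; rewrite ?mulN1r ?scaleN1r.
- apply: squeeze_cvge (cvge2_0 X0 Y0); last exact: cvg_cst.
  apply: nearW => m; rewrite integral_ge0 => [|w _]; last by rewrite lee_fin sqr_ge0.
  have [mXm _ _] := elementary_facts (Xg m); have [mYm _ _] := elementary_facts (Yk m).
  apply: ge0_integral_sqrD_le => [||w|w|w|w]; rewrite ?lee_fin ?sqr_ge0//.
  + by apply/measurable_EFinP/measurable_funX/measurable_funB.
  + by apply/measurable_EFinP/measurable_funX/measurable_funB.
  + have := sqr_ge0 (Xm m w - X w + (Ym m w - Y w)).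
    by set a := Xm m w; set b := X w; set c := Ym m w; set f := Y w; nra.
- apply: squeeze_cvge (cvge2_0 g0 k0); last exact: cvg_cst.
  apply: nearW => m; rewrite integral_ge0 => [|w _]; last by rewrite lee_fin sqr_ge0.
  have [_ mgm _] := elementary_facts (Xg m); have [_ mkm _] := elementary_facts (Yk m).
  apply: ge0_integral_sqrD_le => [||w|w|w|w]; rewrite ?lee_fin ?sqr_ge0//.
  + by apply: weakly_measurable_norm; exact: weakly_measurableB.
  + by apply: weakly_measurable_norm; exact: weakly_measurableB.
  + rewrite -(normrN (km m w - k w)).
    apply: le_trans (L2_sqr_normD_le _ _); rewrite !opprB addrACA [X in _ <= `|X| ^+ 2]addrACA.
    by rewrite [- km m w - _]addrC.
Qed.

(** The inequality (a + b)^2 <= 2 a^2 + 2 b^2 is used twice, to pass from [X] to an elementary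
    integral and from its integrand back to [g]. This gives the factor 4; the approximation errors
    vanish in the limit. *)
Lemma wiener_integral_sqr_le X g (B : R) : wiener_integral X g ->
  (\int[leb]_r (`|g r| ^+ 2)%:E <= B%:E)%E ->
  (\int[P]_w (X w ^+ 2)%:E <= (4 * m2 * B)%:E)%E.
Proof.
move=> [mX mg [Xm [gm [Xg X0 g0]]]] gB.
pose a m := (\int[P]_w ((Xm m w - X w) ^+ 2)%:E)%E.
pose b m := (\int[leb]_r (`|gm m r - g r| ^+ 2)%:E)%E.
have le m : (\int[P]_w (X w ^+ 2)%:E <= 2%:E * a m + ((4 * m2)%:E * b m + (4 * m2 * B)%:E))%E.
  have [mXm mgm Xmg] := elementary_facts (Xg m).
  apply: le_trans (_ : _ <= 2%:E * a m + 2%:E * \int[P]_w (Xm m w ^+ 2)%:E)%E _.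
    apply: ge0_integral_sqrD_le => [||w|w|w|w]; rewrite ?lee_fin ?sqr_ge0//.
    + by apply/measurable_EFinP/measurable_funX/measurable_funB.
    + by apply/measurable_EFinP/measurable_funX.
    + have := sqr_ge0 (Xm m w - X w + Xm m w).
      by set c := Xm m w; set f := X w; nra.
  rewrite leeD2l// Xmg.
  apply: le_trans (_ : _ <= 2%:E * (m2%:E * (2%:E * b m + 2%:E * B%:E)))%E _.
    rewrite lee_wpmul2l// lee_wpmul2l ?lee_fin//.
    apply: le_trans (_ : _ <= 2%:E * b m + 2%:E * \int[leb]_r (`|g r| ^+ 2)%:E)%E _; last first.
      by rewrite leeD2l// lee_wpmul2l.
    apply: ge0_integral_sqrD_le => [||w|w|w|w]; rewrite ?lee_fin ?sqr_ge0//.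
    + by apply: weakly_measurable_norm; exact: weakly_measurableB.
    + exact: weakly_measurable_norm.
    + by rewrite -{1}(subrK (g w) (gm m w)); exact: L2_sqr_normD_le.
  rewrite muleA -EFinM -(EFinM 2 B) muleDr ?fin_num_adde_defl//.
  rewrite muleA -!EFinM leeD ?lee_fin//.
    by rewrite (_ : 2 * m2 * 2 = 4 * m2)//; ring.
  by rewrite (_ : 2 * m2 * (2 * B) = 4 * m2 * B)//; ring.
have lim : (2%:E * a m + ((4 * m2)%:E * b m + (4 * m2 * B)%:E))%E @[m --> \oo] --> (4 * m2 * B)%:E.
  have l1 : (2%:E * a m)%E @[m --> \oo] --> 0%E by rewrite -(mule0 2%:E); exact: cvgeZl.
  have l2 : ((4 * m2)%:E * b m)%E @[m --> \oo] --> 0%E.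
    by rewrite -(mule0 (4 * m2)%:E); exact: cvgeZl.
  rewrite [X in _ --> X](_ : _ = (0 + (0 + (4 * m2 * B)%:E))%E); last by rewrite !add0e.
  apply: cvgeD; [by rewrite add0e|exact: l1|].
  by apply: cvgeD => //; exact: cvg_cst.
rewrite -(cvg_lim _ lim)//; apply: lime_ge; first by apply/cvg_ex; eexists; exact: lim.
exact: nearW.
Qed.

End wiener_integral.

(** * Coordinates of stochastic and Bochner integrals *)

Section measurability.
Context d (T : measurableType d) (R : realType) (mu : {measure set T -> \bar R}).
Local Notation H := (L2 mu).
Context d' (Om : measurableType d').

Lemma measurable_fun_open (D : set Om) (f : Om -> R) : measurable D ->
  (forall U : set R, open U -> measurable (D `&` f @^-1` U)) -> measurable_fun D f.
Proof.
move=> mD fU; apply: (measurability _ (RGenOpens.measurableE R)) => _ [_ [a [b ->]] <-].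
by apply: fU; exact: interval_open.
Qed.

Lemma measurable_wrt_comp (X : Om -> H) (phi : H -> R) : measurable_wrt measurable X ->
  continuous phi -> measurable_fun setT (fun w => phi (X w)).
Proof.
move=> mX cphi; apply: measurable_fun_open => // U oU; rewrite setTI.
apply: (mX (phi @^-1` U)).
by move/continuousP: cphi; apply.
Qed.

Lemma measurable_wrt_dot (X : Om -> H) v : measurable_wrt measurable X ->
  measurable_fun setT (fun w => L2_dot (X w) v).
Proof. by move=> mX; exact: (measurable_wrt_comp mX (@L2_dot_cont _ _ _ _ v)). Qed.

End measurability.

Section ito.
Context d (T : measurableType d) (R : realType) (mu : {measure set T -> \bar R}).
Local Notation H := (L2 mu).
Context d' (Om : measurableType d') (P : probability Om R).
Variables (tT : R) (F : R -> set (set Om)) (Q Qh : H -> H) (W : R -> H -> Om -> R).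
Hypotheses (hF : normal_filtration P tT F) (hQ : nonneg_self_adjoint Q)
  (hQh : operator_sqrt Q Qh) (hW : Q_wiener P tT F Q W).
Variables (e : nat -> H) (lam : nat -> R) (S : R -> H -> H).
Hypothesis eb : orthonormal_basis e.
Hypothesis Se : forall t : R, 0 <= t -> forall v k,
  L2_dot (S t v) (e k) = expR (- (lam k * t)) * L2_dot v (e k).
Local Notation leb := (@lebesgue_measure R).

Lemma onb_norm1 k : `|e k| = 1.
Proof.
apply/eqP; rewrite -(@eqrXn2 _ 2)// ?expr1n//; apply/eqP.
by rewrite -L2_dotvv eb.1 eqxx.
Qed.

Lemma onb_coord_le v k : L2_dot v (e k) ^+ 2 <= `|v| ^+ 2.
Proof.
have := L2_cauchy_schwarz v (e k); rewrite onb_norm1 mulr1 => h.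
by rewrite -real_normK ?num_real// lerXn2r ?nnegrE.
Qed.

Lemma step_time_bounds t phi : step_on e Qh t phi ->
  forall i, (i <= step_size phi)%N -> 0 <= step_time phi i <= t.
Proof.
move=> [t0 tn tS].
have mono i j : (i <= j)%N -> (j <= step_size phi)%N -> step_time phi i <= step_time phi j.
  elim: j => [|j IH]; first by rewrite leqn0 => /eqP->.
  rewrite leq_eqVlt => /predU1P[->//|ij] jn.
  by apply: le_trans (IH ij (ltnW jn)) _; case: (tS j jn).
by move=> i ni; rewrite -{1}t0 -tn !mono.
Qed.

(** Pairing a step integral with e_k moves the step operators to their adjoints and leaves a real
    Wiener integral. The limit integrand is a multiple of [Qh (e k)] because the semigroup is
    diagonal. *)
Lemma ito_coord t Z k : 0 <= t <= tT ->
  ito_integral P e Qh W t (fun s => S (t - s)) Z ->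
  wiener_integral P tT Qh W (fun w => L2_dot (Z w) (e k))
    (fun r => ou_kernel (lam k) t r *: Qh (e k)).
Proof.
move=> /andP[t0 tT'] [mZ [phi [I [phi_on phiI hs0 IZ]]]].
have [[_ Qhs _] _] := hQh.
pose X m (Bs : nat -> H -> H) w := \sum_(i < step_size (phi m))
  1 * increment W (step_time (phi m) i) (step_time (phi m) i.+1) (Bs i (e k)) w.
pose g m (Bs : nat -> H -> H) r := \sum_(i < step_size (phi m))
  (1 * \1_(`](step_time (phi m) i), (step_time (phi m) i.+1)]) r) *: Qh (Bs i (e k)).
have /choice[Bs BsP] m : exists Bs : nat -> H -> H,
   (forall i, (i < step_size (phi m))%N ->
      (forall u v, L2_dot (step_val (phi m) i u) v = L2_dot u (Bs i v))) /\
   {ae P, forall w, X m Bs w = L2_dot (I m w) (e k)}.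
  have [Y [YB IE]] := phiI m.
  have /choice[Bs BsP] : forall i, exists B : H -> H, (i < step_size (phi m))%N ->
      (forall u v, L2_dot (step_val (phi m) i u) v = L2_dot u (B v)) /\
      {ae P, forall w, L2_dot (Y i w) (e k) =
         increment W (step_time (phi m) i) (step_time (phi m) i.+1) (B (e k)) w}.
    move=> i; have [ni|_] := ltnP i (step_size (phi m)); last by exists id.
    by have [_ [B [_ BB] YE]] := YB i ni; exists B => _; split => //; exact: YE.
  exists Bs; split; first by move=> i /BsP[].
  have : {ae P, forall w, forall i, (i < step_size (phi m))%N -> L2_dot (Y i w) (e k) =
         increment W (step_time (phi m) i) (step_time (phi m) i.+1) (Bs i (e k)) w}.
    apply: ae_foralln => i; have [ni|_] := ltnP i (step_size (phi m)).
      by apply: filterS (BsP i ni).2.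
    exact: nearW.
  apply: filterS => w h; rewrite IE L2_dot_suml; apply: eq_bigr => i _.
  by rewrite mul1r h.
have tb m := step_time_bounds (phi_on m).
have elemX m : elementary tT Qh W (X m (Bs m)) (g m (Bs m)).
  apply: (elementary_sum (n := step_size (phi m))
    (X := fun i w => 1 * increment W (step_time (phi m) i) (step_time (phi m) i.+1) (Bs m i (e k)) w)
    (g := fun i r => (1 * \1_(`](step_time (phi m) i), (step_time (phi m) i.+1)]) r) *: Qh (Bs m i (e k)))).
  move=> i ni; have /andP[h1 h2] := tb m i (ltnW ni).
  have /andP[h3 h4] := tb m i.+1 ni; have [_ _ /(_ i ni)[h5 _ _]] := phi_on m.
  by apply: elementary_increment => //; exact: le_trans tT'.
have mZk := measurable_wrt_dot (e k) mZ.
have mK : weakly_measurable (fun r => ou_kernel (lam k) t r *: Qh (e k)).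
  move=> v; under eq_fun do rewrite L2_dotZl.
  by apply: measurable_funM => //; exact: measurable_ou_kernel.
split => //; exists (fun m => X m (Bs m)), (fun m => g m (Bs m)); split => //.
- apply: squeeze_cvge IZ; last exact: cvg_cst.
  apply: nearW => m; rewrite integral_ge0 => [/=|w _]; last by rewrite lee_fin sqr_ge0.
  have [mX _ _] := elementary_facts hF hQ hQh hW (elemX m).
  have mXZ : measurable_fun setT (fun w => ((X m (Bs m) w - L2_dot (Z w) (e k)) ^+ 2)%:E).
    by apply/measurable_EFinP/measurable_funX/measurable_funB.
  have [N [mN N0 NP]] := (BsP m).2.
  rewrite (ge0_negligible_integral mN)//; last by move=> w _; rewrite lee_fin sqr_ge0.
  rewrite /mean_sq [leLHS]integral_mkcond.
  apply: ge0_le_integral_nonmeas => w _; rewrite patchE; case: ifPn => //; rewrite ?lee_fin ?sqr_ge0//.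
  rewrite inE => -[_ Nw].
  have -> : X m (Bs m) w = L2_dot (I m w) (e k).
    by apply: contrapT => h; apply: Nw; exact: NP.
  by rewrite -L2_dotBl; exact: onb_coord_le.
- apply: squeeze_cvge hs0; last exact: cvg_cst.
  apply: nearW => m; rewrite integral_ge0 => [/=|w _]; last by rewrite lee_fin sqr_ge0.
  rewrite [leRHS]integral_mkcond; apply: ge0_le_integral_nonmeas => r _; first by rewrite lee_fin sqr_ge0.
  have hs_ge0 : (0 <= hs_norm_sq e (fun v => (S (t - r) (Qh v) - step_at (phi m) r (Qh v))%R))%E.
    by apply: nneseries_ge0 => j _ _; rewrite lee_fin sqr_ge0.
  have [/andP[r0 rt]|rt] := boolP (0 < r <= t); last first.
    have -> : g m (Bs m) r = 0.
      rewrite /g big1// => i _; rewrite indicE mem_setE in_itv/=.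
      have [/andP[h1 h2]|_] := boolP (step_time (phi m) i < r <= step_time (phi m) i.+1); last by rewrite mulr0 scale0r.
      case/negP: rt; have /andP[h3 _] := tb m i (ltnW (ltn_ord i)).
      by have /andP[_ h4] := tb m i.+1 (ltn_ord i); rewrite (le_lt_trans h3 h1) (le_trans h2 h4).
    rewrite /ou_kernel indicE mem_setE in_itv/= (negbTE rt) mul0r scale0r subr0 normr0 expr0n/=.
    by rewrite patchE; case: ifP.
  rewrite patchE mem_set/= ?in_itv/= ?rt ?(ltW r0)// -(parseval eb).
  (* By duality, the j-th coordinate of the integrand error in mode k is, up to sign, the k-th
     coordinate of the operator error at e_j. Summed over j it is bounded by the Hilbert-Schmidt
     norm. *)
  apply: lee_nneseries => j _; first by rewrite lee_fin sqr_ge0.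
  rewrite lee_fin; apply: le_trans (onb_coord_le _ k).
  rewrite le_eqVlt; apply/orP; left; apply/eqP; rewrite -[LHS]sqrrN; congr (_ ^+ 2).
  rewrite !L2_dotBl opprB Se ?subr_ge0// /ou_kernel indicE mem_setE in_itv/= r0 rt mul1r L2_dotZl.
  rewrite (Qhs (e k)) (L2_dotC (e k)); congr (_ - _).
  rewrite /g /step_at !L2_dot_suml [RHS]big_mkcond/=; apply: eq_bigr => i _.
  rewrite indicE mem_setE in_itv/= mul1r L2_dotZl Qhs L2_dotC -((BsP m).1 i (ltn_ord i)).
  by case: ifP; rewrite ?mul1r ?mul0r.
Qed.

End ito.

Section bochner.
Context d (T : measurableType d) (R : realType) (mu : {measure set T -> \bar R}).
Local Notation H := (L2 mu).
Local Notation leb := (@lebesgue_measure R).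

(** Cauchy-Schwarz bounds the scalar approximation error by the norm error in the definition, and
    pairing commutes with integrals of simple functions. Integrability is inherited from one
    approximation at finite distance. *)
Lemma bochner_dot (a b : R) (g : R -> H) (x v : H) : `|v| <= 1 ->
  measurable_fun `[a, b] (fun r => L2_dot (g r) v) ->
  bochner_integral a b g x ->
  leb.-integrable `[a, b] (EFin \o (fun r => L2_dot (g r) v)) /\
  L2_dot x v = (\int[leb]_(r in `[a, b]) L2_dot (g r) v)%R.
Proof.
move=> v1 mg [N [E [c [ED _ g0 xE]]]].
pose s m r : H := \sum_(i < N m) (\1_(E m i) r : R) *: c m i.
have mab : measurable (`[a, b]%classic : set (measurableTypeR R)) by exact: measurable_itv.
have finab : (leb `[a, b] < +oo)%E by rewrite lebesgue_measure_itv/=; case: ifP; rewrite ltry.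
have iE m i : (i < N m)%N -> leb.-integrable `[a, b] (EFin \o (fun r => \1_(E m i) r * L2_dot (c m i) v)).
  move=> ni; have [mE _] := ED m i ni.
  apply: measurable_bounded_integrable => //.
    by apply: measurable_funM => //; apply: measurable_funTS; exact: measurable_indic.
  exists `|L2_dot (c m i) v|; split; first exact: num_real.
  move=> M lM r _; rewrite /= normrM; apply: le_trans (ltW lM).
  by rewrite ler_piMl// indicE; case: (_ \in _); rewrite ?normr1 ?normr0.
have sE m : (fun r => L2_dot (s m r) v) = (fun r => \sum_(i < N m) \1_(E m i) r * L2_dot (c m i) v).
  by apply/funext => r; rewrite /s L2_dot_suml; apply: eq_bigr => i _; rewrite L2_dotZl.
have is_ m : leb.-integrable `[a, b] (EFin \o (fun r => L2_dot (s m r) v)).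
  rewrite sE.
  have := @integrable_sum _ _ _ leb _ mab _ (index_enum 'I_(N m)) xpredT
    (fun i r => (\1_(E m i) r * L2_dot (c m i) v)%:E) (fun i _ => iE m i (ltn_ord i)).
  by apply: eq_integrable => // r _; rewrite /= sumEFin.
have Is m : (\int[leb]_(r in `[a, b]) L2_dot (s m r) v)%R =
    L2_dot (\sum_(i < N m) fine (leb (E m i)) *: c m i) v.
  rewrite sE L2_dot_suml /Rintegral.
  under eq_integral do rewrite -sumEFin.
  rewrite integral_sum//; last by move=> i; exact: iE.
  rewrite -sum_fine; last by move=> i _; apply: integrable_fin_num => //; exact: iE.
  apply: eq_bigr => i _; rewrite L2_dotZl.
  have [mE EDi] := ED m i (ltn_ord i).
  rewrite -/(Rintegral _ _ _) RintegralZr//; last first.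
    apply: measurable_bounded_integrable => //.
    exists 1; split; first exact: num_real.
    move=> M lM r _; apply: le_trans (ltW lM).
    by rewrite indicE; case: (_ \in _); rewrite ?normr1 ?normr0.
  by rewrite /Rintegral integral_indic// setIidl.
have mgs m : measurable_fun `[a, b] (fun r => L2_dot (g r) v - L2_dot (s m r) v).
  by apply: measurable_funB => //; have /integrableP[/measurable_EFinP] := is_ m.
have gs_le m : (\int[leb]_(r in `[a, b]) `|L2_dot (g r) v - L2_dot (s m r) v|%:E <=
    \int[leb]_(r in `[a, b]) `|g r - s m r|%:E)%E.
  apply: ge0_le_integral_nonmeas => r _; rewrite lee_fin// -L2_dotBl.
  by apply: le_trans (L2_cauchy_schwarz _ _) _; rewrite ler_piMr.
have gs0 : (\int[leb]_(r in `[a, b]) `|L2_dot (g r) v - L2_dot (s m r) v|%:E)%E @[m --> \oo] --> 0%E.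
  apply: squeeze_cvge g0; last exact: cvg_cst.
  by apply: nearW => m; rewrite integral_ge0//=; exact: gs_le.
have ig : leb.-integrable `[a, b] (EFin \o (fun r => L2_dot (g r) v)).
  have /fine_cvgP[[M _ MP] _] := gs0.
  have iMs : leb.-integrable `[a, b] (EFin \o (fun r => L2_dot (g r) v - L2_dot (s M r) v)).
    apply/integrableP; split; first by apply/measurable_EFinP; exact: mgs.
    by rewrite ltey_eq MP//=.
  have := integrableD mab iMs (is_ M); apply: eq_integrable => // r _.
  by rewrite /= -EFinD subrK.
split => //.
have l1 : L2_dot (\sum_(i < N m) fine (leb (E m i)) *: c m i) v @[m --> \oo] --> L2_dot x v.
  exact: (cvg_comp _ (fun u => L2_dot u v) xE (@L2_dot_cont _ _ _ _ v x)).
apply: (cvg_unique _ l1) => //=.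
apply/cvgrPdist_le => eps eps0.
have /fine_cvgP[_ /cvgrPdist_le/(_ _ eps0)] := gs0.
have /fine_cvgP[+ _] := gs0; apply: filterS2 => m /= gfin.
rewrite sub0r normrN ger0_norm ?fine_ge0 ?integral_ge0// => le_eps.
rewrite -Is -RintegralB//; apply: le_trans le_eps.
by apply: le_normr_Rintegral => //; have := integrableB mab ig (is_ m); apply: eq_integrable.
Qed.

End bochner.

(** * Second-moment estimates *)

Section cauchy_schwarz.
Context d (T : measurableType d) (R : realType) (mu : {measure set T -> \bar R}).

Lemma Rintegral_cauchy_schwarz (a p : T -> R) (A B : R) :
  measurable_fun setT a -> measurable_fun setT p ->
  (\int[mu]_x ((a x) ^+ 2)%:E <= A%:E)%E -> (\int[mu]_x ((p x) ^+ 2)%:E <= B%:E)%E ->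
  (\int[mu]_x (a x * p x))%R ^+ 2 <= A * B.
Proof.
move=> ma mp aA pB.
have [U Ua] := L2_exists ma (le_lt_trans aA (ltry A)).
have [V Vp] := L2_exists mp (le_lt_trans pB (ltry B)).
have -> : (\int[mu]_x (a x * p x))%R = L2_dot U V.
  apply: ae_eq_Rintegral; [exact: measurable_funM|exact: measurable_funM|].
  by apply: filterS2 Ua Vp => x h1 h2 Tx; rewrite h1// h2.
have UA : `|U| ^+ 2 <= A.
  rewrite -lee_fin -L2_sqr_integral; apply: le_trans aA.
  rewrite le_eqVlt; apply/orP; left; apply/eqP; apply: ae_eq_integral => //.
  - by apply/measurable_EFinP/measurable_funX.
  - by apply/measurable_EFinP/measurable_funX.
  - by apply: filterS Ua => x h Tx; rewrite h.
have VB : `|V| ^+ 2 <= B.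
  rewrite -lee_fin -L2_sqr_integral; apply: le_trans pB.
  rewrite le_eqVlt; apply/orP; left; apply/eqP; apply: ae_eq_integral => //.
  - by apply/measurable_EFinP/measurable_funX.
  - by apply/measurable_EFinP/measurable_funX.
  - by apply: filterS Vp => x h Tx; rewrite h.
apply: (@le_trans _ _ (`|U| ^+ 2 * `|V| ^+ 2)); last by rewrite ler_pM ?sqr_ge0.
rewrite -exprMn -[leLHS]real_normK ?num_real// lerXn2r ?nnegrE ?mulr_ge0//.
exact: L2_cauchy_schwarz.
Qed.

End cauchy_schwarz.

(** * Bounds in mean by measurable majorants *)

Section integral_bound.
Context d (Om : measurableType d) (R : realType) (P : {measure set Om -> \bar R}).
Implicit Types (x y : Om -> \bar R) (c : R).

(* [c] bounds the upper integral of [x], which need not be measurable *)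
Definition integral_bound x c := exists B : Om -> \bar R,
  [/\ measurable_fun setT B, forall w, (0 <= B w)%E, {ae P, forall w, (x w <= B w)%E} &
      (\int[P]_w B w <= c%:E)%E].

Lemma integral_bound_measurable x c : measurable_fun setT x -> (forall w, (0 <= x w)%E) ->
  (\int[P]_w x w <= c%:E)%E -> integral_bound x c.
Proof. by move=> mx x0 xc; exists x; split => //; exact: nearW. Qed.

Lemma integral_bound_le x y c : integral_bound y c -> {ae P, forall w, (x w <= y w)%E} ->
  integral_bound x c.
Proof.
move=> [B [mB B0 yB Bc]] xy; exists B; split => //.
by apply: filterS2 xy yB => w; exact: le_trans.
Qed.

Lemma integral_bound_le_cst x c c' : integral_bound x c -> c <= c' -> integral_bound x c'.
Proof.
by move=> [B [mB B0 xB Bc]] cc'; exists B; split => //; rewrite (le_trans Bc)// lee_fin.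
Qed.

Lemma integral_boundD x y c c' : integral_bound x c -> integral_bound y c' ->
  integral_bound (fun w => x w + y w)%E (c + c').
Proof.
move=> [B [mB B0 xB Bc]] [B' [mB' B0' yB' Bc']].
exists (fun w => B w + B' w)%E; split.
- exact: emeasurable_funD.
- by move=> w; rewrite adde_ge0.
- by apply: filterS2 xB yB' => w; exact: leeD.
- by rewrite ge0_integralD// EFinD leeD.
Qed.

Lemma integral_boundZ x c (a : R) : 0 <= a -> integral_bound x c ->
  integral_bound (fun w => a%:E * x w)%E (a * c).
Proof.
move=> a0 [B [mB B0 xB Bc]]; exists (fun w => a%:E * B w)%E; split.
- exact: measurable_funeM.
- by move=> w; rewrite mule_ge0.
- by apply: filterS xB => w; apply: lee_wpmul2l; rewrite lee_fin.
- by rewrite ge0_integralZl// EFinM lee_wpmul2l.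
Qed.

Lemma integral_bound_sum n (x : nat -> Om -> \bar R) (c : R) :
  (forall i, (i < n)%N -> integral_bound (x i) c) ->
  integral_bound (fun w => \sum_(i < n) x i w)%E (n%:R * c).
Proof.
elim: n => [|n IH] h.
  apply: integral_bound_measurable.
  - by under eq_fun do rewrite big_ord0; exact: measurable_cst.
  - by move=> w; rewrite big_ord0.
  - by under eq_integral do rewrite big_ord0; rewrite integral0 mul0r.
rewrite -natr1 mulrDl mul1r; under eq_fun do rewrite big_ord_recr/=.
by apply: integral_boundD; [apply: IH => i ni; apply: h; exact: ltnW|exact: h].
Qed.

Lemma integral_bound_integral x c : (forall w, (0 <= x w)%E) -> integral_bound x c ->
  (\int[P]_w x w <= c%:E)%E.
Proof.
move=> x0 [B [mB B0 [N [mN N0 NP]] Bc]].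
(* The value infinity on the exceptional null set makes the majorant valid everywhere and leaves its
   integral unchanged. *)
pose B' w := (B w + (+oo * (\1_N w)%:E))%E.
have mB' : measurable_fun setT B'.
  apply: emeasurable_funD => //; apply: measurable_funeM.
  by apply/measurable_EFinP; exact: measurable_indic.
have B'0 w : (0 <= B' w)%E by rewrite adde_ge0// mule_ge0.
apply: (@le_trans _ _ (\int[P]_w B' w)%E).
  apply: ge0_le_integral_nonmeas => // w _; rewrite /B' indicE.
  have [wN|wN] := boolP (w \in N).
    by rewrite mule1 addey ?leey// gt_eqF// (lt_le_trans _ (B0 w))// ltNy0.
  rewrite mule0 adde0; apply: contrapT => h; move/negP: wN; apply.
  by rewrite inE; apply: NP.
rewrite (ge0_ae_eq_integral measurableT mB' mB)//.
exists N; split => // w /= h; apply: contrapT => Nw; apply: h => _.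
by rewrite /B' indicE memNset// mule0 adde0.
Qed.

End integral_bound.

Section tonelli_bound.
Context d (Om : measurableType d) (R : realType) (P : probability Om R).
Local Notation leb := (@lebesgue_measure R).

(** Turns second-moment bounds at fixed times into a bound in mean for the time integral along a
    path. *)
Lemma tonelli_bound (th : measurableTypeR R * Om -> \bar R) (kap : R -> \bar R) (c : R) :
  measurable_fun setT th -> (forall p, (0 <= th p)%E) ->
  (forall r, (\int[P]_w th (r, w) <= kap r)%E) -> (\int[leb]_r kap r <= c%:E)%E ->
  integral_bound P (fun w => \int[leb]_r th (r, w))%E c.
Proof.
move=> mth th0 thk kc; apply: integral_bound_measurable.
- exact: (measurable_fun_fubini_tonelli_G th).
- by move=> w; apply: integral_ge0.
- rewrite -(fubini_tonelli th)//; apply: le_trans kc.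
  by apply: ge0_le_integral_nonmeas => r _ //; exact: integral_ge0.
Qed.

End tonelli_bound.

Lemma nneseries_sqr4_le (R : realType) (x y z t : nat -> R) :
  (\sum_(k <oo) ((x k + y k + z k + t k) ^+ 2)%:E <=
   4%:E * (\sum_(k <oo) (x k ^+ 2)%:E + \sum_(k <oo) (y k ^+ 2)%:E +
           \sum_(k <oo) (z k ^+ 2)%:E + \sum_(k <oo) (t k ^+ 2)%:E))%E.
Proof.
have p0 (v : nat -> R) i : (0 <= (v i ^+ 2)%:E)%E by rewrite lee_fin sqr_ge0.
rewrite -!nneseriesD//; try by move=> *; rewrite ?adde_ge0.
rewrite -nneseriesZl; last by move=> i _; rewrite !adde_ge0.
apply: lee_nneseries => k _; first by rewrite lee_fin sqr_ge0.
rewrite -!EFinD -EFinM lee_fin.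
have h (a b c e : R) : (a + b + c + e) ^+ 2 <= 4 * (a ^+ 2 + b ^+ 2 + c ^+ 2 + e ^+ 2).
  by have := sqr_ge0 (a - b); have := sqr_ge0 (a - c); have := sqr_ge0 (a - e);
     have := sqr_ge0 (b - c); have := sqr_ge0 (b - e); have := sqr_ge0 (c - e); nra.
exact: h.
Qed.

Section kernel_integral.
Context d (T : measurableType d) (R : realType) (mu : {measure set T -> \bar R}).
Local Notation H := (L2 mu).
Local Notation leb := (@lebesgue_measure R).
Variable e : nat -> H.
Hypothesis eb : orthonormal_basis e.

Lemma integral_norm_parseval (g : R -> H) : weakly_measurable g ->
  (\int[leb]_r (`|g r| ^+ 2)%:E = \sum_(k <oo) \int[leb]_r (L2_dot (g r) (e k) ^+ 2)%:E)%E.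
Proof.
move=> mg; under eq_integral do rewrite -(parseval eb).
rewrite integral_nneseries// => [k|k r _]; last by rewrite lee_fin sqr_ge0.
by apply/measurable_EFinP; apply: measurable_funX; exact: mg.
Qed.

(** Cauchy-Schwarz in each mode with one bound [c] for all kernels; Parseval sums what remains. The
    drift thus needs no weight in the eigenvalues. *)
Lemma kernel_integral_le (a : nat -> R -> R) (g : R -> H) (c : R) : 0 < c ->
  weakly_measurable g -> (forall k, measurable_fun setT (a k)) ->
  (forall k, \int[leb]_r (a k r ^+ 2)%:E <= c%:E)%E ->
  (\sum_(k <oo) ((\int[leb]_r (a k r * L2_dot (g r) (e k)))%R ^+ 2)%:E <=
   c%:E * \int[leb]_r (`|g r| ^+ 2)%:E)%E.
Proof.
move=> c0 mg ma ac; rewrite integral_norm_parseval//.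
have i0 k : (0 <= \int[leb]_r (L2_dot (g r) (e k) ^+ 2)%:E)%E.
  by apply: integral_ge0 => r _; rewrite lee_fin sqr_ge0.
rewrite -nneseriesZl; last by move=> k _; exact: i0.
apply: lee_nneseries => k _; first by rewrite lee_fin sqr_ge0.
have [fin|] := boolP ((\int[leb]_r (L2_dot (g r) (e k) ^+ 2)%:E)%E \is a fin_num).
  rewrite -(fineK fin) -EFinM lee_fin.
  have mgk : measurable_fun setT (fun r => L2_dot (g r) (e k)) by exact: mg.
  have gk_le : (\int[leb]_r (L2_dot (g r) (e k) ^+ 2)%:E <=
      (fine (\int[leb]_r (L2_dot (g r) (e k) ^+ 2)%:E))%:E)%E by rewrite fineK.
  exact: (@Rintegral_cauchy_schwarz _ (measurableTypeR R) R leb _ _ _ _ (ma k) mgk (ac k) gk_le).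
rewrite ge0_fin_numE// -leNgt leye_eq => /eqP ->.
by rewrite gt0_muley ?lte_fin// leey.
Qed.

End kernel_integral.

Lemma Rintegral_cells (R : realType) (tau : R) n (c : nat -> R) : 0 < tau ->
  (@lebesgue_measure R).-integrable setT (EFin \o (fun r => \sum_(i < n) c i * \1_(cell tau i) r)) /\
  (\int[@lebesgue_measure R]_r (\sum_(i < n) c i * \1_(cell tau i) r))%R = \sum_(i < n) tau * c i.
Proof.
move=> tau0.
have ind i : (@lebesgue_measure R).-integrable setT (EFin \o (\1_(cell tau i) : R -> R)).
  exact: integrable_indic_itv.
have indI i : (\int[@lebesgue_measure R]_r (\1_(cell tau i) r))%R = tau.
  rewrite /Rintegral integral_indic ?setIT//; last exact: measurable_cell.
  exact: (congr1 fine (cell_measure i tau0)).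
elim: n => [|n [IHi IH]].
  rewrite big_ord0; under eq_fun do rewrite big_ord0.
  by split; [exact: integrable0|rewrite /Rintegral integral0].
have ci := integrableZl_EFin (c n) (ind n).
under [X in _.-integrable _ (EFin \o X)]eq_fun do rewrite big_ord_recr/=.
under eq_Rintegral do rewrite big_ord_recr/=.
split; first exact: integrableD_EFin.
by rewrite RintegralD// IH RintegralZl// indI big_ord_recr/= (mulrC tau).
Qed.

Lemma sqr_sum_le (R : realDomainType) n (a : nat -> R) :
  (\sum_(i < n) a i) ^+ 2 <= n%:R * \sum_(i < n) a i ^+ 2.
Proof.
(* The second clause is the cross term of the expanded square; the induction step uses it at b =
   [a n]. *)
suff [h _] : (\sum_(i < n) a i) ^+ 2 <= n%:R * (\sum_(i < n) a i ^+ 2) /\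
    forall b, 2 * (\sum_(i < n) a i) * b <= \sum_(i < n) a i ^+ 2 + n%:R * b ^+ 2 by [].
elim: n => [|n [IH IHb]].
  by rewrite !big_ord0 expr0n mul0r; split=> // b; rewrite mulr0 mul0r mul0r addr0.
rewrite !big_ord_recr/= -natr1; split=> [|b].
  have := IHb (a n); move: IH; set x := \sum_(i < n) a i; set y := \sum_(i < n) _ ^+ 2.
  by set m := n%:R; set z := a n; move=> *; nra.
have := IHb b; set x := \sum_(i < n) a i; set y := \sum_(i < n) _ ^+ 2.
by set m := n%:R; set z := a n; have := sqr_ge0 (z - b); nra.
Qed.

(* a discrete Gronwall inequality for an implicit recursion: absorbing the last
   term of the sum costs a factor [(1 - q)^-1 <= 1 + 2 * q] *)
Lemma implicit_gronwall (R : realType) (q : R) (a x : nat -> R) N : 0 <= q -> 2 * q <= 1 ->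
  (forall n, (n <= N)%N -> 0 <= a n) ->
  (forall n, (n <= N)%N -> x n <= a n + q * \sum_(i < n) x i.+1) ->
  x N <= a N + q * (expR (2 * q * N%:R) * \sum_(i < N) a i.+1).
Proof.
move=> q0 q1 a0 xa.
have S_le n : (n <= N)%N -> \sum_(i < n) x i.+1 <= (1 + 2 * q) ^+ n * \sum_(i < n) a i.+1.
  elim: n => [|n IH] nN; first by rewrite !big_ord0 mulr0.
  rewrite !big_ord_recr/=; have := xa n.+1 nN; rewrite big_ord_recr/=.
  have := IH (ltnW nN); have := a0 n.+1 nN.
  have p1 : 1 <= (1 + 2 * q) ^+ n by rewrite exprn_ege1// lerDl mulr_ge0.
  have s0 : 0 <= \sum_(i < n) a i.+1.
    by apply: sumr_ge0 => i _; apply: a0; exact: leq_trans (ltn_ord i) (ltnW nN).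
  rewrite exprS; move: p1 s0; set P := _ ^+ n; set X := \sum_(i < n) x i.+1.
  set Y := \sum_(i < n) a i.+1; set y := x n.+1; set b := a n.+1 => p1 s0 b0 XY yb.
  have h1 : (1 - q) * (X + y) <= P * (Y + b) by nra.
  have h2 : 0 <= P * (Y + b) by rewrite mulr_ge0 ?addr_ge0//; lra.
  have h3 : (1 + 2 * q) * ((1 - q) * (X + y)) <= (1 + 2 * q) * (P * (Y + b)).
    by rewrite ler_wpM2l//; lra.
  (* The signs of [x] are not prescribed, and the comparison (1 + 2 q) (1 - q) = 1 + q (1 - 2 q) >=
     1 may only be multiplied by a nonnegative sum. *)
  case: (leP (X + y) 0) => h4.
    by apply: le_trans h4 _; rewrite -mulrA mulr_ge0//; lra.
  rewrite -mulrA; apply: le_trans h3.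
  have : 0 <= q * (1 - 2 * q) * (X + y) by rewrite !mulr_ge0//; lra.
  by lra.
apply: le_trans (xa N (leqnn N)) _; rewrite lerD2l ler_wpM2l//.
apply: le_trans (S_le N (leqnn N)) _; rewrite ler_wpM2r//.
  by apply: sumr_ge0 => i _; exact: a0.
rewrite (mulrC (2 * q)) expRM_natl lerXn2r ?nnegrE ?expR_ge0//; first by lra.
exact: expR_ge1Dx.
Qed.

(** * The mild solution *)

Section spde.
Context d (T : measurableType d) (R : realType) (mu : {measure set T -> \bar R}).
Local Notation H := (L2 mu).
Local Notation leb := (@lebesgue_measure R).
Variables (e : nat -> H) (lam : nat -> R) (S : R -> H -> H) (Q Qh : H -> H)
  (f : H -> H) (Lf tT beta : R).
Hypotheses (eb : orthonormal_basis e) (lam0 : forall k, 0 < lam k)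
  (Se : forall t : R, 0 <= t -> forall v k,
    L2_dot (S t v) (e k) = expR (- (lam k * t)) * L2_dot v (e k))
  (hQ : nonneg_self_adjoint Q) (hQh : operator_sqrt Q Qh)
  (hLf : 0 <= Lf) (hf : forall u v, `|f u - f v| <= Lf * `|u - v|)
  (hT : 0 < tT) (hbeta : 0 <= beta < 1).
Context d' (Om : measurableType d') (P : probability Om R).
Variables (u0 : Om -> H) (nQ l0 E0 : R).
Hypotheses (HnQ : (\sum_(k <oo) (lam k `^ (beta - 1) * `|Qh (e k)| ^+ 2)%:E <= nQ%:E)%E)
  (l0_gt0 : 0 < l0) (lam_ge : forall k, l0 <= lam k).
(** The square of |A^(beta/2) u0| as a series in [0, oo], defined on every path. *)
Definition initial_energy w : \bar R :=
  (\sum_(k <oo) (lam k `^ beta * L2_dot (u0 w) (e k) ^+ 2)%:E)%E.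
Hypothesis HE0 : integral_bound P initial_energy E0.
Variables (F : R -> set (set Om)) (W : R -> H -> Om -> R).
Hypotheses (hF : normal_filtration P tT F) (hW : Q_wiener P tT F Q W).

Let m2 : R := fine (gaussian_moment2 R).
Let m20 : 0 <= m2. Proof. exact: gaussian_moment2_fine_ge0. Qed.

Let nQ0 : 0 <= nQ.
Proof.
rewrite -lee_fin; apply: le_trans HnQ; apply: nneseries_ge0 => k _ _.
by rewrite lee_fin mulr_ge0 ?powR_ge0 ?sqr_ge0.
Qed.

(** Mode k costs at most 4 m2 C lam_k^(beta-1) |Qh e_k|^2, and the sum of these weighted norms is
    what the Hilbert-Schmidt hypothesis controls. *)
Lemma noise_bound (X : nat -> Om -> R) (a : nat -> R -> R) (C : R) : 0 <= C ->
  (forall k, wiener_integral P tT Qh W (X k) (fun r => a k r *: Qh (e k))) ->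
  (forall k, measurable_fun setT (a k)) ->
  (forall k, \int[leb]_r (a k r ^+ 2)%:E <= (C * lam k `^ (beta - 1))%:E)%E ->
  integral_bound P (fun w => \sum_(k <oo) (X k w ^+ 2)%:E)%E (4 * m2 * C * nQ).
Proof.
move=> C0 Xa ma aC.
have mX k : measurable_fun setT (X k) by case: (Xa k).
have mX2 k : measurable_fun setT (fun w => (X k w ^+ 2)%:E).
  exact/measurable_EFinP/measurable_funX.
apply: integral_bound_measurable.
- by apply: ge0_emeasurable_sum => // n w _ _; rewrite lee_fin sqr_ge0.
- by move=> w; apply: nneseries_ge0 => k _ _; rewrite lee_fin sqr_ge0.
rewrite integral_nneseries//; last by move=> k w _; rewrite lee_fin sqr_ge0.
apply: le_trans (_ : _ <= \sum_(k <oo) ((4 * m2 * C)%:E *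
   (lam k `^ (beta - 1) * `|Qh (e k)| ^+ 2)%:E))%E _; last first.
  rewrite nneseriesZl; last by move=> k _; rewrite lee_fin mulr_ge0 ?powR_ge0 ?sqr_ge0.
  by rewrite [leRHS]EFinM lee_wpmul2l// lee_fin !mulr_ge0.
apply: lee_nneseries => k _; first by move=> _; apply: integral_ge0 => w _; rewrite lee_fin sqr_ge0.
rewrite -EFinM -!mulrA mulrA (mulrA C).
apply: (wiener_integral_sqr_le hF hQ hQh hW eb (Xa k)).
under eq_integral do rewrite normrZ exprMn real_normK ?num_real// EFinM.
rewrite ge0_integralZr//; last first.
- by move=> r _; rewrite lee_fin sqr_ge0.
- by apply/measurable_EFinP; apply: measurable_funX; exact: ma.
by rewrite [leRHS]EFinM lee_wpmul2r ?lee_fin ?sqr_ge0.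
Qed.

Lemma coord_bound (V : Om -> H) (X : nat -> Om -> R) (ini : nat -> R)
    (ker ker' : nat -> R -> R) (g g' : R -> Om -> H) (c1 c2 c2' c3 G G' : R) :
  0 <= c1 -> 0 < c2 -> 0 < c2' -> 0 <= c3 ->
  (forall k, ini k ^+ 2 <= c1 * lam k `^ beta) ->
  (forall k, measurable_fun setT (ker k)) -> (forall k, measurable_fun setT (ker' k)) ->
  (forall k, \int[leb]_r (ker k r ^+ 2)%:E <= c2%:E)%E ->
  (forall k, \int[leb]_r (ker k r ^+ 2)%:E <= (c3 * lam k `^ (beta - 1))%:E)%E ->
  (forall k, \int[leb]_r (ker' k r ^+ 2)%:E <= c2'%:E)%E ->
  (forall w, weakly_measurable (g^~ w)) -> (forall w, weakly_measurable (g'^~ w)) ->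
  integral_bound P (fun w => \int[leb]_r (`|g r w| ^+ 2)%:E)%E G ->
  integral_bound P (fun w => \int[leb]_r (`|g' r w| ^+ 2)%:E)%E G' ->
  (forall k, wiener_integral P tT Qh W (X k) (fun r => ker k r *: Qh (e k))) ->
  {ae P, forall w, forall k, L2_dot (V w) (e k) = ini k * L2_dot (u0 w) (e k) +
     (\int[leb]_r (ker k r * L2_dot (g r w) (e k)))%R +
     (\int[leb]_r (ker' k r * L2_dot (g' r w) (e k)))%R + X k w} ->
  integral_bound P (fun w => (`|V w| ^+ 2)%:E)
    (4 * (c1 * E0 + c2 * G + c2' * G' + 4 * m2 * c3 * nQ)).
Proof.
move=> c10 c20 c20' c30 inic mk mk' kc2 kc3 kc2' mg mg' gG gG' Xk VE.
apply: integral_bound_le; first (apply: integral_boundZ => //;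
  apply: integral_boundD; last exact: (noise_bound c30 Xk mk kc3);
  apply: integral_boundD; last exact: (integral_boundZ (ltW c20') gG');
  apply: integral_boundD; [exact: (integral_boundZ c10 HE0)|exact: (integral_boundZ (ltW c20) gG)]).
apply: filterS VE => w VE; rewrite -(parseval eb).
under eq_eseriesr do rewrite VE.
apply: le_trans (nneseries_sqr4_le _ _ _ _) _; rewrite lee_wpmul2l ?lee_fin//.
apply: leeD => //; apply: leeD; last exact: (kernel_integral_le eb c20' (mg' w) mk' kc2').
apply: leeD; last exact: (kernel_integral_le eb c20 (mg w) mk kc2).
rewrite -nneseriesZl; last by move=> k _; rewrite lee_fin mulr_ge0 ?powR_ge0 ?sqr_ge0.
apply: lee_nneseries => k _; first by rewrite lee_fin sqr_ge0.
by rewrite -[leRHS]EFinM lee_fin exprMn [leRHS]mulrA ler_wpM2r ?sqr_ge0.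
Qed.

Lemma f_continuous : continuous f.
Proof.
move=> v; apply/(@cvgrPdist_le R _ _ (nbhs v) (nbhs_filter v)) => eps eps0; near=> x.
apply: le_trans (hf v x) _.
apply: (@le_trans _ _ ((Lf + 1) * `|v - x|)); first by rewrite ler_wpM2r// lerDl.
rewrite mulrC -ler_pdivlMr ?ltr_wpDl//.
by near: x; apply: cvgr_dist_le => //; rewrite divr_gt0// ltr_wpDl.
Unshelve. all: by end_near. Qed.

Lemma f_dot_continuous v : continuous (fun x => L2_dot (f x) v).
Proof.
move=> x; have fx := @f_continuous x.
apply: (@cvg_comp _ _ _ f (fun y => L2_dot y v) _ _ _ fx); exact: L2_dot_cont.
Qed.

Lemma f_growth v : `|f v| ^+ 2 <= 2 * `|f 0| ^+ 2 + 2 * Lf ^+ 2 * `|v| ^+ 2.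
Proof.
rewrite -{1}(subrK (f 0) (f v)) addrC; apply: le_trans (L2_sqr_normD_le _ _) _.
rewrite lerD2l -mulrA ler_wpM2l// -exprMn lerXn2r ?nnegrE ?mulr_ge0//.
by have := hf v 0; rewrite subr0.
Qed.

Section solution.
Variable u : R -> Om -> H.
Hypothesis hu : mild_solution P tT F e Qh W S f u0 u.

(** Cut off to ]0, t], because joint measurability of [u] is given on [0, T] only while the kernels
    live on the whole line. *)
Definition drift t r w : H := if 0 < r <= t then f (u r w) else 0.

Lemma measurable_solution (phi : H -> R) t : t <= tT -> continuous phi ->
  measurable_fun setT (fun p : measurableTypeR R * Om =>
    if 0 < p.1 <= t then phi (u p.1 p.2) else 0).
Proof.
move=> tT' cphi; pose D := [set p : measurableTypeR R * Om | p.1 \in `[0, tT]].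
pose D' := [set p : measurableTypeR R * Om | p.1 \in `]0, t]].
have mD : measurable D.
  have := mild_measurable hu (@openT H); congr measurable.
  by apply/seteqP; split => [p []|p pD].
have mD' : measurable D'.
  have m0t : measurable (`]0, t]%classic : set (measurableTypeR R)) by exact: measurable_itv.
  by have := @measurable_fst _ _ (measurableTypeR R) Om measurableT _ m0t; rewrite setTI.
have sD : D' `<=` D.
  by move=> p; rewrite /D' /D/= !in_itv/= => /andP[/ltW -> /le_trans ->].
have mphi : measurable_fun D (fun p => phi (u p.1 p.2)).
  apply: measurable_fun_open => // U oU.
  have := mild_measurable hu (U := phi @^-1` U).
  by apply; move/continuousP : cphi; apply.
have := (measurable_restrictT _ mD').1 (measurable_funS mD sD mphi).
congr (measurable_fun _ _); apply/funext => p.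
have [pin|pin] := boolP (0 < p.1 <= t).
  by rewrite patchE mem_set// /D'/= in_itv.
by rewrite patchE memNset// /D'/= in_itv; exact/negP.
Qed.

Lemma measurable_drift_dot t v : t <= tT -> measurable_fun setT
  (fun p : measurableTypeR R * Om => L2_dot (drift t p.1 p.2) v).
Proof.
move=> tT'; have := measurable_solution tT' (@f_dot_continuous v).
congr (measurable_fun _ _); apply/funext => p; rewrite /drift.
by case: ifP => _; rewrite ?L2_dot0l.
Qed.

Lemma measurable_drift_norm t : t <= tT -> measurable_fun setT
  (fun p : measurableTypeR R * Om => (`|drift t p.1 p.2| ^+ 2)%:E).
Proof.
move=> tT'; under eq_fun do rewrite -(parseval eb).
apply: ge0_emeasurable_sum => [n r _ _|n _]; first by rewrite lee_fin sqr_ge0.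
by apply/measurable_EFinP/measurable_funX; exact: measurable_drift_dot.
Qed.

Lemma measurable_section (g : measurableTypeR R * Om -> R) w : measurable_fun setT g ->
  measurable_fun setT (fun r : R => g (r, w)).
Proof. by move=> mg; apply: (measurableT_comp mg); exact: measurable_fun_pair. Qed.

Lemma drift_weakly_measurable t w : t <= tT -> weakly_measurable (drift t ^~ w).
Proof. by move=> tT' v; exact: (measurable_section w (measurable_drift_dot v tT')). Qed.

(** The drift may be cut at a later time t' since the kernel vanishes after t. Solutions at two
    times can then share one drift, and the recorded integrability allows their kernels to be
    subtracted under the integral. *)
Lemma mild_coord t t' : 0 <= t <= t' -> t' <= tT -> exists2 Z : Om -> H,
  (forall k, wiener_integral P tT Qh W (fun w => L2_dot (Z w) (e k))
     (fun r => ou_kernel (lam k) t r *: Qh (e k))) &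
  {ae P, forall w, forall k,
    leb.-integrable setT (EFin \o (fun r => ou_kernel (lam k) t r * L2_dot (drift t' r w) (e k))) /\
    L2_dot (u t w) (e k) = expR (- (lam k * t)) * L2_dot (u0 w) (e k) +
      (\int[leb]_r (ou_kernel (lam k) t r * L2_dot (drift t' r w) (e k)))%R + L2_dot (Z w) (e k)}.
Proof.
move=> /andP[t0 tt'] t'T; have tT' := le_trans tt' t'T.
have tin : 0 <= t <= tT by rewrite t0.
have tin' : t \in `[0, tT] by rewrite in_itv.
have [Z itoZ uE] := mild_eq hu tin'.
exists Z; first by move=> k; exact: (ito_coord hF hQ hQh hW eb Se _ tin itoZ).
apply: filterS uE => w [J JE ->] k.
pose K r := ou_kernel (lam k) t r * L2_dot (drift t' r w) (e k).
have mK : measurable_fun setT K.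
  by apply: measurable_funM; [exact: measurable_ou_kernel|exact: drift_weakly_measurable].
have gE r : r \in (`]0, t]%classic : set R) ->
   L2_dot (S (t - r) (f (u r w))) (e k) = expR (- (lam k * (t - r))) * L2_dot (drift t' r w) (e k).
  by rewrite inE/= in_itv/= => /andP[r0 rt]; rewrite Se ?subr_ge0// /drift r0 (le_trans rt).
have mg : measurable_fun `[0, t] (fun r => L2_dot (S (t - r) (f (u r w))) (e k)).
  have gE' : {in (`]0, t]%classic : set (measurableTypeR R)),
      (fun r => expR (- (lam k * (t - r))) * L2_dot (drift t' r w) (e k)) =1
      (fun r => L2_dot (S (t - r) (f (u r w))) (e k))} by move=> r /gE.
  (* At r = 0 the cut-off drift and the true integrand may differ, so this point is split off. *)
  rewrite -(@setU1itv _ _ _ _ false) ?bnd_simp//; apply/measurable_funU => //.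
  split; first exact: measurable_fun_set1.
  apply: eq_measurable_fun gE' _.
  apply: measurable_funTS; apply: measurable_funM; last exact: drift_weakly_measurable.
  apply: measurableT_comp => //; apply: measurableT_comp => //.
  by apply: measurable_funM => //; apply: measurable_funB.
have ek1 : `|e k| <= 1 by rewrite (onb_norm1 eb).
have [ig IJ] := bochner_dot ek1 mg JE.
have KE : K = (fun r => L2_dot (S (t - r) (f (u r w))) (e k)) \_ `]0, t].
  apply/funext => r; rewrite patchE /K /ou_kernel indicE.
  have [rt|_] := boolP (r \in _); last by rewrite !mul0r.
  by rewrite mul1r gE.
have sub : (`]0, t] `<=` `[0, t])%classic.
  by move=> r; rewrite /= !in_itv/= => /andP[/ltW -> ->].
have m0 : measurable (`[0, t]%classic : set (measurableTypeR R)) by exact: measurable_itv.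
have m1 : measurable (`]0, t]%classic : set (measurableTypeR R)) by exact: measurable_itv.
split.
  rewrite -/K KE.
  have := (@integrable_mkcond _ (measurableTypeR R) R leb _ (EFin \o (fun r => L2_dot (S (t - r) (f (u r w))) (e k))) m1).1
     (@integrableS _ (measurableTypeR R) R leb _ _ _ m0 m1 sub ig).
  by apply: eq_integrable => // r _; rewrite /= !patchE; case: ifP.
rewrite !L2_dotDl Se//; congr (_ + _ + _); rewrite -/K.
transitivity (\int[leb]_(r in `]0, t]) L2_dot (S (t - r) (f (u r w))) (e k))%R.
  by rewrite IJ; apply/esym/Rintegral_itv_obnd_cbnd; exact: (@integrableS _ (measurableTypeR R) R leb _ _ _ m0 m1 sub ig).
by rewrite Rintegral_mkcond -KE.
Qed.

Lemma mean_sq_f v : measurable_wrt measurable v ->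
  (mean_sq P (fun w => f (v w)) <= (2 * `|f 0| ^+ 2)%:E + (2 * Lf ^+ 2)%:E * mean_sq P v)%E.
Proof.
move=> mv; rewrite /mean_sq.
have mv2 : measurable_fun setT (fun w => (`|v w| ^+ 2)%:E).
  apply/measurable_EFinP/measurable_funX.
  by apply: (measurable_wrt_comp mv); exact: norm_continuous.
have -> : ((2 * `|f 0| ^+ 2)%:E = \int[P]_w (2 * `|f 0| ^+ 2)%:E)%E.
  by rewrite (integral_cst P measurableT) [X in (_ * X)%E](@probability_setT _ _ _ P) mule1.
rewrite -ge0_integralZl//; last by rewrite lee_fin mulr_ge0 ?sqr_ge0.
rewrite -ge0_integralD//; last first.
- exact: measurable_funeM.
- by move=> w _; rewrite mule_ge0// lee_fin ?mulr_ge0 ?sqr_ge0.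
apply: ge0_le_integral_nonmeas => w _; first by rewrite lee_fin sqr_ge0.
by rewrite -EFinM -EFinD lee_fin; exact: f_growth.
Qed.

Lemma solution_measurable t : 0 <= t <= tT -> measurable_wrt measurable (u t).
Proof.
move=> tin; have tin' : t \in `[0, tT] by rewrite in_itv.
by move=> U oU; apply: (filtration_sub hF tin'); exact: (mild_adapted hu tin').
Qed.

(** Integrating exp(c r) over ]0, t] returns the weight exp(c t) with a gain 1/c, which a large [c]
    turns into a contraction. *)
Lemma drift_bound t N c : 0 <= N -> 0 < c -> 0 <= t <= tT ->
  (forall r, 0 <= r <= t -> (mean_sq P (u r) <= (N * expR (c * r))%:E)%E) ->
  integral_bound P (fun w => \int[leb]_r (`|drift t r w| ^+ 2)%:E)%E
    (2 * `|f 0| ^+ 2 * t + 2 * Lf ^+ 2 * (N * expR (c * t) / c)).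
Proof.
move=> N0 c0 /andP[t0 tT'] uN.
apply: (tonelli_bound (th := fun p : measurableTypeR R * Om => (`|drift t p.1 p.2| ^+ 2)%:E)
   (kap := (fun r => (2 * `|f 0| ^+ 2)%:E + (2 * Lf ^+ 2 * (N * expR (c * r)))%:E)%E \_ `]0, t])).
- exact: measurable_drift_norm.
- by move=> p; rewrite lee_fin sqr_ge0.
- move=> r; rewrite patchE /= /drift; case: (boolP (r \in _)) => [rt|/negP rt]; last first.
    have -> : (0 < r <= t) = false by apply/negP => h; apply: rt; rewrite inE/= in_itv.
    rewrite -[point]/(0%E).
    by under eq_integral do rewrite normr0 expr0n/=; rewrite integral0.
  move: rt; rewrite inE/= in_itv/= => rt; rewrite rt; move/andP: rt => [/ltW r0 rt].
  apply: le_trans (mean_sq_f _) _; first by apply: solution_measurable; rewrite r0 (le_trans rt).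
  by rewrite leeD2l// [leRHS]EFinM lee_wpmul2l ?lee_fin ?mulr_ge0 ?sqr_ge0// uN// r0.
have m0t : measurable (`]0, t]%classic : set (measurableTypeR R)) by exact: measurable_itv.
have mE : measurable_fun (`]0, t]%classic : set (measurableTypeR R))
    (fun r => (2 * Lf ^+ 2 * (N * expR (c * r)))%:E).
  apply/measurable_EFinP; apply: measurable_funTS; apply: measurable_funM => //.
  by apply: measurable_funM => //; apply: measurableT_comp => //; exact: measurable_funM.
rewrite -integral_mkcond ge0_integralD//; first last.
- by move=> r _; rewrite lee_fin !mulr_ge0 ?sqr_ge0 ?expR_ge0.
rewrite (integral_cst leb m0t).
have lt : leb (`]0, t]%classic : set (measurableTypeR R)) = t%:E.
  rewrite lebesgue_measure_itv/= lte_fin.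
  by case: ltP => h; rewrite ?oppr0 ?adde0//; congr (_%:E); apply/eqP; rewrite eq_le t0 h.
rewrite [X in (_ * X)%E + _]lt.
rewrite EFinD leeD//.
have -> : (\int[leb]_(r in `]0%R, t]) (2 * Lf ^+ 2 * (N * expR (c * r)))%:E =
    \int[leb]_(r in `]0%R, t]) ((2 * Lf ^+ 2 * (N * expR (c * t)))%:E * (expR (- (c * (t - r))))%:E))%E.
  apply: eq_integral => r _; have -> : expR (c * r) = expR (c * t) * expR (- (c * (t - r))).
    by rewrite -expRD; congr expR; ring.
  by rewrite !mulrA EFinM.
rewrite ge0_integralZl//; first last.
- by rewrite lee_fin !mulr_ge0 ?sqr_ge0 ?expR_ge0.
- apply/measurable_EFinP; apply: measurable_funTS; apply: measurableT_comp => //.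
  by apply: measurableT_comp => //; apply: measurable_funM => //; apply: measurable_funB.
rewrite (mulrA _ (N * _)) [leRHS]EFinM lee_wpmul2l ?lee_fin ?mulr_ge0 ?sqr_ge0 ?expR_ge0//.
exact: integral_expR_le_inv.
Qed.

Lemma inv_eigenvalue_le k : (lam k)^-1 <= l0 `^ (- beta) * lam k `^ (beta - 1).
Proof.
have /andP[b0 _] := hbeta.
rewrite !powRN powRD; last by rewrite implybE (gt_eqF (lam0 k)) orbT.
rewrite powRN powRr1 ?(ltW (lam0 k))// mulrA ler_peMl ?invr_ge0 ?(ltW (lam0 k))//.
rewrite mulrC ler_pdivlMr ?mul1r ?powR_gt0//.
by rewrite ge0_ler_powR ?nnegrE ?(ltW l0_gt0) ?(ltW (lam0 k)).
Qed.

Lemma energy_bound_ge0 : 0 <= E0.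
Proof.
have [B [_ B0 _ BE]] := HE0; rewrite -lee_fin; apply: le_trans BE.
exact: integral_ge0.
Qed.

(** Here 16 is the product of the 4 of [coord_bound], the 2 of [f_growth] and a 2 for halving; [tT]
    bounds the squared kernels. The added 1 keeps the rate positive for [Lf] = 0. *)
Definition growth_rate : R := 16 * tT * Lf ^+ 2 + 1.
Definition energy_const : R :=
  4 * (l0 `^ (- beta) * E0 + tT * (2 * `|f 0| ^+ 2 * tT) + 4 * m2 * l0 `^ (- beta) * nQ).

Lemma growth_rate_gt0 : 0 < growth_rate.
Proof. by rewrite ltr_wpDl// !mulr_ge0 ?sqr_ge0// ltW. Qed.

Lemma energy_const_ge0 : 0 <= energy_const.
Proof.
have E00 := energy_bound_ge0; have T0 := ltW hT.
by rewrite /energy_const mulr_ge0// !addr_ge0 ?mulr_ge0 ?powR_ge0 ?sqr_ge0.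
Qed.

Lemma zero_drift_bound :
  integral_bound P (fun w => \int[leb]_r (`|(fun _ _ => 0 : H) r w| ^+ 2)%:E)%E 0.
Proof.
apply: integral_bound_measurable.
- under eq_fun do under eq_integral do rewrite normr0 expr0n/=.
  by under eq_fun do rewrite integral0; exact: measurable_cst.
- by move=> w; apply: integral_ge0 => r _; rewrite lee_fin sqr_ge0.
- under eq_integral do under eq_integral do rewrite normr0 expr0n/=.
  by under eq_integral do rewrite integral0; rewrite integral0.
Qed.

(* [growth_rate] is large enough for the exponential weight to halve the
   contribution of the drift *)
Lemma weighted_bound_step N : 0 <= N ->
  (forall r, 0 <= r <= tT -> (mean_sq P (u r) <= (N * expR (growth_rate * r))%:E)%E) ->
  forall t, 0 <= t <= tT ->
    (mean_sq P (u t) <= ((energy_const + N / 2) * expR (growth_rate * t))%:E)%E.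
Proof.
move=> N0 uN t tin; have /andP[t0 tT'] := tin.
have c0 := growth_rate_gt0; have /andP[b0 b1] := hbeta.
have [Z Zk uE] := @mild_coord t t ltac:(by rewrite t0 lexx) tT'.
have dG : integral_bound P (fun w => \int[leb]_r (`|drift t r w| ^+ 2)%:E)%E
    (2 * `|f 0| ^+ 2 * t + 2 * Lf ^+ 2 * (N * expR (growth_rate * t) / growth_rate)).
  by apply: drift_bound => // r /andP[r0 rt]; apply: uN; rewrite r0 (le_trans rt).
have := coord_bound (c1 := l0 `^ (- beta)) (c2 := tT) (c2' := 1) (c3 := l0 `^ (- beta))
  (ini := fun k => expR (- (lam k * t))) (ker := fun k => ou_kernel (lam k) t)
  (ker' := fun _ _ => 0) (V := u t) _ _ _ _ _ _ _ _ _ _ _ _ dG zero_drift_bound Zk.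
move=> /(_ (powR_ge0 _ _) hT ltr01 (powR_ge0 _ _)) H.
apply: le_trans (_ : _ <= (4 * (l0 `^ (- beta) * E0 +
   tT * (2 * `|f 0| ^+ 2 * t + 2 * Lf ^+ 2 * (N * expR (growth_rate * t) / growth_rate)) +
   1 * 0 + 4 * m2 * l0 `^ (- beta) * nQ))%:E)%E _.
  apply: integral_bound_integral; first by move=> w; rewrite lee_fin sqr_ge0.
  apply: H.
  - move=> k; apply: (@le_trans _ _ 1).
      by rewrite expr_le1 ?expR_ge0// expR_le1 oppr_le0 mulr_ge0// ltW.
    rewrite powRN mulrC ler_pdivlMr ?mul1r ?powR_gt0//.
    by rewrite ge0_ler_powR ?nnegrE ?(ltW l0_gt0) ?(ltW (lam0 k)).
  - by move=> k; exact: measurable_ou_kernel.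
  - by move=> k; exact: measurable_cst.
  - move=> k; rewrite integral_ou_kernel_sqr; apply: le_trans (integral_expR_le_length _ _) _ => //.
      by rewrite mulr_gt0.
    by rewrite subr0 lee_fin.
  - move=> k; apply: le_trans (ou_kernel_sqr_le _ (lam0 k)) _; rewrite lee_fin.
    apply: le_trans (inv_eigenvalue_le k).
    by rewrite lef_pV2 ?posrE ?mulr_gt0// ler_peMl ?(ltW (lam0 k))// ler1n.
  - by move=> k; under eq_integral do rewrite expr0n/=; rewrite integral0 lee_fin.
  - by move=> w; exact: drift_weakly_measurable.
  - by move=> w v; under eq_fun do rewrite L2_dot0l; exact: measurable_cst.
  - apply: filterS uE => w uE k; have [_ ->] := uE k.
    have -> : (\int[leb]_r (0 * L2_dot (0 : H) (e k)))%R = 0.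
      by rewrite mul0r /Rintegral integral0.
    by rewrite addr0.
rewrite lee_fin /energy_const; clear H.
have e1 : 1 <= expR (growth_rate * t) by rewrite -expR0 ler_expR mulr_ge0// ltW.
have f0 : 0 <= tT * (2 * `|f 0| ^+ 2) by rewrite !mulr_ge0 ?sqr_ge0 ?(ltW hT).
have h1 : tT * (2 * `|f 0| ^+ 2 * t) <= tT * (2 * `|f 0| ^+ 2 * tT).
  by rewrite !mulrA ler_wpM2l// -!mulrA.
have h2 : 4 * (tT * (2 * Lf ^+ 2 * (N * expR (growth_rate * t) / growth_rate))) <=
    N / 2 * expR (growth_rate * t).
  have -> : 4 * (tT * (2 * Lf ^+ 2 * (N * expR (growth_rate * t) / growth_rate))) =
    (8 * tT * Lf ^+ 2 / growth_rate) * (N * expR (growth_rate * t)) by ring.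
  have -> : N / 2 * expR (growth_rate * t) = 2^-1 * (N * expR (growth_rate * t)) by ring.
  rewrite ler_wpM2r ?mulr_ge0 ?expR_ge0// ler_pdivrMr// /growth_rate.
  by rewrite mulrDr; set z := Lf ^+ 2; lra.
have h3 := energy_const_ge0; move: h3; rewrite /energy_const.
move: h1 h2 e1; set A := l0 `^ (- beta) * E0; set D := tT * (2 * _ * t).
set D' := tT * (2 * _ * tT); set X := expR _; set B := 4 * m2 * _ * nQ.
set Y := tT * (2 * Lf ^+ 2 * _) => h1 h2 e1 h3.
rewrite (mulrDr tT) -/D -/Y mul1r addr0 [leRHS]mulrDl.
have : 4 * (A + D' + B) <= 4 * (A + D' + B) * X by rewrite ler_peMr.
by lra.
Qed.

(** Twice [energy_const] is the fixed point of N -> energy_const + N/2; the 1 is what may remain of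
    the starting value when the iteration stops. *)
Definition energy_bound : R := (2 * energy_const + 1) * expR (growth_rate * tT).

Lemma mean_sq_solution_le t : 0 <= t <= tT -> (mean_sq P (u t) <= energy_bound%:E)%E.
Proof.
move=> tin.
(* [M] depends on the solution; it starts the iteration and must not reach the bound. *)
have [M M0 uM] : exists2 M : R, 0 <= M & forall r, 0 <= r <= tT -> (mean_sq P (u r) <= M%:E)%E.
  have := mild_bounded hu; set s := ereal_sup _ => sy.
  have us r : 0 <= r <= tT -> (mean_sq P (u r) <= s)%E.
    by move=> rin; apply: ereal_sup_ubound; exists r => //=; rewrite in_itv.
  have s0 : (0 <= s)%E.
    apply: le_trans (us t tin); apply: integral_ge0 => w _; rewrite lee_fin sqr_ge0//.
  exists (fine s); first exact: fine_ge0.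
  by move=> r /us; rewrite fineK// ge0_fin_numE.
have step n : forall r, 0 <= r <= tT ->
    (mean_sq P (u r) <= ((2 * energy_const + M / 2 ^+ n) * expR (growth_rate * r))%:E)%E.
  elim: n => [|n IH].
    move=> r rin; apply: le_trans (uM r rin) _; rewrite lee_fin expr0 divr1.
    have /andP[r0 _] := rin.
    have e1 : 1 <= expR (growth_rate * r).
      by rewrite -expR0 ler_expR mulr_ge0 ?(ltW growth_rate_gt0).
    apply: (@le_trans _ _ (2 * energy_const + M)).
      by rewrite lerDr mulr_ge0 ?energy_const_ge0.
    by rewrite ler_peMr//; have := energy_const_ge0; lra.
  have N0 : 0 <= 2 * energy_const + M / 2 ^+ n.
    have : 0 <= M / 2 ^+ n by rewrite divr_ge0 ?exprn_ge0.
    by have := energy_const_ge0; lra.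
  move=> r rin; apply: le_trans (weighted_bound_step N0 IH rin) _.
  rewrite lee_fin ler_wpM2r ?expR_ge0// exprS invfM.
  set y := (2 ^+ n)^-1; lra.
(* Enough steps for M <= n <= 2^n. *)
pose n := (Num.truncn M).+1.
apply: le_trans (step n t tin) _; rewrite lee_fin /energy_bound.
have /andP[t0 tT'] := tin.
apply: ler_pM.
- have : 0 <= M / 2 ^+ n by rewrite divr_ge0 ?exprn_ge0.
  by have := energy_const_ge0; lra.
- exact: expR_ge0.
- rewrite lerD2l ler_pdivrMr ?exprn_gt0// mul1r; apply: (@le_trans _ _ n%:R).
    by apply/ltW/truncnS_gt.
  by rewrite -natrX ler_nat ltnW// ltn_expl.
- by rewrite ler_expR ler_wpM2l ?(ltW growth_rate_gt0).
Qed.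

Lemma energy_bound_const_ge0 : 0 <= energy_bound.
Proof.
have := energy_const_ge0; rewrite /energy_bound => h.
by rewrite mulr_ge0 ?expR_ge0//; lra.
Qed.

Definition drift_const : R := 2 * `|f 0| ^+ 2 * tT + 2 * Lf ^+ 2 * (energy_bound * expR tT).

Lemma drift_const_ge0 : 0 <= drift_const.
Proof.
have T0 := ltW hT; apply: addr_ge0; first by rewrite !mulr_ge0 ?sqr_ge0.
apply: mulr_ge0; first by rewrite mulr_ge0 ?sqr_ge0.
apply: mulr_ge0; [exact: energy_bound_const_ge0|exact: expR_ge0].
Qed.

Lemma solution_drift_bound t : 0 <= t <= tT ->
  integral_bound P (fun w => \int[leb]_r (`|drift t r w| ^+ 2)%:E)%E drift_const.
Proof.
move=> tin; have /andP[t0 tT'] := tin.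
(* The constant bound is used with the weight of rate 1, whence [expR tT] in [drift_const]. *)
apply: (integral_bound_le_cst (drift_bound energy_bound_const_ge0 (@ltr01 R) tin _)).
  move=> r /andP[r0 rt].
  apply: le_trans (mean_sq_solution_le _) _; first by rewrite r0 (le_trans rt).
  by rewrite lee_fin mul1r ler_peMr ?energy_bound_const_ge0// -expR0 ler_expR.
rewrite divr1 mul1r /drift_const lerD//; first by rewrite ler_wpM2l// mulr_ge0 ?sqr_ge0.
rewrite ler_wpM2l ?mulr_ge0 ?sqr_ge0// ler_wpM2l ?energy_bound_const_ge0//.
by rewrite ler_expR.
Qed.

Definition regularity_const : R :=
  4 * (E0 + 2 * tT `^ (1 - beta) * drift_const + 4 * m2 * 2 * nQ).

Lemma regularity_const_ge0 : 0 <= regularity_const.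
Proof.
by rewrite mulr_ge0// !addr_ge0 ?mulr_ge0 ?powR_ge0 ?energy_bound_ge0 ?drift_const_ge0.
Qed.

Lemma step_le_powR h : 0 < h -> h <= tT -> h <= tT `^ (1 - beta) * h `^ beta.
Proof.
move=> h0 hle; have /andP[b0 b1] := hbeta.
rewrite -{1}[h]powRr1 ?(ltW h0)// -{1}(subrK beta 1) powRD; last by rewrite implybE (gt_eqF h0) orbT.
rewrite ler_wpM2r ?powR_ge0// ge0_ler_powR ?nnegrE ?subr_ge0 ?(ltW b1) ?(ltW h0) ?(ltW hT)//.
Qed.

Lemma min_inv_le_powR k h : 0 < h -> Num.min h (lam k)^-1 <= h `^ beta * lam k `^ (beta - 1).
Proof.
move=> h0; have /andP[b0 b1] := hbeta.
apply: interpolation_le => //; rewrite ?b0 ?(ltW b1)//.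
- by rewrite le_min (ltW h0) invr_ge0 ltW.
- by rewrite ge_min lexx.
- by rewrite ge_min lexx orbT.
Qed.

(** Initial value and noise limit the order to beta. The drift contributes order h, which
    [step_le_powR] lowers to h^beta at the price of a power of T. *)
Lemma time_regularity s t h : 0 <= s -> s <= t -> t <= tT -> t - s <= h -> 0 < h -> h <= tT ->
  integral_bound P (fun w => (`|u t w - u s w| ^+ 2)%:E) (regularity_const * h `^ beta).
Proof.
move=> s0 st tT' tsh h0 hle; have t0 := le_trans s0 st; have sT := le_trans st tT'.
have /andP[b0 b1] := hbeta.
have [Zt Ztk utE] := @mild_coord t t ltac:(by rewrite t0 lexx) tT'.
have [Zs Zsk usE] := @mild_coord s t ltac:(by rewrite s0 st) tT'.
have dG := @solution_drift_bound t ltac:(by rewrite t0).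
have Xk k : wiener_integral P tT Qh W (fun w => L2_dot (Zt w) (e k) - L2_dot (Zs w) (e k))
    (fun r => (ou_kernel (lam k) t r - ou_kernel (lam k) s r) *: Qh (e k)).
  have := wiener_integralB hF hQ hQh hW eb (Ztk k) (Zsk k); congr wiener_integral.
  by apply/funext => r; rewrite scalerBl.
have := coord_bound (c1 := h `^ beta) (c2 := 2 * h) (c2' := 1) (c3 := 2 * h `^ beta)
  (ini := fun k => expR (- (lam k * t)) - expR (- (lam k * s)))
  (ker' := fun _ _ => 0) (V := fun w => u t w - u s w) _ _ _ _ _ _ _ _ _ _ _ _ dG zero_drift_bound Xk.
have h20 : 0 < 2 * h by rewrite mulr_gt0.
have hb0 : 0 <= 2 * h `^ beta by rewrite mulr_ge0 ?powR_ge0.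
move=> /(_ (powR_ge0 _ _) h20 ltr01 hb0) H.
apply: (integral_bound_le_cst (H _ _ _ _ _ _ _ _ _)).
- move=> k; have lts0 : 0 <= lam k * (t - s) by rewrite mulr_ge0 ?subr_ge0// ltW.
  have lh0 : 0 < lam k * h by rewrite mulr_gt0.
  (* The difference factors into exp(-lam s) <= 1 and 1 - exp(-lam (t - s)), which is at most 1 and
     at most lam h; its square is then at most (lam h)^beta. *)
  rewrite (_ : expR _ - _ = - (expR (- (lam k * s)) * (1 - expR (- (lam k * (t - s)))))); last first.
    by rewrite mulrBr mulr1 -expRD opprB; congr (expR _ - _); ring.
  have /andP[x0 xle] := oneB_expRN_le lts0.
  have : Num.min 1 ((lam k * h) ^+ 2) <= (lam k * h) `^ beta.
    by apply: min1_sqr_le_powR => //; rewrite b0 (le_trans (ltW b1))// ler1n.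
  rewrite mulrC powRM ?(ltW (lam0 k)) ?(ltW h0)// => hh.
  rewrite sqrrN; apply: le_trans hh.
  have E0' : 0 <= expR (- (lam k * s)) <= 1.
    by rewrite expR_ge0 expR_le1 oppr_le0 mulr_ge0// ltW.
  rewrite le_min; move: xle; rewrite le_min => /andP[x1 xl].
  have xlh : 1 - expR (- (lam k * (t - s))) <= lam k * h.
    by apply: le_trans xl _; rewrite ler_wpM2l// ltW.
  have /andP[e0 e1] := E0'.
  rewrite expr_le1 ?mulr_ge0// mulr_ile1//= lerXn2r ?nnegrE ?mulr_ge0 ?(ltW (lam0 k)) ?(ltW h0)//.
  by rewrite [leLHS]mulrC (mulrC h) -[leRHS]mulr1 ler_pM.
- by move=> k; apply: measurable_funB; exact: measurable_ou_kernel.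
- by move=> k; exact: measurable_cst.
- move=> k; apply: le_trans (ou_kernel_increment (lam0 k) s0 st tsh) _.
  by rewrite lee_fin ler_wpM2l// ge_min lexx.
- move=> k; apply: le_trans (ou_kernel_increment (lam0 k) s0 st tsh) _.
  by rewrite lee_fin -mulrA ler_wpM2l// min_inv_le_powR.
- by move=> k; under eq_integral do rewrite expr0n/=; rewrite integral0 lee_fin.
- by move=> w; exact: drift_weakly_measurable.
- by move=> w v; under eq_fun do rewrite L2_dot0l; exact: measurable_cst.
- apply: filterS2 utE usE => w tE sE k; have [it tk] := tE k; have [is_ sk] := sE k.
  rewrite L2_dotBl tk sk mul0r /Rintegral integral0 addr0 -!/(Rintegral _ _ _).
  have -> : (\int[leb]_r ((ou_kernel (lam k) t r - ou_kernel (lam k) s r) * L2_dot (drift t r w) (e k)))%R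
    = (\int[leb]_r (ou_kernel (lam k) t r * L2_dot (drift t r w) (e k)))%R -
      (\int[leb]_r (ou_kernel (lam k) s r * L2_dot (drift t r w) (e k)))%R.
    by rewrite -RintegralB//; apply: eq_Rintegral => r _; rewrite mulrBl.
  ring.
rewrite /regularity_const.
have := step_le_powR h0 hle; set y := h `^ beta => hy.
have : 2 * h * drift_const <= 2 * tT `^ (1 - beta) * drift_const * y.
  rewrite -mulrA -!(mulrA 2) ler_wpM2l// mulrAC ler_wpM2r ?drift_const_ge0//.
clear H; set z := 2 * h * _; set z' := 2 * _ * drift_const => hz.
rewrite mulr0 addr0.
have -> : 4 * (E0 + z' + 4 * m2 * 2 * nQ) * y =
    4 * (y * E0 + z' * y + 4 * m2 * (2 * y) * nQ) by ring.
by rewrite ler_wpM2l// lerD2r lerD2l.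
Qed.

(** * The Euler scheme *)

Section scheme.
Variables (A : H -> H -> Prop) (tau : R) (un : nat -> Om -> H).
Hypotheses (Ae : forall k, A (e k) (lam k *: e k)) (tau0 : 0 < tau)
  (hun : backward_euler P tT W A f u0 tau un).

(** With f(u^(i+1)) regarded as given, the recursion is linear and can be unrolled in each mode.
    Whatever enters on cell i passes n - i resolvents, which fixes the exponents. *)
Lemma scheme_coord Rs : (forall v k, L2_dot (Rs v) (e k) = euler_factor (lam k) tau * L2_dot v (e k)) ->
  (forall n, n.+1%:R * tau <= tT -> exists2 Y,
     apply_cylindrical P Rs (increment W (n%:R * tau) (n.+1%:R * tau)) Y &
     {ae P, forall w, un n.+1 w = Rs (un n w + tau *: f (un n.+1 w)) + Y w}) ->
  forall n, n%:R * tau <= tT -> {ae P, forall w, forall k,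
    L2_dot (un n w) (e k) = euler_factor (lam k) tau ^+ n * L2_dot (u0 w) (e k) +
      \sum_(i < n) tau * (euler_factor (lam k) tau ^+ (n - i) * L2_dot (f (un i.+1 w)) (e k)) +
      \sum_(i < n) euler_factor (lam k) tau ^+ (n - i) *
        increment W (i%:R * tau) (i.+1%:R * tau) (e k) w}.
Proof.
move=> Rse step; have [_ un0 _] := hun.
elim=> [|n IH] nT.
  by apply: filterS un0 => w -> k; rewrite !big_ord0 !addr0 expr0 mul1r.
have nT' : n%:R * tau <= tT.
  by apply: le_trans nT; rewrite ler_wpM2r ?(ltW tau0)// ler_nat.
have [Y [_ [Bs BsE YE]] unE] := step n nT.
have incE k : {ae P, forall w, L2_dot (Y w) (e k) =
    euler_factor (lam k) tau * increment W (n%:R * tau) (n.+1%:R * tau) (e k) w}.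
  (* Split so that linearity of increments applies in its form a h + g with h = g = e_k. *)
  have rk : Bs (e k) = (euler_factor (lam k) tau - 1) *: e k + e k.
    by rewrite (diagonal_adjoint eb Rse BsE) scalerBl scale1r subrK.
  have nt0 : 0 <= n%:R * tau by rewrite mulr_ge0// ltW.
  have ntn : n%:R * tau <= n.+1%:R * tau by rewrite ler_wpM2r ?(ltW tau0)// ler_nat.
  have := increment_linear hW (euler_factor (lam k) tau - 1) (e k) (e k) nt0 ntn nT.
  by apply: filterS2 (YE (e k)) => w -> ; rewrite rk => ->; ring.
have {}incE : {ae P, forall w, forall k, L2_dot (Y w) (e k) =
    euler_factor (lam k) tau * increment W (n%:R * tau) (n.+1%:R * tau) (e k) w}.
  exact: ae_foralln.
apply: filterS3 (IH nT') unE incE => w IHw unw incw k.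
rewrite unw L2_dotDl incw Rse L2_dotDl L2_dotZl IHw !big_ord_recr/= subSnn expr1.
have exprE i : (i < n)%N -> euler_factor (lam k) tau ^+ (n.+1 - i) =
    euler_factor (lam k) tau * euler_factor (lam k) tau ^+ (n - i).
  by move=> ni; rewrite subSn ?exprS// ltnW.
have -> : \sum_(i < n) tau * (euler_factor (lam k) tau ^+ (n.+1 - i) * L2_dot (f (un i.+1 w)) (e k)) =
    euler_factor (lam k) tau *
    \sum_(i < n) tau * (euler_factor (lam k) tau ^+ (n - i) * L2_dot (f (un i.+1 w)) (e k)).
  by rewrite mulr_sumr; apply: eq_bigr => i _; rewrite exprE//; ring.
have -> : \sum_(i < n) euler_factor (lam k) tau ^+ (n.+1 - i) *
      increment W (i%:R * tau) (i.+1%:R * tau) (e k) w =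
    euler_factor (lam k) tau *
    \sum_(i < n) euler_factor (lam k) tau ^+ (n - i) *
      increment W (i%:R * tau) (i.+1%:R * tau) (e k) w.
  by rewrite mulr_sumr; apply: eq_bigr => i _; rewrite exprE//; ring.
rewrite exprS; ring.
Qed.

Lemma scheme_noise n k : n%:R * tau <= tT ->
  wiener_integral P tT Qh W
    (fun w => \sum_(i < n) euler_factor (lam k) tau ^+ (n - i) *
        increment W (i%:R * tau) (i.+1%:R * tau) (e k) w)
    (fun r => euler_kernel (lam k) tau n r *: Qh (e k)).
Proof.
move=> nT.
have el : elementary tT Qh W
    (fun w => \sum_(i < n) euler_factor (lam k) tau ^+ (n - i) *
        increment W (i%:R * tau) (i.+1%:R * tau) (e k) w)
    (fun r => euler_kernel (lam k) tau n r *: Qh (e k)).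
  have := elementary_sum (n := n) (X := fun i w => euler_factor (lam k) tau ^+ (n - i) *
        increment W (i%:R * tau) (i.+1%:R * tau) (e k) w)
    (g := fun i r => (euler_factor (lam k) tau ^+ (n - i) *
       \1_(`](i%:R * tau), (i.+1%:R * tau)]) r) *: Qh (e k)) (tT := tT) (W := W) (Qh := Qh).
  rewrite (_ : (fun r => \sum_(i < n) _) = (fun r => euler_kernel (lam k) tau n r *: Qh (e k))).
    apply=> i ni; apply: elementary_increment.
    - by rewrite mulr_ge0// ltW.
    - by rewrite ler_wpM2r ?(ltW tau0)// ler_nat.
    - by apply: le_trans nT; rewrite ler_wpM2r ?(ltW tau0)// ler_nat.
  by apply/funext => r; rewrite /euler_kernel scaler_suml.
have [mX _ _] := elementary_facts hF hQ hQh hW el.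
by apply: (elementary_wiener_integral hF hQ hQh hW el mX); exact: ae_eq_refl.
Qed.

(** On cell i this is f(u(r)) - f(u(t_(i+1))): the error of freezing the exact drift at the endpoint
    that the implicit scheme uses. *)
Definition drift_defect n r w : H :=
  drift (n%:R * tau) r w - \sum_(i < n) (\1_(cell tau i) r : R) *: f (u (i.+1%:R * tau) w).

Lemma drift_defect_dot n r w v : L2_dot (drift_defect n r w) v =
  L2_dot (drift (n%:R * tau) r w) v -
  \sum_(i < n) L2_dot (f (u (i.+1%:R * tau) w)) v * \1_(cell tau i) r.
Proof.
rewrite L2_dotBl L2_dot_suml; congr (_ - _); apply: eq_bigr => i _.
by rewrite L2_dotZl mulrC.
Qed.

Lemma grid_time n i : n%:R * tau <= tT -> (i <= n)%N -> 0 <= i%:R * tau <= tT.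
Proof.
move=> nT ni; rewrite mulr_ge0 ?(ltW tau0)//=.
by apply: le_trans nT; rewrite ler_wpM2r ?(ltW tau0)// ler_nat.
Qed.

Lemma measurable_drift_defect_dot n v : n%:R * tau <= tT ->
  measurable_fun setT (fun p : measurableTypeR R * Om => L2_dot (drift_defect n p.1 p.2) v).
Proof.
move=> nT; under eq_fun do rewrite drift_defect_dot.
apply: measurable_funB; first exact: measurable_drift_dot.
apply: measurable_sum => i; apply: measurable_funM.
  have tin := grid_time nT (ltn_ord i).
  have := measurable_wrt_comp (solution_measurable tin) (@f_dot_continuous v).
  by move=> m; apply: (measurableT_comp m); exact: measurable_snd.
have m := @measurable_indic _ (measurableTypeR R) R setT _ (@measurable_cell R tau i).
by apply: (measurableT_comp m); exact: measurable_fst.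
Qed.

Lemma drift_defect_weakly_measurable n w : n%:R * tau <= tT ->
  weakly_measurable ((drift_defect n)^~ w).
Proof.
by move=> nT v; exact: (measurable_section w (measurable_drift_defect_dot v nT)).
Qed.

Lemma drift_defect_bound n : n%:R * tau <= tT ->
  integral_bound P (fun w => \int[leb]_r (`|drift_defect n r w| ^+ 2)%:E)%E
    (Lf ^+ 2 * (regularity_const * tau `^ beta) * tT).
Proof.
(* [time_regularity] requires tau <= T, which n tau <= T yields only for n > 0. *)
move=> nT; have [n0|n_gt0] := posnP n.
  have zE : (fun w => \int[leb]_r (`|drift_defect n r w| ^+ 2)%:E)%E =
      (fun w => \int[leb]_r (`|(fun _ _ => 0 : H) r w| ^+ 2)%:E)%E.
    apply/funext => w; apply: eq_integral => r _; rewrite n0 /drift_defect big_ord0 subr0.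
    by rewrite mul0r /drift; case: ifP => // /andP[/lt_le_trans h /h]; rewrite ltxx.
  rewrite zE; apply: integral_bound_le_cst zero_drift_bound _.
  exact: (mulr_ge0 (mulr_ge0 (sqr_ge0 _) (mulr_ge0 regularity_const_ge0 (powR_ge0 _ _))) (ltW hT)).
have tauT : tau <= tT by apply: le_trans nT; rewrite ler_peMl ?(ltW tau0)// ler1n.
pose c := Lf ^+ 2 * (regularity_const * tau `^ beta).
have c0 : 0 <= c := mulr_ge0 (sqr_ge0 _) (mulr_ge0 regularity_const_ge0 (powR_ge0 _ _)).
apply: (tonelli_bound (th := fun p : measurableTypeR R * Om => (`|drift_defect n p.1 p.2| ^+ 2)%:E)
   (kap := fun r => (\sum_(j < n) c * \1_(cell tau j) r)%:E)).
- under eq_fun do rewrite -(parseval eb).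
  apply: ge0_emeasurable_sum => [k r _ _|k _]; first by rewrite lee_fin sqr_ge0.
  by apply/measurable_EFinP/measurable_funX; exact: measurable_drift_defect_dot.
- by move=> p; rewrite lee_fin sqr_ge0.
- move=> r /=; have [rin|rout] := boolP (0 < r <= n%:R * tau); last first.
    have sE w : drift_defect n r w = 0.
      apply: (onb_ext eb) => k; rewrite drift_defect_dot.
      rewrite (sum_cell0 (fun i => L2_dot (f (u (i.+1%:R * tau) w)) (e k)) tau0 rout) subr0 /drift.
      by rewrite (negbTE rout) L2_dot0l.
    under eq_integral do rewrite sE normr0 expr0n/=.
    by rewrite integral0 lee_fin (sum_cell0 (fun=> c) tau0 rout).
  have /andP[r0 rn] := rin; have [i ni ci] := cell_exists tau0 r0 rn.
  have sE w : drift_defect n r w = f (u r w) - f (u (i.+1%:R * tau) w).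
    apply: (onb_ext eb) => k; rewrite drift_defect_dot.
    rewrite (sum_cell (fun i => L2_dot (f (u (i.+1%:R * tau) w)) (e k)) tau0 ni ci).
    by rewrite /drift rin L2_dotBl.
  rewrite (sum_cell (fun=> c) tau0 ni ci).
  have /andP[ri0 ri1] : i%:R * tau < r <= i.+1%:R * tau by move: ci; rewrite /cell/= in_itv.
  have /andP[_ iT] := grid_time nT ni.
  have lst : i.+1%:R * tau - r <= tau.
    by rewrite -natr1 mulrDl mul1r; move: ri0; set z := i%:R * tau; lra.
  have reg := time_regularity (ltW r0) ri1 iT lst tau0 tauT.
  apply: (@le_trans _ _ (\int[P]_w ((Lf ^+ 2)%:E * (`|u (i.+1%:R * tau) w - u r w| ^+ 2)%:E))%E).
    apply: ge0_le_integral_nonmeas => w _; first by rewrite lee_fin sqr_ge0.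
    rewrite sE -EFinM lee_fin -exprMn lerXn2r ?nnegrE ?mulr_ge0//.
    by rewrite distrC; exact: hf.
  apply: integral_bound_integral; first by move=> w; rewrite mule_ge0// lee_fin sqr_ge0.
  exact: (integral_boundZ (sqr_ge0 Lf) reg).
- rewrite (@integral_cells _ _ _ (fun=> c))// lee_fin sumr_const card_ord -mulr_natr.
  rewrite -/c (_ : tau * (c * n%:R) = c * (n%:R * tau)); last by ring.
  exact: ler_wpM2l.
Qed.

Definition truncation_const : R :=
  4 * (E0 + tT `^ (1 - beta) * drift_const +
       tT * (Lf ^+ 2 * regularity_const * tT) + 4 * m2 * 2 * nQ).

(** The error with its feedback through [f] removed. The values f(u^(i+1)) cancel from its
    coordinates, so only exact quantities and noise remain to be estimated. *)
Definition truncation_error (Rs : H -> H) n w : H :=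
  u (n%:R * tau) w - un n w -
  \sum_(i < n) tau *: iter (n - i) Rs (f (u (i.+1%:R * tau) w) - f (un i.+1 w)).

Lemma iter_coord Rs (b : nat -> R) : (forall v k, L2_dot (Rs v) (e k) = b k * L2_dot v (e k)) ->
  forall m v k, L2_dot (iter m Rs v) (e k) = b k ^+ m * L2_dot v (e k).
Proof.
move=> Rse; elim=> [|m IH] v k; first by rewrite expr0 mul1r.
by rewrite iterS Rse IH exprS mulrA.
Qed.

Lemma euler_kernel_sqr_le k n : n%:R * tau <= tT ->
  (\int[leb]_r (euler_kernel (lam k) tau n r ^+ 2)%:E <= tT%:E)%E.
Proof.
move=> nT.
apply: (@le_trans _ _ (\int[leb]_r (\sum_(j < n) 1 * \1_(cell tau j) r)%:E)%E).
  apply: ge0_le_integral_nonmeas => r _; rewrite lee_fin ?sqr_ge0//.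
  have [rin|rout] := boolP (0 < r <= n%:R * tau); last first.
    rewrite /euler_kernel (sum_cell0 (fun i => euler_factor (lam k) tau ^+ (n - i)) tau0 rout).
    by rewrite (sum_cell0 (fun=> 1) tau0 rout) expr0n.
  have /andP[r0 rn] := rin; have [i ni ci] := cell_exists tau0 r0 rn.
  rewrite (sum_cell (fun=> 1) tau0 ni ci).
  have /andP[g0 g1] := euler_kernel_le1 (lam0 k) tau0 n r.
  by rewrite expr_le1.
rewrite (@integral_cells _ _ _ (fun=> 1))// lee_fin sumr_const card_ord mulrC.
exact: nT.
Qed.

Lemma truncation_bound Rs n :
  (forall v k, L2_dot (Rs v) (e k) = euler_factor (lam k) tau * L2_dot v (e k)) ->
  (forall n, n.+1%:R * tau <= tT -> exists2 Y,
     apply_cylindrical P Rs (increment W (n%:R * tau) (n.+1%:R * tau)) Y &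
     {ae P, forall w, un n.+1 w = Rs (un n w + tau *: f (un n.+1 w)) + Y w}) ->
  n%:R * tau <= tT ->
  integral_bound P (fun w => (`|truncation_error Rs n w| ^+ 2)%:E)
    (truncation_const * tau `^ beta).
Proof.
move=> Rse step nT; have /andP[b0 b1] := hbeta.
set t := n%:R * tau; have t0 : 0 <= t by rewrite mulr_ge0// ltW.
have [Z Zk uE] := @mild_coord t t ltac:(by rewrite t0 lexx) nT.
have unE := scheme_coord Rse step nT.
have dG := @solution_drift_bound t ltac:(by rewrite t0).
pose N k w := \sum_(i < n) euler_factor (lam k) tau ^+ (n - i) *
        increment W (i%:R * tau) (i.+1%:R * tau) (e k) w.
have Xk k : wiener_integral P tT Qh W (fun w => L2_dot (Z w) (e k) - N k w)
    (fun r => (ou_kernel (lam k) t r - euler_kernel (lam k) tau n r) *: Qh (e k)).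
  have := wiener_integralB hF hQ hQh hW eb (Zk k) (scheme_noise k nT); congr wiener_integral.
  by apply/funext => r; rewrite scalerBl.
have := coord_bound (c1 := tau `^ beta) (c2 := Num.min tau tT) (c2' := tT) (c3 := 2 * tau `^ beta)
  (ini := fun k => expR (- (lam k * t)) - euler_factor (lam k) tau ^+ n)
  (ker' := fun k => euler_kernel (lam k) tau n) (V := truncation_error Rs n)
  _ _ _ _ _ _ _ _ _ _ _ _ dG (drift_defect_bound nT) Xk.
(* For n = 0 the step may exceed T, and [tau] itself would not be bounded by T^(1-beta) tau^beta;
   the kernel difference is zero then, so the minimum is a valid bound in all cases. *)
have min0 : 0 < Num.min tau tT by rewrite lt_min tau0.
have hb0 : 0 <= 2 * tau `^ beta by rewrite mulr_ge0 ?powR_ge0.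
move=> /(_ (powR_ge0 _ _) min0 hT hb0) H.
apply: (integral_bound_le_cst (H _ _ _ _ _ _ _ _ _)).
- move=> k; apply: le_trans (euler_initial_error (lam0 k) tau0 n) _.
  rewrite -powRM ?(ltW tau0) ?(ltW (lam0 k))//.
  by apply: min1_sqr_le_powR; rewrite ?mulr_gt0// b0 (le_trans (ltW b1))// ler1n.
- by move=> k; apply: measurable_funB; [exact: measurable_ou_kernel|exact: measurable_euler_kernel].
- by move=> k; exact: measurable_euler_kernel.
- move=> k; have [n0|n_gt0] := posnP n.
    have z r : ou_kernel (lam k) t r - euler_kernel (lam k) tau n r = 0.
      by rewrite /t n0 mul0r /euler_kernel big_ord0 /ou_kernel set_itvoc0 indic0 mul0r subr0.
    by under eq_integral do rewrite z expr0n/=; rewrite integral0 lee_fin ltW.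
  apply: le_trans (kernel_diff_le_tau (lam0 k) tau0 n) _.
  rewrite lee_fin le_min lexx/=.
  by apply: le_trans nT; rewrite ler_peMl ?(ltW tau0)// ler1n.
- move=> k; have h1 := kernel_diff_le_tau (lam0 k) tau0 n.
  have h2 := kernel_diff_le_inv n (lam0 k) tau0.
  apply: (@le_trans _ _ (2 * Num.min tau (lam k)^-1)%:E).
    rewrite minr_pMr// EFin_min le_min h2 andbT; apply: le_trans h1 _.
    by rewrite lee_fin ler_peMl ?(ltW tau0)// ler1n.
  by rewrite lee_fin -mulrA ler_wpM2l// min_inv_le_powR.
- by move=> k; exact: euler_kernel_sqr_le.
- by move=> w; exact: drift_weakly_measurable.
- by move=> w; exact: drift_defect_weakly_measurable.
- apply: filterS2 uE unE => w uwE unwE k; have [ik uk] := uwE k.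
  rewrite /truncation_error !L2_dotBl -/t uk unwE L2_dot_suml.
  pose c i := L2_dot (f (u (i.+1%:R * tau) w)) (e k).
  have sE : \sum_(i < n) L2_dot (tau *: iter (n - i) Rs (f (u (i.+1%:R * tau) w) - f (un i.+1 w))) (e k)
     = \sum_(i < n) tau * (euler_factor (lam k) tau ^+ (n - i) * c i) -
       \sum_(i < n) tau * (euler_factor (lam k) tau ^+ (n - i) * L2_dot (f (un i.+1 w)) (e k)).
    rewrite -sumrB; apply: eq_bigr => i _.
    by rewrite L2_dotZl (iter_coord Rse) L2_dotBl /c; ring.
  rewrite sE.
  (* The grid values in the defect get the same exponents as the sum subtracted in
     [truncation_error], so the two decompositions agree. *)
  have dd r : euler_kernel (lam k) tau n r * L2_dot (drift_defect n r w) (e k) =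
      euler_kernel (lam k) tau n r * L2_dot (drift t r w) (e k) -
      \sum_(i < n) euler_factor (lam k) tau ^+ (n - i) * c i * \1_(cell tau i) r.
    rewrite drift_defect_dot mulrBr; congr (_ - _).
    have [rin|rout] := boolP (0 < r <= n%:R * tau); last first.
      by rewrite (sum_cell0 c tau0 rout) mulr0 (sum_cell0 (fun i => euler_factor (lam k) tau ^+ (n - i) * c i) tau0 rout).
    have /andP[r0 rn] := rin; have [i ni ci] := cell_exists tau0 r0 rn.
    rewrite (sum_cell c tau0 ni ci) (sum_cell (fun i => euler_factor (lam k) tau ^+ (n - i) * c i) tau0 ni ci).
    by rewrite (euler_kernel_cell _ tau0 ni ci).
  have [icell Icell] := Rintegral_cells n (fun i => euler_factor (lam k) tau ^+ (n - i) * c i) tau0.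
  have ig : leb.-integrable setT (EFin \o (fun r => euler_kernel (lam k) tau n r * L2_dot (drift t r w) (e k))).
    have mg : measurable_fun setT (fun r => euler_kernel (lam k) tau n r * L2_dot (drift t r w) (e k)).
      by apply: measurable_funM; [exact: measurable_euler_kernel|exact: drift_weakly_measurable].
    (* Integrability is known against the semigroup kernel. On ]0, t] the Euler kernel is at most 1,
       hence at most exp(lam_k t) times that kernel. *)
    have := integrableZl_EFin (expR (lam k * t)) ik.
    apply: (@le_integrable _ (measurableTypeR R) R leb) => //.
      by apply/measurable_EFinP.
    move=> r _; rewrite /= lee_fin mulrA !normrM ler_wpM2r//.
    have /andP[g0 g1] := euler_kernel_le1 (lam0 k) tau0 n r.
    have [rin|rout] := boolP (0 < r <= t); last first.
      by rewrite /euler_kernel (sum_cell0 (fun i => euler_factor (lam k) tau ^+ (n - i)) tau0 rout) normr0.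
    rewrite (ger0_norm g0); apply: le_trans g1 _.
    have /andP[r0 rt] := rin.
    rewrite /ou_kernel indicE mem_set ?mul1r/=; last by rewrite in_itv.
    rewrite normr1 mul1r !(ger0_norm (expR_ge0 _)) -expRD -expR0 ler_expR.
    have -> : lam k * t - lam k * (t - r) = lam k * r by ring.
    by rewrite mulr_ge0 ?ltW.
  have -> : (\int[leb]_r (euler_kernel (lam k) tau n r * L2_dot (drift_defect n r w) (e k)))%R =
     (\int[leb]_r (euler_kernel (lam k) tau n r * L2_dot (drift t r w) (e k)))%R -
     \sum_(i < n) tau * (euler_factor (lam k) tau ^+ (n - i) * c i).
    by rewrite -Icell -RintegralB//; apply: eq_Rintegral => r _; exact: dd.
  have -> : (\int[leb]_r ((ou_kernel (lam k) t r - euler_kernel (lam k) tau n r) * L2_dot (drift t r w) (e k)))%R =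
     (\int[leb]_r (ou_kernel (lam k) t r * L2_dot (drift t r w) (e k)))%R -
     (\int[leb]_r (euler_kernel (lam k) tau n r * L2_dot (drift t r w) (e k)))%R.
    by rewrite -RintegralB//; apply: eq_Rintegral => r _; rewrite mulrBl.
  rewrite /N; ring.
clear H; rewrite /truncation_const.
have hmin : Num.min tau tT <= tT `^ (1 - beta) * tau `^ beta.
  have [tauT|tauT] := leP tau tT; first exact: step_le_powR.
  apply: le_trans (step_le_powR hT (lexx _)) _.
  by rewrite ler_wpM2l ?powR_ge0// ge0_ler_powR ?nnegrE ?(ltW hT) ?(ltW tau0)// ltW.
have hd := ler_wpM2r drift_const_ge0 hmin; move: hd.
set y := tau `^ beta; set a := Num.min _ _ * _; set b := tT `^ (1 - beta) * y * _ => hd.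
have -> : 4 * (E0 + tT `^ (1 - beta) * drift_const + tT * (Lf ^+ 2 * regularity_const * tT) +
    4 * m2 * 2 * nQ) * y =
  4 * (y * E0 + b + tT * (Lf ^+ 2 * (regularity_const * y) * tT) + 4 * m2 * (2 * y) * nQ).
  by rewrite /b; ring.
by rewrite ler_wpM2l// !lerD2r lerD2l.
Qed.

Definition error_const : R :=
  2 * truncation_const * (1 + (Lf * tT * expR (2 * (Lf * tT))) ^+ 2).

Lemma truncation_const_ge0 : 0 <= truncation_const.
Proof.
apply: mulr_ge0 => //; rewrite !addr_ge0 ?energy_bound_ge0//.
- exact: (mulr_ge0 (powR_ge0 _ _) drift_const_ge0).
- exact: (mulr_ge0 (ltW hT) (mulr_ge0 (mulr_ge0 (sqr_ge0 _) regularity_const_ge0) (ltW hT))).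
- by rewrite !mulr_ge0.
Qed.

(** Resolvent powers are contractions, so restoring the feedback gives an implicit recursion for the
    norms with q = tau Lf. Cauchy-Schwarz on the Gronwall sum produces the factor n. *)
Lemma pathwise_error Rs n w :
  (forall v k, L2_dot (Rs v) (e k) = euler_factor (lam k) tau * L2_dot v (e k)) ->
  2 * (tau * Lf) <= 1 ->
  n%:R * tau <= tT ->
  `|u (n%:R * tau) w - un n w| ^+ 2 <= 2 * `|truncation_error Rs n w| ^+ 2 +
    2 * (tau * Lf * expR (2 * (Lf * tT))) ^+ 2 * n%:R *
      \sum_(i < n) `|truncation_error Rs i.+1 w| ^+ 2.
Proof.
move=> Rse q1 nT.
pose a i := `|truncation_error Rs i w|; pose x i := `|u (i%:R * tau) w - un i w|.
pose q := tau * Lf; have q0 : 0 <= q by rewrite mulr_ge0// ltW.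
have Rle m v : `|iter m Rs v| <= `|v|.
  rewrite -[leRHS]mul1r; apply: (diagonal_norm_le eb ler01 (iter_coord Rse m)) => k.
  have /andP[r0 r1] := euler_factor_exp_le1 (lam0 k) tau0 m.
  by rewrite ger0_norm.
have xa i : x i <= a i + q * \sum_(j < i) x j.+1.
  rewrite /x -(subrK (\sum_(j < i) tau *: iter (i - j) Rs (f (u (j.+1%:R * tau) w) - f (un j.+1 w)))
    (u (i%:R * tau) w - un i w)).
  apply: le_trans (ler_normD _ _) _; rewrite lerD2l.
  apply: le_trans (ler_norm_sum _ _ _) _; rewrite mulr_sumr; apply: ler_sum => j _.
  rewrite normrZ gtr0_norm// /q -mulrA ler_wpM2l ?(ltW tau0)//.
  by apply: le_trans (Rle _ _) _; exact: hf.
have := implicit_gronwall q0 q1 (N := n) (a := a) (x := x) (fun i _ => normr_ge0 _) (fun i _ => xa i).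
set s := \sum_(i < n) _ => xle.
have s0 : 0 <= s by apply: sumr_ge0 => i _; exact: normr_ge0.
have nLf : q * n%:R <= Lf * tT by rewrite /q mulrAC mulrC ler_wpM2l// mulrC.
have {}xle : x n <= a n + q * expR (2 * (Lf * tT)) * s.
  apply: le_trans xle _; rewrite lerD2l -[leRHS]mulrA ler_wpM2l// ler_wpM2r// ler_expR.
  by rewrite -mulrA ler_wpM2l.
have g0 : 0 <= q * expR (2 * (Lf * tT)) by rewrite mulr_ge0 ?expR_ge0.
set g := q * _ in xle g0 *.
apply: (@le_trans _ _ ((a n + g * s) ^+ 2)).
  have y0 : 0 <= a n + g * s := addr_ge0 (normr_ge0 _) (mulr_ge0 g0 s0).
  by rewrite lerXn2r ?nnegrE ?normr_ge0.
apply: (@le_trans _ _ (2 * a n ^+ 2 + 2 * g ^+ 2 * s ^+ 2)).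
  by have := sqr_ge0 (a n - g * s); nra.
rewrite lerD2l -[leRHS]mulrA.
exact: (ler_wpM2l (mulr_ge0 (ler0n R 2) (sqr_ge0 g)) (sqr_sum_le n (fun i => a i.+1))).
Qed.

(** Two factors n appear, one from Cauchy-Schwarz and one from the number of terms; the tau^2 in the
    squared Gronwall factor pays for both, as n tau <= T. *)
Lemma scheme_error_bound n : 2 * (tau * Lf) <= 1 -> n%:R * tau <= tT ->
  (mean_sq P (fun w => u (n%:R * tau) w - un n w)%R <= (error_const * tau `^ beta)%:E)%E.
Proof.
move=> q1 nT; have [_ _ [Rs RsA step]] := hun.
have Rse := resolvent_coord eb Ae lam0 tau0 RsA.
pose C := truncation_const * tau `^ beta.
have C0 : 0 <= C := mulr_ge0 truncation_const_ge0 (powR_ge0 _ _).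
pose g := tau * Lf * expR (2 * (Lf * tT)).
have tb i : (i <= n)%N -> integral_bound P (fun w => (`|truncation_error Rs i w| ^+ 2)%:E) C.
  by move=> ni; apply: truncation_bound => //; have /andP[] := grid_time nT ni.
apply: (@le_trans _ _ (2 * C + 2 * g ^+ 2 * n%:R * (n%:R * C))%:E).
  apply: integral_bound_integral; first by move=> w; rewrite lee_fin sqr_ge0.
  have sb := integral_bound_sum (n := n) (x := fun i w => (`|truncation_error Rs i.+1 w| ^+ 2)%:E)
    (fun i ni => tb i.+1 ni).
  have g20 : 0 <= 2 * g ^+ 2 * n%:R := mulr_ge0 (mulr_ge0 (ler0n R 2) (sqr_ge0 g)) (ler0n R n).
  have := integral_boundD (integral_boundZ (ler0n R 2) (tb n (leqnn n))) (integral_boundZ g20 sb).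
  move=> h; apply: (integral_bound_le h); apply: nearW => w.
  rewrite sumEFin -!EFinM -EFinD lee_fin; exact: pathwise_error.
rewrite lee_fin /error_const.
have -> : 2 * truncation_const * (1 + (Lf * tT * expR (2 * (Lf * tT))) ^+ 2) * tau `^ beta =
   2 * C + 2 * C * (Lf * tT * expR (2 * (Lf * tT))) ^+ 2 by rewrite /C; ring.
rewrite lerD2l (_ : 2 * g ^+ 2 * n%:R * (n%:R * C) = 2 * C * (n%:R * g) ^+ 2); last by ring.
apply: ler_wpM2l; first exact: (mulr_ge0 (ler0n R 2) C0).
rewrite lerXn2r ?nnegrE ?mulr_ge0 ?expR_ge0 ?(ltW tau0) ?(ltW hT)//.
rewrite /g mulrA ler_wpM2r ?expR_ge0// mulrA mulrC ler_wpM2l//.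
Qed.

End scheme.

End solution.
End spde.

(** * The data hypotheses as bounds on weighted sums *)

Section data.
Context d (T : measurableType d) (R : realType) (mu : {measure set T -> \bar R}).
Local Notation H := (L2 mu).
Variables (e : nat -> H) (lam : nat -> R).
Hypotheses (eb : orthonormal_basis e) (lam0 : forall k, 0 < lam k)
  (lamy : lam @ \oo --> +oo).

Lemma hs_norm_fin (beta : R) (B : H -> H) : beta < 1 ->
  (forall u v, L2_dot (B u) v = L2_dot u (B v)) ->
  (hs_norm e (fun v => power e lam ((beta - 1) / 2) (B v)) < +oo)%E ->
  exists c, (\sum_(k <oo) (lam k `^ (beta - 1) * `|B (e k)| ^+ 2)%:E <= c%:E)%E.
Proof.
move=> b1 Bs hfin.
have fin : (hs_norm_sq e (fun v => power e lam ((beta - 1) / 2) (B v)) < +oo)%E.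
  by apply: (@lty_poweRy _ _ 2^-1) => //; rewrite invr_neq0.
move: fin; rewrite (hs_norm_sq_power eb lam0 lamy _ Bs); last first.
  by rewrite pmulr_lle0 ?invr_gt0// subr_le0 ltW.
rewrite mulrC divfK//; set s := (\sum_(_ <oo) _)%E => sy.
have s0 : (0 <= s)%E.
  by apply: nneseries_ge0 => k _ _; rewrite lee_fin mulr_ge0 ?powR_ge0 ?sqr_ge0.
by exists (fine s); rewrite fineK// ge0_fin_numE.
Qed.

Context d' (Om : measurableType d') (P : probability Om R).

(** The series is measurable and agrees with the squared norm of [power] off the null set where u0
    is outside the domain and [power] has no meaning. *)
Lemma initial_energy_bound (beta : R) (u0 : Om -> H) :
  in_L2_Omega_power P e lam (beta / 2) u0 ->
  exists c, integral_bound P (initial_energy e lam beta u0) c.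
Proof.
move=> [mu0 dom0 fin0]; set pw := fun w => power e lam (beta / 2) (u0 w).
have fin : (mean_sq P pw < +oo)%E.
  by apply: (@lty_poweRy _ _ 2^-1) => //; rewrite invr_neq0.
have s0 : (0 <= mean_sq P pw)%E by apply: integral_ge0 => w _; rewrite lee_fin sqr_ge0.
have t0 w k : (0 <= (lam k `^ beta * L2_dot (u0 w) (e k) ^+ 2)%:E)%E.
  by rewrite lee_fin mulr_ge0 ?powR_ge0 ?sqr_ge0.
have m0 : measurable_fun setT (initial_energy e lam beta u0).
  apply: ge0_emeasurable_sum => // k _; apply/measurable_EFinP/measurable_funM => //.
  by apply: measurable_funX; exact: measurable_wrt_dot.
exists (fine (mean_sq P pw)); apply: integral_bound_measurable => //.
  by move=> w; apply: nneseries_ge0 => k _ _.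
rewrite fineK ?ge0_fin_numE//; have [N [mN N0 NP]] := dom0.
rewrite (ge0_negligible_integral mN)//; last by move=> w _; apply: nneseries_ge0 => k _ _.
rewrite /mean_sq [leLHS]integral_mkcond.
apply: ge0_le_integral_nonmeas => w _; rewrite patchE; case: ifPn => [|_].
- by move=> _; apply: nneseries_ge0 => k _ _.
- by [].
- rewrite inE => -[_ Nw].
  have dw : in_dom_power e lam (beta / 2) (u0 w) by apply: contrapT => h; apply: Nw; exact: NP.
  by rewrite (power_norm eb dw) mulrC divfK.
- by rewrite lee_fin sqr_ge0.
Qed.

End data.

Unset Implicit Arguments.
Set Strict Implicit.
Theorem theorem4p5 (R : realType) (dim : nat) (hdim : (0 < dim <= 3)%N)
  (D : domain R dim)
  (kappa : 'rV[R]_dim -> R) (kappa0 : R)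
  (hkappa : smooth kappa) (hkappa0 : 0 < kappa0)
  (hkappa_lower : forall x, dom D x -> kappa0 < kappa x)
  (e : nat -> L2 (dom_measure D)) (lam : nat -> R)
  (heig : orthonormal_eigenbasis (elliptic_op kappa) e lam)
  (S : R -> L2 (dom_measure D) -> L2 (dom_measure D))
  (hS : semigroup_generated (elliptic_op kappa) S)
  (Q Qhalf : L2 (dom_measure D) -> L2 (dom_measure D))
  (hQ : nonneg_self_adjoint Q) (hQhalf : operator_sqrt Q Qhalf)
  (f : L2 (dom_measure D) -> L2 (dom_measure D)) (Lf : R) (hLf : 0 <= Lf)
  (hf : forall u v, `|f u - f v| <= Lf * `|u - v|)
  (tT : R) (hT : 0 < tT)
  (beta : R) (hbeta : 0 <= beta < 1)
  (hAQ : (hs_norm e (fun v => power e lam ((beta - 1) / 2) (Qhalf v)) < +oo)%E)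
  (d : measure_display) (Om : measurableType d) (P : probability Om R)
  (u0 : Om -> L2 (dom_measure D))
  (hu0 : in_L2_Omega_power P e lam (beta / 2) u0) :
  exists C : R,
    forall (F : R -> set (set Om)) (W : R -> L2 (dom_measure D) -> Om -> R),
      normal_filtration P tT F -> Q_wiener P tT F Q W ->
    forall u : R -> Om -> L2 (dom_measure D),
      mild_solution P tT F e Qhalf W S f u0 u ->
    forall (tau : R) (un : nat -> Om -> L2 (dom_measure D)),
      0 < tau -> (0 < Lf -> tau < (2 * Lf)^-1) ->
      backward_euler P tT W (elliptic_op kappa) f u0 tau un ->
    forall n : nat, n%:R * tau <= tT ->
      (L2_Omega_norm P (fun w => u (n%:R * tau) w - un n w)%R
         <= (C * tau `^ (beta / 2))%:E)%E.
Proof.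
have [onb esum lam0 Ae lamy] := heig; have eb : orthonormal_basis e by split.
have Se := semigroup_coord eb Ae hS.
have [_ Qhs _] := hQhalf.1; have /andP[_ b1] := hbeta.
have [nQ HnQ] := hs_norm_fin eb lam0 lamy b1 Qhs hAQ.
have [l0 l0_gt0 lam_ge] := eigenvalue_lower_bound lam0 lamy.
have [E0 HE0] := initial_energy_bound eb hu0.
(* Built from the data alone. The root appears because all estimates are for mean squares. *)
exists (error_const f Lf tT beta nQ l0 E0 `^ 2^-1).
move=> F W hF hW u hu tau un tau0 tauL hun n nT.
have q1 : 2 * (tau * Lf) <= 1.
  (* For [Lf] = 0 the step restriction is void and the Gronwall condition reads 0 <= 1. *)
  move: hLf; rewrite le_eqVlt => /orP[/eqP <-|Lf0]; first by rewrite !mulr0.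
  by rewrite mulrCA -ler_pdivlMr ?mulr_gt0// mul1r; exact/ltW/tauL.
have err := scheme_error_bound eb lam0 Se hQ hQhalf hLf hf hT hbeta HnQ l0_gt0 lam_ge HE0 hF hW hu Ae tau0 hun q1 nT.
set K := error_const _ _ _ _ _ _ _ in err *.
have err0 : (0 <= mean_sq P (fun w => u (n%:R * tau) w - un n w)%R)%E.
  by apply: integral_ge0 => w _; rewrite lee_fin sqr_ge0.
(* The sign of [K] is read off the estimate itself: K tau^beta dominates a mean square. It allows
   the root of the product to be split. *)
have Ktau0 : 0 <= K * tau `^ beta by rewrite -lee_fin (le_trans err0 err).
have K0 : 0 <= K by move: Ktau0; rewrite pmulr_lge0 ?powR_gt0.
have -> : (K `^ 2^-1 * tau `^ (beta / 2))%:E = ((K * tau `^ beta)%:E `^ 2^-1)%E.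
  by rewrite poweR_EFin powRM ?powR_ge0// powRrM.
by apply: gt0_ler_poweR => //; rewrite in_itv/= leey andbT ?lee_fin.
Qed.
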